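(* Let $L$ be a linear operator on $L^2(\mathbb{R}^n)$ which generates an analytic semigroup $e^{-tL}$ whose kernel $p_t(x,y)$ satisfies, for some constants $C_0,c>0$, the Gaussian upper bound $$|p_t(x,y)|\le \frac{C_0}{t^{n/2}}e^{-c\frac{|x-y|^2}{t}}\qquad\text{for all }x,y\in\mathbb{R}^n,\ t>0.$$ Let $0<\alpha<n$, $1<p<n/\alpha$, $1/q=1/p-\alpha/n$, $0\le\kappa<p/q$, let $w$ be a weight with $w^{q/p}\in A_1$, and suppose $r_w>\frac{1-\kappa}{p/q-\kappa}$, where $r_w$ is the critical index of $w$ for the reverse Hölder condition. Let $m\ge 1$ be an integer and let $\vec b=(b_1,\dots,b_m)$ with $b_j\in BMO(w)$ for $j=1,2,\dots,m$. Then there is a constant $C>0$, independent of $f$ and $\vec b$, such that for all $f\in L^{p,\kappa}(w)$ $$\|L_{\vec b}^{-\alpha/2}f\|_{L^{q,\kappa q/p}(w^{q/p},w)}\le C\,\|\vec b\|_{BMO(w)}\,\|f\|_{L^{p,\kappa}(w)}.$$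
   Context: A weight is a locally integrable function on $\mathbb{R}^n$ with values in $(0,\infty)$ almost everywhere. For a weight $w$ and measurable $E$, $w(E)=\int_E w(x)\,dx$. Fractional integral: $L^{-\alpha/2}f(x)=\frac{1}{\Gamma(\alpha/2)}\int_0^\infty e^{-tL}f(x)\,t^{\alpha/2-1}\,dt$, where $e^{-tL}f(x)=\int_{\mathbb{R}^n}p_t(x,y)f(y)\,dy$. Its kernel is denoted $K_\alpha(x,y)$, so that $L^{-\alpha/2}f(x)=\int_{\mathbb{R}^n}K_\alpha(x,y)f(y)\,dy$. Multilinear commutator: for locally integrable functions $\vec b=(b_1,\dots,b_m)$, $L_{\vec b}^{-\alpha/2}f=[b_m,\cdots,[b_2,[b_1,L^{-\alpha/2}]]\cdots]f$, where $[b,T]f=bT(f)-T(bf)$; equivalently $$L_{\vec b}^{-\alpha/2}f(y)=\int_{\mathbb{R}^n}\prod_{j=1}^m\big(b_j(y)-b_j(z)\big)K_\alpha(y,z)f(z)\,dz.$$ Weighted Morrey spaces: for $1\le p<\infty$, $0\le\kappa<1$ and weights $u,v$, $L^{p,\kappa}(u,v)$ is the set of $f$ with $$\|f\|_{L^{p,\kappa}(u,v)}=\sup_B\Big(\frac{1}{v(B)^\kappa}\int_B|f(x)|^pu(x)\,dx\Big)^{1/p}<\infty,$$ the supremum being over all balls $B\subset\mathbb{R}^n$; and $L^{p,\kappa}(w)=L^{p,\kappa}(w,w)$. $A_1$: $w\in A_1$ if there is $C$ such that $\frac1{|B|}\int_B w(x)\,dx\le C\,\operatorname{ess\,inf}_{x\in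 B}w(x)$ for every ball $B$. Reverse Hölder class: $w\in RH_r$ ($r>1$) if there is $C>0$ with $\big(\frac1{|B|}\int_Bw^r\,dx\big)^{1/r}\le C\frac1{|B|}\int_Bw\,dx$ for every ball $B$. The critical index is $r_w=\sup\{r>1:w\in RH_r\}$. $BMO(w)$: the space of $b$ with $\|b\|_{BMO(w)}=\|b\|_{*,w}=\sup_Q\frac1{w(Q)}\int_Q|b(x)-b_{Q,w}|w(x)\,dx<\infty$, where $b_{Q,w}=\frac1{w(Q)}\int_Qb(z)w(z)\,dz$ and $Q$ ranges over cubes. Finally $\|\vec b\|_{BMO(w)}=\prod_{j=1}^m\|b_j\|_{BMO(w)}$. *)

(* Defs.v *)
From HB Require Import structures.
From mathcomp Require Import all_boot all_order all_algebra complex.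
From mathcomp Require Import all_classical all_reals all_analysis.
From mathcomp Require Import ess_sup_inf.

Set Implicit Arguments.
Unset Strict Implicit.
Unset Printing Implicit Defensive.

Import Order.TTheory GRing.Theory Num.Theory.
Import numFieldNormedType.Exports.
Import ComplexField.Normc.

Local Open Scope classical_set_scope.
Local Open Scope ring_scope.

Definition Rn (R : realType) (n : nat) := n.-tuple (measurableTypeR R).
HB.instance Definition _ (R : realType) (n : nat) := Measurable.on (Rn R n).

Section cons_measure.
Context {R : realType} (n : nat).
Variable mu : {sigma_finite_measure set (Rn R n) -> \bar R}.

Definition consRn (z : measurableTypeR R * Rn R n) : Rn R n.+1 :=
  [tuple of z.1 :: z.2].

Lemma measurable_consRn : measurable_fun [set: _] consRn.
Proof. exact: measurable_cons. Qed.

Definition cons_measure : set (Rn R n.+1) -> \bar R :=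
  pushforward ((@lebesgue_measure R) \x mu)%E consRn.

Let cons_measure_pushforward : {measure set (Rn R n.+1) -> \bar R} :=
  measure_function_pushforward__canonical__measure_function_Measure
    ((@lebesgue_measure R) \x mu)%E measurable_consRn.

HB.instance Definition _ := isMeasure.Build _ _ _ cons_measure
  (measure0 cons_measure_pushforward) (measure_ge0 cons_measure_pushforward)
  (@measure_semi_sigma_additive _ _ _ cons_measure_pushforward).

Lemma cons_measure_sigma_finite : sigma_finite setT cons_measure.
Proof.
have /sigma_finiteP[F [TF ndF Foo]] :=
  sigma_finiteT (lebesgue_measure :
    {sigma_finite_measure set (measurableTypeR R) -> \bar R}).
have /sigma_finiteP[G [TG ndG Goo]] := sigma_finiteT mu.
pose h (x : Rn R n.+1) : measurableTypeR R * Rn R n :=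
  (thead x, [tuple of behead x]).
have mh : measurable_fun [set: _] h.
  apply/measurable_fun_pair; first exact: measurable_tnth.
  exact: measurable_behead.
have hK : cancel consRn h.
  move=> [a v]; rewrite /h theadE; congr (_, _).
  exact: val_inj.
exists (fun k => h @^-1` (F k `*` G k)).
  rewrite -preimage_bigcup (_ : \bigcup_k _ = setT) ?preimage_setT//.
  rewrite predeqE => -[x y]; split=> // _.
  have [k _ Fkx] : (\bigcup_k F k) x by rewrite -TF.
  have [l _ Gly] : (\bigcup_k G k) y by rewrite -TG.
  exists (maxn k l) => //; split.
  - by move: x Fkx; exact/subsetPset/ndF/leq_maxl.
  - by move: y Gly; exact/subsetPset/ndG/leq_maxr.
move=> k; have [mFk Fk] := Foo k; have [mGk Gk] := Goo k; split.
  rewrite -[X in measurable X]setTI; apply: mh => //.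
  exact: measurableX.
rewrite /cons_measure /pushforward -comp_preimage.
rewrite (_ : h \o consRn = id) ?preimage_id; last exact/funext.
by rewrite product_measure1E// lte_mul_pinfty// ge0_fin_numE.
Qed.

HB.instance Definition _ := Measure_isSigmaFinite.Build _ _ _ cons_measure
  cons_measure_sigma_finite.

End cons_measure.

Fixpoint lebesgueRn (R : realType) (n : nat) :
    {sigma_finite_measure set (Rn R n) -> \bar R} :=
  match n with
  | 0 => dirac ([tuple] : Rn R 0)
  | m.+1 => cons_measure (lebesgueRn R m)
  end.

Section geometry.
Context {R : realType} {n : nat}.

Definition edist (x y : Rn R n) : R :=
  Num.sqrt (\sum_(i < n) (tnth x i - tnth y i) ^+ 2).

Definition eball (x : Rn R n) (r : R) : set (Rn R n) :=
  [set y | edist x y < r].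

Definition balls : set (set (Rn R n)) :=
  [set B | exists x r, 0 < r /\ B = eball x r].

Definition cubes : set (set (Rn R n)) :=
  [set Q | exists (a : Rn R n) (l : R), 0 < l /\
    Q = [set y | forall i, tnth a i < tnth y i < tnth a i + l]].

End geometry.

Section complex_integral.
Context d (T : measurableType d) (R : realType).
Implicit Types (mu : {measure set T -> \bar R}) (D : set T) (f : T -> R[i]).

Definition cmeasurable D f :=
  measurable_fun D (fun x => complex.Re (f x)) /\
  measurable_fun D (fun x => complex.Im (f x)).

Definition cintegrable mu D f :=
  mu.-integrable D (fun x => (complex.Re (f x))%:E) /\
  mu.-integrable D (fun x => (complex.Im (f x))%:E).

Definition cintegral mu D f : R[i] :=
  Complex (Rintegral mu D (fun x => complex.Re (f x)))
          (Rintegral mu D (fun x => complex.Im (f x))).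

End complex_integral.

Section weights.
Context {R : realType} {n : nat}.
Local Notation leb := (lebesgueRn R n).
Implicit Types (w u v : Rn R n -> R) (E B : set (Rn R n)).
Local Open Scope ereal_scope.

Definition loc_integrable (g : Rn R n -> R) :=
  measurable_fun setT g /\
  forall B, balls B -> \int[leb]_(x in B) `|(g x)%:E| < +oo.

Definition weight w :=
  loc_integrable w /\ {ae leb, forall x, (0 < w x)%R}.

Definition wmeasure w E : \bar R := \int[leb]_(x in E) (w x)%:E.

Definition average w B : \bar R :=
  ((fine (leb B))^-1)%:E * \int[leb]_(x in B) (w x)%:E.

(* The value +oo outside B makes the essential infimum over R^n the one over
   B. *)
Definition ess_inf_on w B : \bar R :=
  ess_inf leb (patch (cst +oo) B (EFin \o w)).

Definition A1 w := weight w /\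
  exists C : R, forall B, balls B -> average w B <= C%:E * ess_inf_on w B.

Definition reverse_Hoelder (r : R) w :=
  exists C : R, (0 < C)%R /\ forall B, balls B ->
    average (fun x => (w x) `^ r)%R B `^ r^-1 <= C%:E * average w B.

Definition critical_index w : \bar R :=
  ereal_sup [set r%:E | r in [set r : R | (1 < r)%R /\ reverse_Hoelder r w]].

End weights.

Section spaces.
Context {R : realType} {n : nat}.
Local Notation leb := (lebesgueRn R n).
Implicit Types (w u v : Rn R n -> R) (f b : Rn R n -> R[i]).
Local Open Scope ereal_scope.

Definition morrey_norm (p kappa : R) u v f : \bar R :=
  ereal_sup [set (((fine (wmeasure v B) `^ kappa)^-1)%:E *
    \int[leb]_(x in B) (normc (f x) `^ p * u x)%:E) `^ p^-1 | B in balls].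

Definition morrey (p kappa : R) u v f :=
  cmeasurable setT f /\ morrey_norm p kappa u v f < +oo.

Definition wmean w b (Q : set (Rn R n)) : R[i] :=
  (((fine (wmeasure w Q))^-1)%:C%C *
   cintegral leb Q (fun z => b z * (w z)%:C%C))%R.

Definition bmo_norm w b : \bar R :=
  ereal_sup [set ((fine (wmeasure w Q))^-1)%:E *
    \int[leb]_(x in Q) (normc (b x - wmean w b Q) * w x)%:E | Q in cubes].

Definition bmo w b :=
  [/\ cmeasurable setT b, loc_integrable (fun x => normc (b x)) &
      bmo_norm w b < +oo].

End spaces.

(* Elements of the complex space L^2(R^n) are represented by functions, so that
   identities between them are only required almost everywhere. *)

Section semigroups.
Context {R : realType} {n : nat}.
Local Notation leb := (lebesgueRn R n).
Local Notation CRn := (Rn R n -> R[i]).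
Implicit Types (f g : CRn) (T : CRn -> CRn) (S : R[i] -> CRn -> CRn).

Definition L2norm f : \bar R := Lnorm leb 2%:E (fun x => (normc (f x))%:E).

Definition L2 f := cmeasurable setT f /\ (L2norm f < +oo)%E.

Definition ceq_ae f g := {ae leb, forall x, f x = g x}.

Record operatorL2 := OperatorL2 {
  op_dom : set CRn;
  op_fun :> CRn -> CRn }.

Definition linear_operatorL2 (L : operatorL2) :=
  [/\ op_dom L (fun=> 0),
      forall f, op_dom L f -> L2 f /\ L2 (L f),
      forall f g, op_dom L f -> L2 g -> ceq_ae f g ->
        op_dom L g /\ ceq_ae (L f) (L g) &
      forall (a : R[i]) f g, op_dom L f -> op_dom L g ->
        op_dom L (fun x => a * f x + g x) /\
        ceq_ae (L (fun x => a * f x + g x)) (fun x => a * L f x + L g x)].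

Definition bounded_operatorL2 T :=
  linear_operatorL2 (OperatorL2 L2 T) /\
  exists M : R, forall f, L2 f -> (L2norm (T f) <= M%:E * L2norm f)%E.

Definition sector (theta : R) : set R[i] :=
  [set z | exists r phi : R, [/\ 0 < r, `|phi| < theta &
    z = Complex (r * cos phi) (r * sin phi)]].

Definition analytic_semigroup (theta : R) S :=
  [/\ 0 < theta <= pi / 2,
      forall z, sector theta z -> bounded_operatorL2 (S z),
      (forall f, L2 f -> ceq_ae (S 0 f) f) /\
      (forall z1 z2 f, sector theta z1 -> sector theta z2 -> L2 f ->
        ceq_ae (S (z1 + z2) f) (S z1 (S z2 f))),
      forall z, sector theta z -> exists2 S', bounded_operatorL2 S' &
        forall e : R, 0 < e -> exists2 dlt : R, 0 < dlt &
        forall h : R[i], h != 0 -> normc h < dlt -> sector theta (z + h) ->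
        forall f, L2 f ->
        (L2norm (fun x => (S (z + h) f x - S z f x) / h - S' f x)%R
          <= e%:E * L2norm f)%E &
      forall theta' : R, 0 < theta' < theta -> forall f, L2 f ->
        forall e : R, 0 < e -> exists2 dlt : R, 0 < dlt &
        forall z, sector theta' z -> normc z < dlt ->
        (L2norm (fun x => S z f x - f x)%R <= e%:E)%E].

(* g is the L^2 limit of (f - S(t) f) / t as t -> 0+ *)
Definition minus_generator_at S f g :=
  forall e : R, 0 < e -> exists2 dlt : R, 0 < dlt &
  forall t : R, 0 < t < dlt ->
  (L2norm (fun x => (f x - S t%:C%C f x) / t%:C%C - g x)%R <= e%:E)%E.

(* S(t) = exp(-tL): the generator of S, with its natural domain, is -L *)
Definition generates (L : operatorL2) S :=
  (forall f, op_dom L f <->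
    L2 f /\ exists2 g, L2 g & minus_generator_at S f g) /\
  (forall f, op_dom L f -> minus_generator_at S f (L f)).

(* Joint measurability in (t, x, y) is what gives a meaning to the integrals
   in y and then in t that define the fractional integral. *)
Definition semigroup_kernel (p : R -> Rn R n -> Rn R n -> R[i]) S :=
  cmeasurable ([set t : measurableTypeR R | 0 < t] `*` [set: Rn R n * Rn R n])
    (fun z => p z.1 z.2.1 z.2.2) /\
  forall t f, 0 < t -> L2 f ->
    ceq_ae (S t%:C%C f) (fun x => cintegral leb setT (fun y => p t x y * f y)).

Definition Gaussian_bound (C0 c : R) (p : R -> Rn R n -> Rn R n -> R[i]) :=
  forall x y t, 0 < t ->
    normc (p t x y) <=
      C0 / t `^ (n%:R / 2) * expR (- c * (edist x y ^+ 2 / t)).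

End semigroups.

Definition Gamma {R : realType} (a : R) : R :=
  Rintegral (@lebesgue_measure R) [set t | 0 < t]
    (fun t => t `^ (a - 1) * expR (- t)).

Section commutators.
Context {R : realType} {n : nat}.
Local Notation leb := (lebesgueRn R n).
Local Notation CRn := (Rn R n -> R[i]).

(* An operator whose output need not be defined everywhere: T f x = None when
   the integrals that should define T f at x do not converge absolutely. *)
Definition partial_operator := CRn -> Rn R n -> option R[i].

Definition semigroup_integral (p : R -> Rn R n -> Rn R n -> R[i])
    (t : R) (f : CRn) (x : Rn R n) : R[i] :=
  cintegral leb setT (fun y => p t x y * f y).

Definition fractional_integral (p : R -> Rn R n -> Rn R n -> R[i])
    (alpha : R) : partial_operator := fun f x =>
  let F t := semigroup_integral p t f x * (t `^ (alpha / 2 - 1))%:C%C in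
  if `[< (forall t, 0 < t -> cintegrable leb setT (fun y => p t x y * f y)) /\
         cintegrable (@lebesgue_measure R) [set t | 0 < t] F >]
  then Some ((Gamma (alpha / 2))^-1%:C%C *
             cintegral (@lebesgue_measure R) [set t | 0 < t] F)
  else None.

Definition commutator (b : CRn) (T : partial_operator) : partial_operator :=
  fun f x =>
    if T f x is Some u then
      if T (fun y => b y * f y) x is Some v then Some (b x * u - v) else None
    else None.

(* [b_m, ... [b_2, [b_1, T]] ...] *)
Definition multi_commutator (bs : seq CRn) (T : partial_operator) :
    partial_operator :=
  foldl (fun T' b => commutator b T') T bs.

End commutators.

(* Main.v *)
(* The Gaussian bound integrates to |K_alpha(x,y)| <= C |x-y|^(alpha-n), and the
   iterated commutator is the integral operator with kernel
   \prod_j (b_j(x) - b_j(y)) K_alpha(x,y).  Once each b_j has norm at most 1,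
   \prod_j |b_j(x) - b_j(y)| <= \sum_j |b_j(x) - b_j(y)|^m, so it is enough to bound
   the positive operator with kernel |b(x) - b(y)|^m |x-y|^(alpha-n) for one b.

   Write W = w dx and S = w^(q/p) dx.  A_1 and the reverse Hoelder inequality make
   both measures doubling and comparable on cubes, and give John-Nirenberg, hence all
   moments of b - b_Q, for both.  Fix a cube Q and split f at a dilate of Q.  For
   the part near Q the Morrey bound is an L^p(W) bound, and the operator is dominated
   by a sum over a dyadic grid of averages of f; pairing with h in L^(q'), Young's
   inequality with an exponent strictly between p and q separates f from h, and each
   factor is summed by cutting the function at a level depending on S(cube).
   The part away from Q is summed over the dilates 2^k Q: the reverse Hoelder
   inequality bounds W(Q)/W(2^k Q), and the series converges precisely when
   r > (1 - kappa)/(p/q - kappa).  The oscillation of b costs only polynomial factors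
   in k. *)
Require Import Defs.
From HB Require Import structures.
From mathcomp Require Import all_boot all_order all_algebra complex.
From mathcomp Require Import all_classical all_reals all_analysis.
From mathcomp Require Import measurable_realfun ess_sup_inf.
From mathcomp Require Import ring lra zify.

Set Implicit Arguments.
Unset Strict Implicit.
Unset Printing Implicit Defensive.

Import Order.TTheory GRing.Theory Num.Theory.
Import numFieldNormedType.Exports.
Import ComplexField.Normc.
Import HBSimple HBNNSimple.

Local Open Scope classical_set_scope.
Local Open Scope ring_scope.

Local Notation edist := Defs.edist.

(** The commutator is a partial operator: at a point it has a value only if every integral in its
    expansion converges absolutely. All of them are dominated by the Riesz potential of |f| prod (1
    + |b_j|), whose finiteness almost everywhere comes from the same estimate as the norm bound;
    this is why the positive kernel is 1 + |b(x) - b(y)|^m, with an extra 1. The John-Nirenberg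
    argument is run for W itself, with outer approximation of Borel sets by unions of dyadic cells
    in place of differentiation of integrals. Its centres c_Q are arbitrary numbers, so that means
    over larger open cubes can serve for half-open ones. The inequality r > q/p, used to pass from W
    to S, is contained in the condition on r_w, because (q/p)(p/q - kappa) = 1 - kappa q/p is at
    most 1 - kappa. It makes S(Q) comparable to |Q| (W(Q)/|Q|)^(q/p), and then the side lengths
    cancel in the fractional averages, since alpha/n = 1/p - 1/q. A norm may vanish, so functions
    are normalised by positive upper bounds of their norms and a limit is taken at the end. *)

Lemma le_of_eq d (T : porderType d) (x y : T) : x = y -> (x <= y)%O.
Proof. by move=> ->. Qed.

(** * Measures, series and exponents *)

Section density.
Context d (T : measurableType d) (R : realType).
Variables (mu : {measure set T -> \bar R}) (w : T -> R).
Hypotheses (mw : measurable_fun setT w) (w_ge0 : forall x, 0 <= w x).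
Local Open Scope ereal_scope.

Let dens_fun (A : set T) : \bar R := \int[mu]_(x in A) (w x)%:E.

Let dens_fun0 : dens_fun set0 = 0.
Proof. exact: integral_set0. Qed.

Let dens_fun_ge0 A : 0 <= dens_fun A.
Proof. by apply: integral_ge0 => x _; rewrite lee_fin. Qed.

Let dens_fun_sigma_additive : semi_sigma_additive dens_fun.
Proof.
move=> F mF tF mUF; rewrite /dens_fun ge0_integral_bigcup//; last 2 first.
- by exact/measurable_EFinP/measurable_funTS.
- by move=> x _; rewrite lee_fin.
apply: is_cvg_ereal_nneg_natsum => n _; exact: dens_fun_ge0.
Qed.

Let dens_subproof : {nu : {measure set T -> \bar R} |
  forall A, nu A = \int[mu]_(x in A) (w x)%:E}.
Proof.
pose nu : {measure set T -> \bar R} :=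
  HB.pack dens_fun (isMeasure.Build d T R dens_fun
    dens_fun0 dens_fun_ge0 dens_fun_sigma_additive).
by exists nu.
Qed.

(* The measure [w d mu], kept opaque so that simplification leaves it alone. *)
Definition dens : {measure set T -> \bar R} := sval dens_subproof.

Lemma densE A : dens A = \int[mu]_(x in A) (w x)%:E.
Proof. by rewrite /dens (svalP dens_subproof). Qed.

(** Both sides are monotone limits along [nnsfun_approx], so the identity reduces to a single level
    set of a simple function, where it is [densE]. *)
Lemma integral_dens (D : set T) (f : T -> \bar R) : measurable D ->
  measurable_fun D f -> (forall x, D x -> 0 <= f x) ->
  \int[dens]_(x in D) f x = \int[mu]_(x in D) (f x * (w x)%:E).
Proof.
move=> mD mf f0.
have mwD : measurable_fun D (EFin \o w).
  by exact/measurable_EFinP/measurable_funTS.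
pose f_ := nnsfun_approx mD mf.
transitivity (limn (fun n => \int[dens]_(x in D) (f_ n x)%:E)).
  rewrite -monotone_convergence//=.
  - apply: eq_integral => ? /[!inE] xD; apply/esym/cvg_lim => //=.
    exact: cvg_nnsfun_approx.
  - by move=> *; exact/measurable_EFinP/measurable_funTS.
  - by move=> *; rewrite lee_fin.
  - by move=> x _ m n mn; rewrite lee_fin; exact/lefP/nd_nnsfun_approx.
transitivity (limn (fun n => \int[mu]_(x in D) ((f_ n x)%:E * (w x)%:E))).
  congr (limn _); apply/funext => n.
  under eq_integral do rewrite fimfunE -fsumEFin//.
  rewrite ge0_integral_fsum//; last 2 first.
  - by move=> r; exact/measurable_EFinP/measurableT_comp.
  - by move=> r x _; rewrite EFinM nnfun_muleindic_ge0.
  under [in RHS]eq_integral => x _.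
    rewrite fimfunE -fsumEFin// ge0_mule_fsuml; last first.
      by move=> r; rewrite EFinM nnfun_muleindic_ge0.
    over.
  rewrite ge0_integral_fsum//; last 2 first.
  - move=> r; apply: emeasurable_funM => //.
    by apply/measurable_EFinP/measurable_funTS/measurableT_comp.
  - move=> r x _; rewrite mule_ge0//; last by rewrite lee_fin.
    by rewrite EFinM nnfun_muleindic_ge0.
  apply: eq_fsbigr => r _.
  rewrite integralZl_indic_nnsfun// integral_indic//= densE.
  (* A nonnegative simple function takes no negative value: the level set is empty and both sides
     vanish. The factor r can be extracted once it is nonnegative. *)
  have [r0|r0] := ltP r 0%R.
    rewrite preimage_nnfun0// set0I integral_set0 mule0.
    rewrite integral0_eq// => x Dx; rewrite indicE in_set0 mulr0 mul0e//.
  under [RHS]eq_integral do rewrite EFinM -muleA.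
  rewrite ge0_integralZl//; last 2 first.
  - by apply: emeasurable_funM => //; apply/measurable_EFinP/measurable_funTS/measurable_indic.
  - by move=> x _; rewrite mule_ge0// lee_fin.
  congr (_ * _).
  rewrite setIC integral_mkcondr; apply: eq_integral => x _.
  by rewrite /patch indicE; case: ifPn => _; rewrite ?mul1e ?mul0e.
rewrite -monotone_convergence//=.
- apply: eq_integral => x /[!inE] xD; apply/cvg_lim => //=.
  apply: cvgeZr => //; exact: cvg_nnsfun_approx.
- move=> n; apply: emeasurable_funM => //.
  by apply/measurable_EFinP/measurable_funTS.
- by move=> n x _; rewrite mule_ge0// lee_fin.
- move=> x _ m n mn; rewrite lee_wpmul2r ?lee_fin//.
  by exact/lefP/nd_nnsfun_approx.
Qed.

End density.

Section hoelder_on.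
Context d (T : measurableType d) (R : realType).
Variable mu : {measure set T -> \bar R}.
Local Open Scope ereal_scope.

(** Hoelder's inequality on the whole space for the extensions by zero; positive exponents make
    their powers vanish off [D]. *)
Lemma hoelder_ge0 (D : set T) (f g : T -> R) (p q : R) : measurable D ->
  measurable_fun D f -> measurable_fun D g ->
  (forall x, D x -> 0 <= f x)%R -> (forall x, D x -> 0 <= g x)%R ->
  (0 < p)%R -> (0 < q)%R -> (p^-1 + q^-1 = 1)%R ->
  \int[mu]_(x in D) (f x * g x)%:E <=
    (\int[mu]_(x in D) (f x `^ p)%:E) `^ p^-1 *
    (\int[mu]_(x in D) (g x `^ q)%:E) `^ q^-1.
Proof.
move=> mD mf mg f0 g0 p0 q0 pq.
have := @hoelder _ _ _ mu (f \_ D) (g \_ D) p q.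
move=> /(_ (proj1 (measurable_restrictT _ mD) mf)).
move=> /(_ (proj1 (measurable_restrictT _ mD) mg) p0 q0 pq).
rewrite Lnorm1 unlock.
rewrite (_ : \int[mu]_x _ = \int[mu]_(x in D) (f x * g x)%:E); last first.
  rewrite [RHS]integral_mkcond; apply: eq_integral => x _ /=; rewrite /patch.
  case: ifPn => [/set_mem Dx|_] /=; last by rewrite mulr0 normr0.
  by rewrite ger0_norm// mulr_ge0 ?f0 ?g0.
have H (h : T -> R) (r : R) : (0 < r)%R -> (forall x, D x -> 0 <= h x)%R ->
    \int[mu]_x (`|((h \_ D) x)%:E| `^ r) = \int[mu]_(x in D) (h x `^ r)%:E.
  move=> r0 h0; rewrite [RHS]integral_mkcond; apply: eq_integral => x _.
  rewrite /patch; case: ifPn => [/set_mem Dx|_] /=.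
    by rewrite ger0_norm ?h0.
  by rewrite normr0 powR0 ?gt_eqF.
by rewrite !H.
Qed.

End hoelder_on.

(** * Stopping times and outer approximation along nested countable partitions *)

Section stopping.
Context d (T : measurableType d) (R : realType) (I : countType).
Variables (mu : {measure set T -> \bar R}) (idx : nat -> T -> I).
Hypothesis mcell : forall N i, measurable [set x | idx N x = i].
Hypothesis idx_le : forall M N x y, (M <= N)%N ->
  idx N x = idx N y -> idx M x = idx M y.

Definition cell N i := [set x | idx N x = i].

Definition stopped (S : nat -> I -> Prop) := [set x | exists N, S N (idx N x)].

(** The maximal selected cells: no coarser cell through one of their points is selected. They are
    pairwise disjoint and exhaust [stopped S]. *)
Definition first_stop (S : nat -> I -> Prop) N i := S N i /\
  forall x, idx N x = i -> forall M, (M < N)%N -> ~ S M (idx M x).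

Let F (S : nat -> I -> Prop) (k : nat) : set T :=
  if @pickle_inv (nat * I)%type k is Some u then
    if `[< first_stop S u.1 u.2 >] then cell u.1 u.2 else set0
  else set0.

Let mF S k : measurable (F S k).
Proof.
rewrite /F; case: pickle_inv => [u|//]; case: ifPn => // _.
exact: mcell.
Qed.

Let trivF S : trivIset setT (F S).
Proof.
apply/trivIsetP => k k' _ _ /eqP kk'; rewrite -subset0 => x [].
rewrite /F; case E : pickle_inv => [[N i]|//]; case: ifPn => //= /asboolP[SN fN].
rewrite /cell/= => xi.
case E' : pickle_inv => [[N' i']|//]; case: ifPn => //= /asboolP[SN' fN'].
rewrite /cell/= => xi'.
have [NN'|NN'|NN'] := ltngtP N N'.
- by apply: (fN' x xi' _ NN'); rewrite xi.
- by apply: (fN x xi _ NN'); rewrite xi'.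
- apply: kk'; have := @pickle_invK (nat * I)%type k; have := @pickle_invK (nat * I)%type k';
  rewrite E E' /= => <- <-.
  by rewrite -xi -xi' NN'.
Qed.

Let bigcupF S : \bigcup_k F S k = stopped S.
Proof.
apply/seteqP; split => x.
  case=> k _; rewrite /F; case: pickle_inv => [[N i]|//]; case: ifPn => //=.
  by move=> /asboolP[SN _]; rewrite /cell/= => xi; exists N; rewrite xi.
move=> [N SN].
have exN : exists N, `[< S N (idx N x) >] by exists N; apply/asboolP.
case: (ex_minnP exN) => {SN exN}N /asboolP SN minN.
exists (pickle (N, idx N x)) => //; rewrite /F pickleK_inv /=.
case: ifPn => //= /asboolP; case; split=> // y yx M MN SM.
have : (N <= M)%N; last by rewrite leqNgt MN.
by apply/minN/asboolP; rewrite -(idx_le (ltnW MN) yx).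
Qed.

Lemma measurable_stopped S : measurable (stopped S).
Proof. by rewrite -bigcupF; apply: bigcupT_measurable. Qed.

(** The maximal cells partition the stopped set, so a comparison known on each of them adds up. This
    plays the part of a covering lemma. *)
Lemma stopped_integral_le S (g1 g2 : T -> \bar R) :
  measurable_fun setT g1 -> measurable_fun setT g2 ->
  (forall x, 0 <= g1 x)%E -> (forall x, 0 <= g2 x)%E ->
  (forall N i, first_stop S N i ->
    \int[mu]_(x in cell N i) g1 x <= \int[mu]_(x in cell N i) g2 x)%E ->
  (\int[mu]_(x in stopped S) g1 x <= \int[mu]_(x in stopped S) g2 x)%E.
Proof.
move=> mg1 mg2 g10 g20 g12; rewrite -bigcupF.
rewrite !ge0_integral_bigcup//; try exact: measurable_funTS.
apply: lee_nneseries => k *; first by apply: integral_ge0.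
rewrite /F; case: pickle_inv => [[N i]|]; last by rewrite !integral_set0.
by case: ifPn => [/asboolP/g12//|_]; rewrite !integral_set0.
Qed.

(* The open sets of the topology generated by the cells. *)
Definition cell_open (V : set T) :=
  forall x, V x -> exists N, cell N (idx N x) `<=` V.

(** Outer regularity of [mu] at [A] for the topology generated by the cells. *)
Definition outer_approx (A : set T) := forall e : R, 0 < e ->
  exists V, [/\ measurable V, cell_open V, A `<=` V & (mu (V `\` A) <= e%:E)%E].

Hypothesis mu_fin : (mu setT < +oo)%E.

Let mu_lty A : measurable A -> (mu A < +oo)%E.
Proof.
by move=> mA; apply: le_lt_trans mu_fin; apply: le_measure; rewrite ?inE.
Qed.

Lemma outer_approxI A B : measurable A -> measurable B ->
  outer_approx A -> outer_approx B -> outer_approx (A `&` B).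
Proof.
move=> mA mB oA oB e e0.
have e20 : 0 < e / 2 by rewrite divr_gt0.
have [V [mO oO AO Oe]] := oA _ e20; have [P [mP oP BP Pe]] := oB _ e20.
exists (V `&` P); split.
- exact: measurableI.
- move=> x [/oO[M xM] /oP[N xN]]; exists (maxn M N) => y yx; split.
    by apply: xM; rewrite /cell/=; apply: (idx_le (leq_maxl M N)).
  by apply: xN; rewrite /cell/=; apply: (idx_le (leq_maxr M N)).
- exact: setISS.
- rewrite (splitr e) EFinD.
  apply: (@le_trans _ _ (mu ((V `\` A) `|` (P `\` B)))).
    apply: le_measure; rewrite ?inE.
    + by apply: measurableD; exact: measurableI.
    + by apply: measurableU; exact: measurableD.
    + move=> x [[Ox Px] nAB]; have [Ax|nAx] := pselect (A x).
        by right; split => // Bx; apply: nAB.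
      by left.
  apply: le_trans (leeD Oe Pe); apply: measureU2; exact: measurableD.
Qed.

(** Finiteness of [mu] enters here: the finite intersections decrease to the full one, so one of
    them is within e/2 of it in measure, and that one is approximated within e/2 by the case of two
    sets. *)
Lemma outer_approx_bigcap (A : (set T)^nat) :
  (forall k, measurable (A k)) -> (forall k, outer_approx (A k)) ->
  outer_approx (\bigcap_k A k).
Proof.
move=> mA oA e e0.
pose B k := \bigcap_(i < k.+1) A i.
have mB k : measurable (B k) by apply: bigcap_measurable => //; exists 0%N.
have oB k : outer_approx (B k).
  elim: k => [|k IH].
    rewrite /B (_ : \bigcap_(_ < _) _ = A 0%N); first exact: oA.
    by rewrite bigcap_mkord big_ord_recl big_ord0 setIT.
  rewrite /B (_ : \bigcap_(_ < _) _ = B k `&` A k.+1).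
    exact: outer_approxI.
  by rewrite /B !bigcap_mkord big_ord_recr.
have BA : \bigcap_k B k = \bigcap_k A k.
  apply/seteqP; split=> x Bx k _; first by apply: (Bx k) => //=.
  by move=> i _; exact: Bx.
have mcap : measurable (\bigcap_k A k) by apply: bigcapT_measurable.
have e20 : 0 < e / 2 by rewrite divr_gt0.
have [k Bk] : exists k, (mu (B k `\` \bigcap_k A k) <= (e / 2)%:E)%E.
  have := @nonincreasing_cvg_mu _ _ _ mu (fun k => B k `\` \bigcap_k A k).
  move=> /(_ (mu_lty (measurableD (mB _) mcap))).
  move=> /(_ (fun k => measurableD (mB _) mcap)).
  have -> : \bigcap_n (B n `\` \bigcap_k0 A k0) = set0.
    rewrite -subset0 => x xB; have [_ +] := xB 0%N Logic.I.
    by apply; rewrite -BA => k _; have [] := xB k Logic.I.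
  rewrite measure0 => /(_ measurable0).
  have nd : nonincreasing_seq (fun k => B k `\` \bigcap_k A k).
    move=> m n mn; apply/subsetPset; apply: setSD => x Bx i/= im.
    by apply: Bx => /=; exact: leq_trans mn.
  move=> /(_ nd) /= /fine_cvgP[_ /cvgrPdist_le/(_ _ e20)[k _ /(_ k (leqnn k))]].
  rewrite sub0r normrN => H; exists k.
  rewrite -[leLHS]fineK; last by rewrite ge0_fin_numE// mu_lty//; exact: measurableD.
  by rewrite lee_fin (le_trans (ler_norm _)).
have [V [mO oO BO Oe]] := oB k _ e20.
exists V; split => //; first by apply: subset_trans BO; rewrite -BA => x; exact.
rewrite (splitr e) EFinD; apply: le_trans (leeD Oe Bk).
apply: (@le_trans _ _ (mu ((V `\` B k) `|` (B k `\` \bigcap_k A k)))); last first.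
  by apply: measureU2; exact: measurableD.
apply: le_measure; rewrite ?inE; [exact: measurableD|by apply: measurableU; exact: measurableD|].
by move=> x [Ox nA]; have [Bx|nB] := pselect (B k x); [right|left].
Qed.

Lemma outer_approx_bigcup (A : (set T)^nat) :
  (forall k, measurable (A k)) -> (forall k, outer_approx (A k)) ->
  outer_approx (\bigcup_k A k).
Proof.
move=> mA oA e e0.
have /choice[V HO] : forall k, exists V, [/\ measurable V, cell_open V,
    A k `<=` V & (mu (V `\` A k) <= (e / (2 ^ k.+1)%:R)%:E)%E].
  by move=> k; apply: oA; rewrite divr_gt0// ltr0n expn_gt0.
exists (\bigcup_k V k); split.
- by apply: bigcupT_measurable => k; case: (HO k).
- move=> x [k _ Ox]; case: (HO k) => _ oO _ _; have [N xN] := oO _ Ox.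
  by exists N; apply: (subset_trans xN); exact: bigcup_sup.
- by apply: subset_bigcup => k _; case: (HO k).
- apply: (@le_trans _ _ (mu (\bigcup_k (V k `\` A k)))).
    apply: le_measure; rewrite ?inE.
    + apply: measurableD; apply: bigcupT_measurable => // k.
      by case: (HO k).
    + by apply: bigcupT_measurable => k; apply: measurableD => //; case: (HO k).
    + move=> x [[k _ Ox] nA]; exists k => //; split => // Ax; apply: nA.
      by exists k.
  have mVA k : measurable (V k `\` A k).
    by apply: measurableD => //; case: (HO k).
  apply: le_trans.
    by apply: (@measure_sigma_subadditive _ _ _ mu _ (fun k => V k `\` A k)) => //;
      exact: bigcupT_measurable.
  apply: (@le_trans _ _ (\sum_(k <oo) (0 + (e / (2 ^ k.+1)%:R)%:E))%E).
    by apply: lee_nneseries => // k _; rewrite add0e; case: (HO k).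
  apply: le_trans (epsilon_trick _ _ (ltW e0)) _ => //.
  by rewrite eseries0// add0e.
Qed.

(** Asking for approximation of the complement too makes stability under complements automatic; for
    a union, the complement is a countable intersection, treated by [outer_approx_bigcap]. *)
Lemma outer_approx_sigma_algebra :
  sigma_algebra setT [set A | [/\ measurable A, outer_approx A & outer_approx (~` A)]].
Proof.
split => /=.
- split => // e e0; first by exists set0; split => //; rewrite set0D measure0 lee_fin ltW.
  by exists setT; split => //; [exists 0%N|rewrite setC0 setDv measure0 lee_fin ltW].
- by move=> A [mA oA oCA]; rewrite setTD; split => //; [exact: measurableC|rewrite setCK].
- move=> A HA; split.
  + by apply: bigcupT_measurable => k; case: (HA k).
  + by apply: outer_approx_bigcup => k; case: (HA k).
  + rewrite setC_bigcup; apply: outer_approx_bigcap => k; case: (HA k) => // mA _ _.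
    exact: measurableC.
Qed.

End stopping.

(** * Inequalities for real powers, geometric series and dyadic layers *)

Section real_bounds.
Context (R : realType).
Implicit Types (a r t u v x y z : R).

(** This is [ln y < y] at y = z e / t, multiplied by t and exponentiated; the constant is explicit
    but not sharp. *)
Lemma powR_le_expR t e z : 0 < t -> 0 < e -> 0 <= z ->
  z `^ t <= (t / e) `^ t * expR (e * z).
Proof.
move=> t0 e0; rewrite le_eqVlt => /predU1P[<-|z0].
  by rewrite powR0 ?gt_eqF// mulr_ge0 ?powR_ge0 ?expR_ge0.
have te : 0 < t / e by rewrite divr_gt0.
have zE : z = (t / e) * (z * e / t) by field; rewrite !gt_eqF.
have y0 : 0 < z * e / t by rewrite divr_gt0// mulr_gt0.
rewrite {1}zE (powRM _ (ltW te) (ltW y0)); apply: ler_wpM2l; first exact: powR_ge0.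
rewrite /powR gt_eqF// ler_expR.
have := ltW (ln_sublinear y0); rewrite -(ler_pM2l t0) => /le_trans; apply.
by rewrite (_ : t * _ = e * z)//; field; rewrite gt_eqF.
Qed.

Lemma powRN_lt1 a : 0 < a -> (0 : R) <= 2 `^ (- a) < 1.
Proof.
move=> a0; rewrite powR_ge0/= powRN invf_lt1 ?powR_gt0//.
have := @gt0_ltr_powR R a a0 1 2; rewrite powR1; apply; rewrite ?nnegrE//.
by rewrite ltr1n.
Qed.

Lemma powR_gt0_le t x y : 0 <= t -> 0 <= x -> x <= y -> x `^ t <= y `^ t.
Proof.
move=> t0 x0 xy; apply: ge0_ler_powR; rewrite ?nnegrE//.
exact: le_trans xy.
Qed.

Lemma powR_le0_le t x y : t <= 0 -> 0 < x -> x <= y -> y `^ t <= x `^ t.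
Proof.
move=> t0 x0 xy; have y0 : 0 < y by exact: lt_le_trans xy.
rewrite -[t]opprK !(powRN _ (- t)) lef_pV2 ?posrE ?powR_gt0//.
by apply: powR_gt0_le; [rewrite oppr_ge0|exact: ltW|].
Qed.

Lemma powR_addr_le t u v : 0 <= t -> 0 <= u -> 0 <= v ->
  (u + v) `^ t <= 2 `^ t * (u `^ t + v `^ t).
Proof.
move=> t0; wlog uv : u v / u <= v => [H|] u0 v0.
  by have /orP[/H|/H] := le_total u v; [exact|rewrite addrC [X in _ * X]addrC; exact].
apply: (@le_trans _ _ ((2 * v) `^ t)).
  by apply: powR_gt0_le => //; [exact: addr_ge0|rewrite mulr_natl mulr2n lerD].
rewrite powRM// ler_wpM2l ?powR_ge0// lerDr powR_ge0//.
Qed.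

Lemma nneseries_ge_term (u : (\bar R)^nat) k : (forall n, 0 <= u n)%E ->
  (u k <= \sum_(n <oo) u n)%E.
Proof.
move=> u0; apply: le_trans (nneseries_lim_ge k.+1 _); last by [].
by rewrite big_nat_recr//= leeDr// sume_ge0.
Qed.

Lemma nneseries_le (u : (\bar R)^nat) M : (forall n, 0 <= u n)%E ->
  (forall n, \sum_(k < n) u k <= M)%E -> (\sum_(n <oo) u n <= M)%E.
Proof.
move=> u0 uM; apply: lime_le; first exact: is_cvg_nneseries.
by apply: nearW => n; rewrite big_mkord.
Qed.

Lemma nneseries_geometric_le a r : 0 <= a -> 0 <= r < 1 ->
  (\sum_(k <oo) (a * r ^+ k)%:E <= (a / (1 - r))%:E)%E.
Proof.
move=> a0 /andP[r0 r1]; apply: nneseries_le => n.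
  by rewrite lee_fin mulr_ge0// exprn_ge0.
rewrite sumEFin lee_fin.
have := @geometric_seriesE _ a r (negbT (lt_eqF r1)) => /(congr1 (fun f => f n)) /=.
rewrite /series/= big_mkord => ->.
have r10 : 0 < 1 - r by rewrite subr_gt0.
by rewrite ler_pM2r ?invr_gt0// ler_piMr// gerBl exprn_ge0.
Qed.

(** With e = - ln r / 2, half of the decay of r^k absorbs the polynomial factor and the other half
    leaves a geometric series of ratio exp(-e), the square root of r. *)
Lemma poly_geometric_series t r : 0 <= t -> 0 < r < 1 -> exists C, 0 < C /\
  (\sum_(k <oo) (k.+1%:R `^ t * r ^+ k)%:E <= C%:E)%E.
Proof.
move=> t0 /andP[r0 r1].
(* [powR_le_expR] asks for a positive exponent; otherwise the series is dominated by the one with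
   exponent t + 1. *)
wlog t1 : t t0 / 0 < t => [H|].
  have [C [C0 HC]] := H (t + 1) (addr_ge0 t0 ler01) (ltr_wpDl t0 ltr01).
  exists C; split => //; apply: le_trans HC; apply: lee_nneseries => k *.
    by rewrite lee_fin mulr_ge0 ?powR_ge0// exprn_ge0// ltW.
  rewrite lee_fin ler_wpM2r ?exprn_ge0 ?(ltW r0)//.
  by apply: ler_powR; rewrite ?ler1n// lerDl.
pose e := - ln r / 2.
have e0 : 0 < e by rewrite divr_gt0// oppr_gt0 ln_lt0// r0.
pose C1 := (t / e) `^ t * expR e.
have C10 : 0 < C1 by rewrite mulr_gt0 ?expR_gt0// powR_gt0// divr_gt0.
pose r2 := expR (- e).
have r2lt : 0 <= r2 < 1 by rewrite expR_ge0/= expR_lt1 oppr_lt0.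
exists (C1 / (1 - r2)); split.
  by rewrite divr_gt0// subr_gt0; case/andP: r2lt.
apply: le_trans (nneseries_geometric_le (ltW C10) r2lt).
apply: lee_nneseries => k *.
  by rewrite lee_fin mulr_ge0 ?powR_ge0// exprn_ge0// ltW.
rewrite lee_fin.
have := @powR_le_expR t e k.+1%:R t1 e0 (ler0n _ _).
have rk : 0 <= r ^+ k by rewrite exprn_ge0 ?ltW.
move=> /(ler_wpM2r rk) /le_trans; apply.
have rE : r ^+ k = expR (- e - e) ^+ k.
  by rewrite /e -opprD -splitr opprK lnK.
rewrite /C1 {C10 C1}; clearbody e.
rewrite -!mulrA ler_wpM2l ?powR_ge0//; apply: le_of_eq.
rewrite rE.
rewrite /r2.
rewrite -!expRM_natr -!expRD; congr expR; rewrite -natr1; ring.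
Qed.

(** Here the closed end is on the right, in [dyadic_below] on the left. The first is applied to size
    over threshold and the second to threshold over size, so both yield layers open below and closed
    above. *)
Lemma dyadic_above y : 1 < y -> exists l, 2 ^+ l < y <= 2 ^+ l.+1.
Proof.
move=> y1.
have exN : exists N, y <= 2 ^+ N.+1.
  exists (Num.bound y); apply: ltW; apply: lt_le_trans (archi_boundP _) _.
    by rewrite ltW// (lt_trans _ y1).
  rewrite -natrX ler_nat; apply: ltnW; apply: ltn_trans (ltn_expl _ (ltnSn 1)) _.
  by rewrite ltn_exp2l.
case: (ex_minnP exN) => -[|l] yl minl; first by exists 0%N; rewrite expr0 y1.
exists l.+1; rewrite yl andbT ltNge; apply/negP => /minl.
by rewrite ltnn.
Qed.

Lemma dyadic_below y : 1 <= y -> exists l, 2 ^+ l <= y < 2 ^+ l.+1.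
Proof.
move=> y1.
have exN : exists N, y < 2 ^+ N.+1.
  exists (Num.bound y); apply: lt_le_trans (archi_boundP _) _.
    by rewrite (le_trans _ y1).
  rewrite -natrX ler_nat; apply: ltnW; apply: ltn_trans (ltn_expl _ (ltnSn 1)) _.
  by rewrite ltn_exp2l.
case: (ex_minnP exN) => -[|l] yl minl; first by exists 0%N; rewrite expr0 y1.
exists l.+1; rewrite yl andbT leNgt; apply/negP => /minl.
by rewrite ltnn.
Qed.

Section layers.
Variables (s : nat -> R) (P : nat -> bool) (N0 : R).
Hypothesis count : forall t, 0 < t ->
  (\sum_(i <oo) (P i && (t < s i <= 2 * t))%:R%:E <= N0%:E :> \bar R)%E.

Let N00 : 0 <= N0.
Proof. by rewrite -lee_fin (le_trans _ (count ltr01))// nneseries_ge0. Qed.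

(** Each nonzero term is charged to one dyadic layer of sizes. After exchanging the sums, layer l
    contributes at most [N0] times its bound [c l]. *)
Let layers_le (u : nat -> \bar R) (c b : nat -> R) M :
  (forall l, 0 <= c l) -> (forall l, 0 < b l) ->
  (forall i, 0 <= u i)%E ->
  (forall i, (u i <= 0)%E \/
    exists2 l, (u i <= (c l)%:E)%E & P i && (b l < s i <= 2 * b l)) ->
  (\sum_(l <oo) (c l)%:E <= M%:E)%E ->
  (\sum_(i <oo) u i <= (M * N0)%:E)%E.
Proof.
move=> c0 b0 u0 ub cM.
pose a (i l : nat) : \bar R :=
  ((c l)%:E * (P i && (b l < s i <= 2 * b l)%R)%:R%:E)%E.
have a0 i l : (0 <= a i l)%E by rewrite mule_ge0// lee_fin.
apply: (@le_trans _ _ (\sum_(i <oo) \sum_(l <oo) a i l)%E).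
  apply: lee_nneseries => // i _; have [/le_trans|[l ul Pl]] := ub i.
    by apply; exact: nneseries_ge0.
  apply: le_trans (nneseries_ge_term l (a0 i)).
  by rewrite /a Pl mule1.
rewrite nneseries_interchange//.
apply: (@le_trans _ _ (\sum_(l <oo) (N0%:E * (c l)%:E))%E).
  apply: lee_nneseries => [l _ _|l _]; first by apply: nneseries_ge0 => *; exact: a0.
  rewrite /a nneseriesZl// muleC lee_wpmul2r ?lee_fin// count//.
rewrite nneseriesZl => [|l _]; last by rewrite lee_fin.
by rewrite mulrC EFinM lee_wpmul2l.
Qed.

(** The layers below [T] form a geometric series of ratio 2^(-a), so the sum is comparable to its
    largest possible term. *)
Lemma layers_small a T : 0 < a -> 0 <= T -> (forall i, 0 <= s i) ->
  (\sum_(i <oo) (if P i && (s i <= T)%R then s i `^ a else 0)%:E <=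
    (T `^ a / (1 - 2 `^ (- a)) * N0)%:E)%E.
Proof.
(* A zero threshold does occur: a negative power of 0 is 0 for [powR], and [T] will be such a power
   of a function that may vanish. *)
move=> a0 T0 s0; have [T00|Tn0] := eqVneq T 0.
  rewrite eseries0 => [|i _ _]; last first.
    case: ifPn => // /andP[_ sT].
    have -> : s i = 0 by apply/eqP; rewrite eq_le s0 andbT -T00.
    by rewrite powR0 ?gt_eqF.
  by rewrite T00 powR0 ?gt_eqF// !mul0r.
have {Tn0}T1 : 0 < T by rewrite lt0r Tn0.
have r01 : 0 <= 2 `^ (- a) < 1.
  exact: powRN_lt1.
apply: (@layers_le _ (fun l => T `^ a * (2 `^ (- a)) ^+ l) (fun l => T / 2 ^+ l.+1)).
- by move=> l; rewrite mulr_ge0 ?powR_ge0// exprn_ge0// powR_ge0.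
- by move=> l; rewrite divr_gt0// exprn_gt0.
- by move=> i; case: ifPn => // _; rewrite lee_fin powR_ge0.
- move=> i; case: ifPn => [/andP[Pi sT]|_]; last by left.
  have [si0|sin0] := eqVneq (s i) 0; first by left; rewrite si0 powR0 ?gt_eqF.
  have si : 0 < s i by rewrite lt0r sin0 s0.
  right; have [|l /andP[ly yl]] := @dyadic_below (T / s i).
    by rewrite ler_pdivlMr// mul1r.
  have p2 k : 0 < 2 ^+ k :> R by rewrite exprn_gt0.
  have sl : s i <= T / 2 ^+ l by rewrite ler_pdivlMr// mulrC -ler_pdivlMr.
  exists l.
    rewrite lee_fin powRN exprVn -(powR_mulrn l (powR_ge0 _ _)) -powRrM mulrC.
    rewrite (mulrC a) powRrM powR_mulrn// mulrC -powR_inv1 ?powR_ge0//.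
    have e0 : (0 : R) <= 2 ^+ l by rewrite exprn_ge0.
    rewrite powRAC powR_inv1// -powRM ?invr_ge0//.
    by apply: powR_gt0_le => //; exact: ltW.
  rewrite Pi /= exprS; apply/andP; split.
    rewrite ltr_pdivrMr ?mulr_gt0// mulrC -ltr_pdivrMr//.
    by move: yl; rewrite exprS.
  by rewrite (_ : 2 * _ = T / 2 ^+ l)//; field; rewrite gt_eqF.
- exact: (nneseries_geometric_le (powR_ge0 _ _)).
Qed.

Lemma layers_large a T : 0 < a -> 0 < T ->
  (\sum_(i <oo) (if P i && (T < s i)%R then s i `^ (- a) else 0)%:E <=
    (T `^ (- a) / (1 - 2 `^ (- a)) * N0)%:E)%E.
Proof.
move=> a0 T0.
have r01 : 0 <= 2 `^ (- a) < 1.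
  exact: powRN_lt1.
apply: (@layers_le _ (fun l => T `^ (- a) * (2 `^ (- a)) ^+ l) (fun l => T * 2 ^+ l)).
- by move=> l; rewrite mulr_ge0 ?powR_ge0// exprn_ge0// powR_ge0.
- by move=> l; rewrite mulr_gt0// exprn_gt0.
- by move=> i; case: ifPn => // _; rewrite lee_fin powR_ge0.
- move=> i; case: ifPn => [/andP[Pi sT]|_]; last by left.
  have si : 0 < s i by exact: lt_trans sT.
  right; have [|l /andP[ly yl]] := @dyadic_above (s i / T).
    by rewrite ltr_pdivlMr// mul1r.
  have p2 k : 0 < 2 ^+ k :> R by rewrite exprn_gt0.
  have sl : T * 2 ^+ l < s i by rewrite mulrC -ltr_pdivlMr.
  exists l.
    rewrite lee_fin -(powR_mulrn l (powR_ge0 _ _)) powRAC powR_mulrn//.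
    rewrite -(powRM _ (ltW T0) (ltW (p2 l))).
    apply: powR_le0_le; [by rewrite oppr_le0 ltW|by rewrite mulr_gt0|exact: ltW].
  rewrite Pi sl/=.
  by rewrite mulrCA -exprS mulrC -ler_pdivrMr.
- exact: (nneseries_geometric_le (powR_ge0 _ _)).
Qed.

End layers.

End real_bounds.

Section jensen.
Context d (T : measurableType d) (R : realType).
Variable mu : {measure set T -> \bar R}.
Local Open Scope ereal_scope.

Lemma le_poweR (x y : \bar R) (r : R) : (0 <= r)%R -> 0 <= x -> x <= y ->
  x `^ r <= y `^ r.
Proof.
move=> r0 x0 xy; apply: gt0_ler_poweR => //; rewrite in_itv/= leey andbT//.
exact: le_trans xy.
Qed.

Lemma measurable_powR_comp (D : set T) (f : T -> R) (r : R) :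
  measurable_fun D f -> measurable_fun D (fun x => (f x `^ r)%:E).
Proof.
by move=> mf; apply/measurable_EFinP; apply: (measurableT_comp (measurable_powR r)).
Qed.

(** Hoelder's inequality against the constant 1. The mass of [D] stays as a factor instead of being
    divided out, which avoids distinguishing null sets. *)
Lemma integral_powR_le (D : set T) (f : T -> R) (t : R) : measurable D ->
  measurable_fun D f -> (forall x, D x -> 0 <= f x)%R -> (1 < t)%R ->
  (\int[mu]_(x in D) (f x)%:E) `^ t <=
  \int[mu]_(x in D) (f x `^ t)%:E * mu D `^ (t - 1).
Proof.
move=> mD mf f0 t1; have t0 : (0 < t)%R by exact: lt_trans t1.
have t10 : (0 < t - 1)%R by rewrite subr_gt0.
have := @hoelder_ge0 _ _ _ mu D f (cst 1%R) t (t / (t - 1)) mD mf.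
move=> /(_ (measurable_cst _) f0 (fun _ _ => ler01) t0 (divr_gt0 t0 t10)).
have -> : (t^-1 + (t / (t - 1))^-1 = 1)%R by field; rewrite !gt_eqF.
move=> /(_ erefl) H.
apply: le_trans (le_poweR (ltW t0) (integral_ge0 _ _) (le_trans _ H)) _.
- by move=> x Dx; rewrite lee_fin f0.
- by apply: le_of_eq; apply: eq_integral => x _; rewrite mulr1.
have -> : \int[mu]_(x in D) (cst 1%R x `^ (t / (t - 1)))%:E = mu D.
  under eq_integral do rewrite /= powR1.
  by rewrite integral_cst// mul1e.
rewrite poweRM ?poweR_ge0// -!poweRrM mulVf ?gt_eqF// poweRe1; last first.
  by apply: integral_ge0 => x Dx; rewrite lee_fin powR_ge0.
by rewrite (_ : (_ * t = t - 1)%R)//; field; rewrite !gt_eqF.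
Qed.

End jensen.

(** * An embedding for averages over sets with bounded overlap at each size *)

Section embedding.
Context d (T : measurableType d) (R : realType).
Variables (mu : {measure set T -> \bar R}) (Q : nat -> set T) (s : nat -> R).
Variables (N0 e p r : R).
Hypotheses (mQ : forall i, measurable (Q i)) (muQ : forall i, mu (Q i) = (s i)%:E).
Hypothesis overlap : forall x t, 0 < t ->
  (\sum_(i <oo) ((x \in Q i) && (t < s i <= 2 * t)%R)%:R%:E <= N0%:E :> \bar R)%E.
Hypotheses (N00 : 0 <= N0) (e1 : 1 <= e) (ep : e < p) (pr : p < r).

Let s0 i : 0 <= s i.
Proof. by rewrite -lee_fin -muQ. Qed.

Let e0 : 0 < e. Proof. exact: lt_le_trans e1. Qed.
Let p0 : 0 < p. Proof. exact: lt_trans ep. Qed.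
Let r0 : 0 < r. Proof. exact: lt_trans pr. Qed.
Let a1 := r / p - 1.
Let a2 := 1 - e / p.
Let a10 : 0 < a1. Proof. by rewrite subr_gt0 ltr_pdivlMr// mul1r. Qed.
Let a20 : 0 < a2. Proof. by rewrite subr_gt0 ltr_pdivrMr// mul1r. Qed.
Let re : 1 < r / e. Proof. by rewrite ltr_pdivlMr// mul1r (lt_trans ep). Qed.

Section fixed_function.
Variable g : T -> R.
Hypotheses (mg : measurable_fun setT g) (g0 : forall x, 0 <= g x).
Hypothesis gp : (\int[mu]_x (g x `^ p)%:E <= 1)%E.

(** The cut is at g = s_i^(-1/p), the natural level of a function whose p-th power has integral at
    most 1, on a set of measure s_i. Where g vanishes, its power -p is 0 and not infinite, so for
    s_i > 0 the point falls on the wrong side; the terms carry a positive power of g, so nothing is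
    lost. *)
Let Z i := [set x | s i <= g x `^ (- p)].

Let mZ i : measurable (Z i).
Proof.
have := @measurable_fun_le _ _ R setT (cst (s i)) (fun x => g x `^ (- p)).
move=> /(_ measurableT (measurable_cst _)).
move=> /(_ (measurableT_comp (measurable_powR _) mg)); rewrite setTI; exact.
Qed.

Let phi1 i x := (if (x \in Q i) && (s i <= g x `^ (- p)) then s i `^ a1 else 0) * g x `^ r.
Let phi2 i x := (if (x \in Q i) && (g x `^ (- p) < s i) then s i `^ (- a2) else 0) * g x `^ e.

Let phi1E i x : phi1 i x = ((fun y => s i `^ a1 * g y `^ r) \_ (Q i `&` Z i)) x.
Proof.
rewrite /phi1 /patch in_setI (_ : (x \in Z i) = (s i <= g x `^ (- p))).
  by case: ifPn => // _; rewrite mul0r.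
by apply/idP/idP; rewrite inE.
Qed.

Let phi2E i x : phi2 i x = ((fun y => s i `^ (- a2) * g y `^ e) \_ (Q i `\` Z i)) x.
Proof.
rewrite /phi2 /patch in_setD (_ : (x \in Z i) = (s i <= g x `^ (- p))).
  by rewrite -ltNge; case: ifPn => // _; rewrite mul0r.
by apply/idP/idP; rewrite inE.
Qed.

Let mgp D t : measurable_fun D (fun x => (g x `^ t)%:E).
Proof. by apply: measurable_powR_comp; exact: measurable_funTS. Qed.

Let int_phi1 i :
  (\int[mu]_x (phi1 i x)%:E = (s i `^ a1)%:E * \int[mu]_(x in Q i `&` Z i) (g x `^ r)%:E)%E.
Proof.
rewrite -ge0_integralZl//; last 3 first.
- exact: measurableI.
- by move=> x _; rewrite lee_fin powR_ge0.
- by rewrite lee_fin powR_ge0.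
rewrite [RHS]integral_mkcond; apply: eq_integral => x _.
by rewrite phi1E /patch; case: ifPn.
Qed.

Let int_phi2 i :
  (\int[mu]_x (phi2 i x)%:E = (s i `^ (- a2))%:E * \int[mu]_(x in Q i `\` Z i) (g x `^ e)%:E)%E.
Proof.
rewrite -ge0_integralZl//; last 3 first.
- exact: measurableD.
- by move=> x _; rewrite lee_fin powR_ge0.
- by rewrite lee_fin powR_ge0.
rewrite [RHS]integral_mkcond; apply: eq_integral => x _.
by rewrite phi2E /patch; case: ifPn.
Qed.

Let phi1_ge0 i x : 0 <= phi1 i x.
Proof. by rewrite mulr_ge0 ?powR_ge0//; case: ifPn => // _; exact: powR_ge0. Qed.

Let phi2_ge0 i x : 0 <= phi2 i x.
Proof. by rewrite mulr_ge0 ?powR_ge0//; case: ifPn => // _; exact: powR_ge0. Qed.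

Let mphi1 i : measurable_fun setT (fun x => (phi1 i x)%:E).
Proof.
apply/measurable_EFinP.
have -> : phi1 i = (fun y => s i `^ a1 * g y `^ r) \_ (Q i `&` Z i).
  by apply/funext => x; rewrite phi1E.
apply/(measurable_restrictT _ _).1; first exact: measurableI.
by apply: measurable_funM => //; apply/measurable_EFinP; exact: mgp.
Qed.

Let mphi2 i : measurable_fun setT (fun x => (phi2 i x)%:E).
Proof.
apply/measurable_EFinP.
have -> : phi2 i = (fun y => s i `^ (- a2) * g y `^ e) \_ (Q i `\` Z i).
  by apply/funext => x; rewrite phi2E.
apply/(measurable_restrictT _ _).1; first exact: measurableD.
by apply: measurable_funM => //; apply/measurable_EFinP; exact: mgp.
Qed.

Let gpQ (D : set T) : measurable D -> (\int[mu]_(x in D) (g x `^ p)%:E <= 1)%E.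
Proof.
move=> mD; apply: le_trans gp; apply: ge0_subset_integral => //.
by move=> x _; rewrite lee_fin powR_ge0.
Qed.

(** Below the level, Jensen's inequality with exponent r/e raises g^e to g^r. Above it, g^e <=
    s_i^(1 - e/p) g^p bounds [B] by s_i^(1 - e/p); one factor [B] is kept as an integral and only
    its power r/e - 1 is estimated. *)
Let term_le i : ((s i `^ (r / p) *
    ((s i)^-1 * fine (\int[mu]_(x in Q i) (g x `^ e)%:E)) `^ (r / e))%:E <=
  (2 `^ (r / e))%:E * (\int[mu]_x (phi1 i x)%:E + \int[mu]_x (phi2 i x)%:E))%E.
Proof.
have [si0|sin0] := eqVneq (s i) 0.
  rewrite si0 powR0 ?mul0r; last by rewrite gt_eqF// divr_gt0.
  rewrite mule_ge0 ?lee_fin ?powR_ge0// adde_ge0// integral_ge0// => x _.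
    by rewrite lee_fin.
  by rewrite lee_fin.
have si : 0 < s i by rewrite lt0r sin0 s0.
have mA : measurable (Q i `&` Z i) by exact: measurableI.
have mB : measurable (Q i `\` Z i) by exact: measurableD.
have gt_ge0 t x : (0 <= (g x `^ t)%:E)%E by rewrite lee_fin powR_ge0.
have fin (D : set T) : measurable D -> D `<=` Q i ->
    (\int[mu]_(x in D) (g x `^ e)%:E)%E \is a fin_num.
  move=> mD DQ; rewrite ge0_fin_numE; last exact: integral_ge0.
  apply: (@le_lt_trans _ _ (\int[mu]_(x in D) (1 + (g x `^ p)%:E))%E).
    apply: ge0_le_integral => //.
    - by apply: emeasurable_funD.
    - move=> x _; rewrite -EFinD lee_fin; have [g1|g1] := leP (g x) 1.
        apply: (@le_trans _ _ 1); last by rewrite lerDl powR_ge0.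
        by have := powR_gt0_le (ltW e0) (g0 x) g1; rewrite powR1.
      by rewrite ler_wpDl//; apply: ler_powR; rewrite ltW.
  rewrite ge0_integralD// integral_cst// mul1e lte_add_pinfty//.
    apply: (@le_lt_trans _ _ (mu (Q i))); first by apply: le_measure; rewrite ?inE.
    by rewrite muQ ltry.
  by apply: le_lt_trans (gpQ mD) _; rewrite ltry.
pose A := fine (\int[mu]_(x in Q i `&` Z i) (g x `^ e)%:E).
pose B := fine (\int[mu]_(x in Q i `\` Z i) (g x `^ e)%:E).
have AE : (\int[mu]_(x in Q i `&` Z i) (g x `^ e)%:E)%E = A%:E.
  by rewrite fineK// fin// => x [].
have BE : (\int[mu]_(x in Q i `\` Z i) (g x `^ e)%:E)%E = B%:E.
  by rewrite fineK// fin// => x [].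
have A0 : 0 <= A by rewrite fine_ge0// integral_ge0.
have B0 : 0 <= B by rewrite fine_ge0// integral_ge0.
have ABE : fine (\int[mu]_(x in Q i) (g x `^ e)%:E) = A + B.
  rewrite -[in LHS](setUIDK (Q i) (Z i)) ge0_integral_setU//; first by rewrite AE BE.
  by apply/disj_set2P; rewrite setDE setIACA setICr setI0.
rewrite ABE int_phi1 int_phi2 BE.
have Bs : B <= s i `^ a2.
  rewrite -lee_fin -BE.
  apply: (@le_trans _ _ (\int[mu]_(x in Q i `\` Z i) ((s i `^ a2)%:E * (g x `^ p)%:E))%E).
    apply: ge0_le_integral => //.
    - by apply: measurable_funeM.
    - move=> x [_ /negP]; rewrite -ltNge => gs; rewrite -EFinM lee_fin.
      have [gx0|gxn0] := eqVneq (g x) 0.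
        by rewrite gx0 powR0 ?gt_eqF// mulr_ge0 ?powR_ge0.
      have gx : 0 < g x by rewrite lt0r gxn0 g0.
      rewrite (_ : g x `^ e = (g x `^ (- p)) `^ a2 * g x `^ p).
        by rewrite ler_wpM2r ?powR_ge0// powR_gt0_le ?powR_ge0// ltW.
      rewrite -powRrM -powRD; first by congr (_ `^ _); rewrite /a2; field; rewrite gt_eqF.
      by rewrite gxn0 implybT.
  rewrite ge0_integralZl_EFin//; last exact: powR_ge0.
  by rewrite -[leRHS]mule1 lee_wpmul2l ?lee_fin ?powR_ge0// gpQ.
rewrite mulrDr.
apply: (@le_trans _ _ (2 `^ (r / e) * (s i `^ (r / p) * ((s i)^-1 * A) `^ (r / e) +
     s i `^ (r / p) * ((s i)^-1 * B) `^ (r / e)))%:E).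
  rewrite lee_fin -[X in _ <= _ * X]mulrDr [X in _ <= X]mulrCA ler_wpM2l ?powR_ge0//.
  by apply: powR_addr_le; rewrite ?mulr_ge0 ?invr_ge0// ltW// (lt_trans _ re).
rewrite EFinM lee_wpmul2l ?lee_fin ?powR_ge0// EFinD leeD//.
  have H := @integral_powR_le _ _ _ mu (Q i `&` Z i) (fun x => g x `^ e) (r / e) mA.
  have mge : measurable_fun (Q i `&` Z i) (fun x => g x `^ e).
    by apply/measurable_EFinP; exact: mgp.
  have {}H := H mge (fun _ _ => powR_ge0 _ _) re.
  rewrite AE poweR_EFin in H.
  have eE : (\int[mu]_(x in Q i `&` Z i) ((g x `^ e) `^ (r / e))%:E =
      \int[mu]_(x in Q i `&` Z i) (g x `^ r)%:E)%E.
    apply: eq_integral => x _; rewrite -powRrM mulrCA divff ?mulr1//.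
    by rewrite gt_eqF.
  rewrite {}eE in H.
  rewrite (_ : s i `^ (r / p) * _ = s i `^ (r / p - r / e) * A `^ (r / e)); last first.
    by rewrite powRM ?invr_ge0// -(powR_inv1 (s0 i)) -powRrM mulrA -powRD ?sin0 ?implybT// mulN1r.
  apply: (@le_trans _ _ ((s i `^ (r / p - r / e))%:E *
    (\int[mu]_(x in Q i `&` Z i) (g x `^ r)%:E * (s i `^ (r / e - 1))%:E))%E).
    rewrite EFinM lee_wpmul2l ?lee_fin ?powR_ge0//; apply: le_trans H _.
    apply: lee_wpmul2l; first exact: integral_ge0.
    rewrite -poweR_EFin -muQ le_poweR//; first by rewrite subr_ge0 ltW.
    by apply: le_measure; rewrite ?inE.
  rewrite muleCA -EFinM muleC -powRD; last by rewrite sin0 implybT.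
  by rewrite (_ : r / p - r / e + (r / e - 1) = a1)// /a1; ring.
rewrite -EFinM lee_fin.
have sB0 : 0 <= (s i)^-1 * B by rewrite mulr_ge0// invr_ge0 ltW.
rewrite -[X in _ * X <= _](@mulr_powRB1 _ _ (r / e))//; last exact: lt_trans re.
apply: (@le_trans _ _ (s i `^ (r / p) * ((s i)^-1 * B * (s i `^ (a2 - 1)) `^ (r / e - 1)))).
  rewrite !ler_wpM2l ?powR_ge0// powR_gt0_le//; first by rewrite subr_ge0 ltW.
  by rewrite powRB ?sin0 ?implybT// powRr1 ?(ltW si)// mulrC ler_pM2r ?invr_gt0.
rewrite -(powR_inv1 (s0 i)) -powRrM.
rewrite [leLHS](_ : _ = (s i `^ (-1) * s i `^ (r / p) * s i `^ ((a2 - 1) * (r / e - 1))) * B);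
  last by ring.
rewrite -!powRD ?sin0 ?implybT//.
rewrite (_ : -1 + r / p + _ = - a2)// /a2; field.
by rewrite !gt_eqF.
Qed.

Let c1 := N0 / (1 - 2 `^ (- a1)).
Let c2 := N0 / (1 - 2 `^ (- a2)).

(** At a fixed x the sizes at most g(x)^(-p) contribute a multiple of g(x)^(-p a1), and r - p a1 =
    p: this fixes [a1]. In the same way e + p a2 = p fixes [a2] for [phi2]. *)
Let sum_phi1 x : (\sum_(i <oo) (phi1 i x)%:E <= (c1 * g x `^ p)%:E)%E.
Proof.
under eq_eseriesr do rewrite /phi1 mulrC EFinM.
rewrite nneseriesZl; last by move=> i _; case: ifPn => // _; rewrite lee_fin powR_ge0.
apply: le_trans.
  apply: lee_wpmul2l; first by rewrite lee_fin powR_ge0.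
  apply: (@layers_small R s (fun i => x \in Q i) N0 (overlap x) a1 (g x `^ (- p))) => //.
  exact: powR_ge0.
rewrite -EFinM lee_fin /c1 -powRrM.
have [->|gx] := eqVneq (g x) 0.
  by rewrite powR0 ?gt_eqF// mul0r powR0 ?gt_eqF// mulr0.
rewrite [leLHS](_ : _ = N0 / (1 - 2 `^ (- a1)) * (g x `^ r * g x `^ (- p * a1))); last by ring.
rewrite -powRD ?gx ?implybT// (_ : r + _ = p)// /a1; field.
by rewrite gt_eqF.
Qed.

Let sum_phi2 x : (\sum_(i <oo) (phi2 i x)%:E <= (c2 * g x `^ p)%:E)%E.
Proof.
have [gx0|gx] := eqVneq (g x) 0.
  rewrite eseries0 => [|i _ _]; last by rewrite /phi2 gx0 [0 `^ e]powR0 ?gt_eqF// mulr0.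
  by rewrite gx0 powR0 ?gt_eqF// mulr0.
under eq_eseriesr do rewrite /phi2 mulrC EFinM.
rewrite nneseriesZl; last by move=> i _; case: ifPn => // _; rewrite lee_fin powR_ge0.
apply: le_trans.
  apply: lee_wpmul2l; first by rewrite lee_fin powR_ge0.
  apply: (@layers_large R s (fun i => x \in Q i) N0 (overlap x) a2 (g x `^ (- p))) => //.
  by rewrite powR_gt0// lt0r gx g0.
rewrite -EFinM lee_fin /c2 -powRrM.
rewrite [leLHS](_ : _ = N0 / (1 - 2 `^ (- a2)) * (g x `^ e * g x `^ (- p * - a2))); last by ring.
rewrite -powRD ?gx ?implybT// (_ : e + _ = p)// /a2; field.
by rewrite gt_eqF.
Qed.

(** After exchanging sum and integral, what remains is the integral of a multiple of g^p. Both
    geometric sums converge because e < p < r are strict, so [a1] and [a2] are positive. *)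
Lemma embedding_sum_le : (\sum_(i <oo) (s i `^ (r / p) *
    ((s i)^-1 * fine (\int[mu]_(x in Q i) (g x `^ e)%:E)) `^ (r / e))%:E <=
  (2 `^ (r / e) * (N0 / (1 - 2 `^ (- (r / p - 1))) + N0 / (1 - 2 `^ (- (1 - e / p)))))%:E)%E.
Proof.
rewrite -/a1 -/a2 -/c1 -/c2.
apply: (@le_trans _ _ (\sum_(i <oo) (2 `^ (r / e))%:E *
    (\int[mu]_x (phi1 i x)%:E + \int[mu]_x (phi2 i x)%:E))%E).
  apply: lee_nneseries => [i _ _|i _]; last exact: term_le.
  by rewrite lee_fin mulr_ge0// powR_ge0.
have i1 i : (0 <= \int[mu]_x (phi1 i x)%:E)%E by apply: integral_ge0 => x _; rewrite lee_fin.
have i2 i : (0 <= \int[mu]_x (phi2 i x)%:E)%E by apply: integral_ge0 => x _; rewrite lee_fin.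
rewrite nneseriesZl; last by move=> i _; exact: adde_ge0.
rewrite EFinM lee_wpmul2l ?lee_fin ?powR_ge0// nneseriesD// EFinD.
have key (phi : nat -> T -> R) (c : R) : 0 <= c ->
    (forall i, measurable_fun setT (fun x => (phi i x)%:E)) ->
    (forall i x, 0 <= phi i x) ->
    (forall x, \sum_(i <oo) (phi i x)%:E <= (c * g x `^ p)%:E)%E ->
    (\sum_(i <oo) \int[mu]_x (phi i x)%:E <= c%:E)%E.
  move=> c0 mphi phi0 phis.
  rewrite -integral_nneseries//; last by move=> i x _; rewrite lee_fin.
  apply: (@le_trans _ _ (\int[mu]_x (c%:E * (g x `^ p)%:E))%E).
    apply: ge0_le_integral => //.
    - by move=> x _; apply: nneseries_ge0 => *; rewrite lee_fin.
    - by apply: ge0_emeasurable_sum => // *; rewrite lee_fin.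
    - by apply: measurable_funeM.
  rewrite ge0_integralZl_EFin//; last by move=> x _; rewrite lee_fin powR_ge0.
  by rewrite -[leRHS]mule1 lee_wpmul2l.
have c0 a : 0 < a -> 0 <= N0 / (1 - 2 `^ (- a)).
  by move=> /powRN_lt1/andP[_ H]; rewrite divr_ge0// subr_ge0 ltW.
by apply: leeD; apply: key => //; [exact: (c0 _ a10)|exact: (c0 _ a20)].
Qed.

End fixed_function.
End embedding.

(** * The converse of Hoelder's inequality on a sigma-finite space *)

Section duality.
Context d (T : measurableType d) (R : realType).
Variable mu : {measure set T -> \bar R}.
Variable E : nat -> set T.
Hypotheses (mE : forall k, measurable (E k)) (ndE : nondecreasing_seq E).
Hypotheses (UE : \bigcup_k E k = setT) (muE : forall k, (mu (E k) < +oo)%E).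

(** [G] may be infinite, so it cannot be tested at once against its own power. Normalised indicators
    first show that [I] is null; then [G] is truncated to be bounded on a set of finite measure,
    where its power q - 1 is a legitimate test function; monotone convergence removes the
    truncation. *)
Lemma Lnorm_dual_le (G : T -> \bar R) (q C : R) : 1 < q -> 0 < C ->
  measurable_fun setT G -> (forall x, 0 <= G x)%E ->
  (forall h : T -> R, measurable_fun setT h -> (forall x, 0 <= h x) ->
    (\int[mu]_x (h x `^ (q / (q - 1)))%:E <= 1)%E ->
    (\int[mu]_x (G x * (h x)%:E) <= C%:E)%E) ->
  (\int[mu]_x (G x `^ q) <= (C `^ q)%:E)%E.
Proof.
move=> q1 C0 mG G0 HG.
have q0 : 0 < q by exact: lt_trans q1.
have q10 : 0 < q - 1 by rewrite subr_gt0.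
have qp0 : 0 < q / (q - 1) by rewrite divr_gt0.
have qpV : (q / (q - 1))^-1 = 1 - q^-1 by field; rewrite !gt_eqF.
pose I := G @^-1` [set +oo%E].
have mI : measurable I by rewrite /I -[X in measurable X]setTI; exact: mG.
have mIE k : measurable (I `&` E k) by exact: measurableI.
have I0 k : mu (I `&` E k) = 0.
  apply/eqP; apply: contraT => mu0.
  have fin : mu (I `&` E k) \is a fin_num.
    rewrite ge0_fin_numE//; apply: le_lt_trans (muE k); apply: le_measure; rewrite ?inE//.
  pose a := fine (mu (I `&` E k)).
  have a0 : 0 < a by rewrite fine_gt0// lt0e mu0 measure_ge0/= -ge0_fin_numE.
  have aE : mu (I `&` E k) = a%:E by rewrite fineK.
  have := HG (fun x => a `^ (- (q / (q - 1))^-1) * \1_(I `&` E k) x).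
  have mh : measurable_fun setT (fun x => a `^ (- (q / (q - 1))^-1) * \1_(I `&` E k) x).
    by apply: measurable_funM => //; exact: measurable_indic.
  move=> /(_ mh) H.
  have /H{H} : forall x, 0 <= a `^ (- (q / (q - 1))^-1) * \1_(I `&` E k) x.
    by move=> x; rewrite mulr_ge0 ?powR_ge0.
  rewrite [X in (X <= 1)%E](_ : _ = 1%E); last first.
    transitivity (\int[mu]_x (a^-1%:E * (\1_(I `&` E k) x)%:E))%E.
      apply: eq_integral => x _; rewrite indicE; case: (x \in _) => /=.
        rewrite !mulr1 mule1 -powRrM mulNr mulVf ?gt_eqF//.
        by rewrite powR_inv1// ltW.
      by rewrite !mulr0 powR0 ?mule0// gt_eqF.
    rewrite ge0_integralZl_EFin//; last 2 first.
    - by apply/measurable_EFinP; exact: measurable_indic.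
    - by rewrite invr_ge0 ltW.
    by rewrite integral_indic// setIT aE -EFinM mulVf ?gt_eqF.
  move=> /(_ (lexx _)).
  rewrite leNgt => /negP; case; apply: lt_le_trans (ltry C) _.
  apply: (@le_trans _ _ (\int[mu]_(x in I `&` E k) (+oo))%E).
    by rewrite integral_cst// gt0_mulye// aE lte_fin.
  have mGh : measurable_fun setT (fun x => G x * (a `^ (- (q / (q - 1))^-1) * \1_(I `&` E k)
    x)%:E)%E.
    by apply: emeasurable_funM => //; apply/measurable_EFinP.
  have Gh0 x : (0 <= G x * (a `^ (- (q / (q - 1))^-1) * \1_(I `&` E k) x)%:E)%E.
    by rewrite mule_ge0// lee_fin mulr_ge0 ?powR_ge0.
  apply: (@le_trans _ _ (\int[mu]_(x in I `&` E k)
      (G x * (a `^ (- (q / (q - 1))^-1) * \1_(I `&` E k) x)%:E))%E); last first.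
    by apply: ge0_subset_integral => //.
  apply: le_of_eq; apply: eq_integral => x xI.
  rewrite indicE xI mulr1; move: xI => /set_mem[-> _].
  by rewrite gt0_mulye// lte_fin powR_gt0.
have I00 : mu I = 0.
  have -> : I = \bigcup_k (I `&` E k) by rewrite -setI_bigcupr UE setIT.
  apply/eqP; rewrite eq_le measure_ge0 andbT.
  apply: le_trans (measure_sigma_subadditive _ mIE _ (@subset_refl _ _)) _.
    exact: bigcupT_measurable.
  by rewrite eseries0.
pose F k := [set x | G x <= k%:R%:E]%E `&` E k.
have mF k : measurable (F k).
  apply: measurableI => //; rewrite -[X in measurable X]setTI.
  exact: emeasurable_fun_infty_c.
have mGq : measurable_fun setT (fun x => G x `^ q)%E.
  exact: (measurableT_comp (measurable_poweR q)).
have FC k : (\int[mu]_(x in F k) (G x `^ q) <= (C `^ q)%:E)%E.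
  pose g x := fine (G x).
  have gE x : F k x -> G x = (g x)%:E.
    move=> [Gx _]; rewrite fineK// ge0_fin_numE//.
    by apply: le_lt_trans Gx _; rewrite ltry.
  have g0 x : 0 <= g x by rewrite fine_ge0.
  have mg : measurable_fun setT g by exact: measurableT_comp.
  rewrite (eq_integral (fun x => (g x `^ q)%:E)); last first.
    by move=> x /[!inE] Fx; rewrite gE.
  have fin : (\int[mu]_(x in F k) (g x `^ q)%:E)%E \is a fin_num.
    rewrite ge0_fin_numE; last by apply: integral_ge0 => x _; rewrite lee_fin powR_ge0.
    apply: (@le_lt_trans _ _ (\int[mu]_(x in F k) (k%:R `^ q)%:E)%E).
      apply: ge0_le_integral => //.
      - by move=> x _; rewrite lee_fin powR_ge0.
      - by apply: measurable_powR_comp; exact: measurable_funTS.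
      - move=> x Fx; rewrite lee_fin powR_gt0_le// ?(ltW q0)//.
        by rewrite -lee_fin -gE//; case: Fx.
    rewrite integral_cst//; apply: lte_mul_pinfty; rewrite ?lee_fin ?powR_ge0//.
    by apply: le_lt_trans (muE k); apply: le_measure; rewrite ?inE// => x [].
  pose X := fine (\int[mu]_(x in F k) (g x `^ q)%:E).
  have XE : (\int[mu]_(x in F k) (g x `^ q)%:E)%E = X%:E by rewrite fineK.
  have X0 : 0 <= X by rewrite -lee_fin -XE; apply: integral_ge0 => x _; rewrite lee_fin powR_ge0.
  rewrite XE; have [->|Xn0] := eqVneq X 0; first by rewrite lee_fin powR_ge0.
  have {X0 Xn0}X0 : 0 < X by rewrite lt0r Xn0.
  (* The extremal function of the truncation, scaled so that the integral of its conjugate power is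
     1; testing against it gives X^(1/q) <= C. *)
  pose h x := X `^ (- (q / (q - 1))^-1) * (g x `^ (q - 1) * \1_(F k) x).
  have mh : measurable_fun setT h.
    apply: measurable_funM => //; apply: measurable_funM; last exact: measurable_indic.
    exact: (measurableT_comp (measurable_powR _)).
  have h0 x : 0 <= h x by rewrite !mulr_ge0 ?powR_ge0.
  have hq : (\int[mu]_x (h x `^ (q / (q - 1)))%:E = 1)%E.
    transitivity (\int[mu]_x (X^-1%:E * ((fun x => (g x `^ q)%:E) \_ (F k)) x))%E.
      apply: eq_integral => x _; rewrite /h indicE /patch; case: (x \in _) => /=.
        rewrite mulr1 powRM ?powR_ge0// -!powRrM mulNr mulVf ?gt_eqF//.
        rewrite powR_inv1 ?ltW// EFinM; congr (_ * (_ `^ _)%:E)%E.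
        by field; rewrite gt_eqF.
      by rewrite !mulr0 powR0 ?mule0// gt_eqF.
    rewrite ge0_integralZl_EFin//.
    - by rewrite -integral_mkcond XE -EFinM mulVf ?gt_eqF.
    - by move=> x _; apply: erestrict_ge0 => y _; rewrite lee_fin powR_ge0.
    - apply/(measurable_restrictT _ _).1 => //.
      by apply: measurable_powR_comp; exact: measurable_funTS.
    - by rewrite invr_ge0 ltW.
  have := HG h mh h0; rewrite hq => /(_ (lexx _)).
  rewrite [X in (X <= _)%E](_ : _ = (X `^ q^-1)%:E); last first.
    transitivity (\int[mu]_x ((X `^ (- (q / (q - 1))^-1))%:E * ((fun x => (g x `^ q)%:E) \_ (F k))
      x))%E.
      apply: eq_integral => x _; rewrite /h indicE /patch; case: ifPn => [/set_mem Fx|_] /=.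
        by rewrite gE// mulr1 -EFinM mulrCA EFinM mulr_powRB1.
      by rewrite !mulr0 mule0 mule0.
    rewrite ge0_integralZl_EFin//.
    - rewrite -integral_mkcond XE -EFinM -{2}(powRr1 (ltW X0)) -powRD.
        by rewrite qpV; congr ((_ `^ _)%:E); ring.
      by rewrite (gt_eqF X0) implybT.
    - by move=> x _; apply: erestrict_ge0 => y _; rewrite lee_fin powR_ge0.
    - apply/(measurable_restrictT _ _).1 => //.
      by apply: measurable_powR_comp; exact: measurable_funTS.
    - exact: powR_ge0.
  rewrite !lee_fin => H.
  have := powR_gt0_le (ltW q0) (powR_ge0 _ _) H.
  by rewrite -powRrM mulVf ?gt_eqF// powRr1// ltW.
rewrite (ge0_negligible_integral mI measurableT mGq _ I00); last first.
  by move=> x _; exact: poweR_ge0.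
have -> : setT `\` I = \bigcup_k F k.
  apply/seteqP; split=> [x [_ Ix]|x [k _ [Gx _]]]; last first.
    by split => // Ixe; move: Gx => /=; rewrite Ixe leye_eq.
  have Gfin : G x \is a fin_num by rewrite ge0_fin_numE// ltey; apply/eqP.
  have : (\bigcup_k E k) x by rewrite UE.
  move=> [k _ Ekx].
  have [l Gl] : exists l : nat, (G x <= l%:R%:E)%E.
    exists (Num.bound (fine (G x))); rewrite -[leLHS]fineK// lee_fin ltW//.
    by apply: archi_boundP; rewrite fine_ge0.
  exists (maxn k l) => //; split.
    by apply: le_trans Gl _; rewrite lee_fin ler_nat leq_maxr.
  by move: Ekx; exact/subsetPset/ndE/leq_maxl.
have ndF : nondecreasing_seq F.
  move=> k l kl; apply/subsetPset => x [Gx Ex]; split.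
    by apply: le_trans Gx _; rewrite lee_fin ler_nat.
  by move: Ex; exact/subsetPset/ndE.
have cF := @ge0_nondecreasing_set_cvg_integral _ _ _ F (fun x => G x `^ q)%E mu ndF mF
  (fun k => measurable_funTS mGq) (fun _ _ _ => poweR_ge0 _ _).
rewrite -(cvg_lim _ cF)//; apply: lime_le; first by apply/cvg_ex; eexists; exact: cF.
by apply: nearW.
Qed.

End duality.

(** * Cubes and the John-Nirenberg inequality *)

Section half_open_cubes.
Context {R : realType} {n : nat}.
Local Notation leb := (lebesgueRn R n).

(** Half-open, so that the dyadic subcubes partition a cube exactly and no boundary has to be
    discarded. *)
Definition hcube (a : Rn R n) (l : R) : set (Rn R n) :=
  [set y | forall i, tnth a i <= tnth y i < tnth a i + l].

Lemma measurable_hcube a l : measurable (hcube a l).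
Proof.
rewrite (_ : hcube a l = \bigcap_(i in [set: 'I_n]) ((fun x : Rn R n => tnth x i) @^-1` `[tnth a i,
  tnth a i + l[)).
  apply: fin_bigcap_measurable => // i _; rewrite -[X in measurable X]setTI.
  by apply: measurable_tnth => //; exact: measurable_itv.
apply/seteqP; split => y Hy i; first by move=> _ /=; rewrite in_itv/=; exact: Hy.
by have := Hy i Logic.I; rewrite /= in_itv.
Qed.

Lemma hcube_sub a b l k : (forall i, tnth b i <= tnth a i) ->
  (forall i, tnth a i + l <= tnth b i + k) -> hcube a l `<=` hcube b k.
Proof.
move=> ba abl y ya i; have /andP[ay yal] := ya i.
by rewrite (le_trans (ba i) ay) (lt_le_trans yal (abl i)).
Qed.

Lemma hcube_corner a l : 0 < l -> hcube a l a.
Proof. by move=> l0 i; rewrite lexx ltrDl. Qed.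

End half_open_cubes.

Lemma lebesgueRn_hcube (R : realType) (n : nat) (a : Rn R n) (l : R) : 0 <= l ->
  lebesgueRn R n (hcube a l) = (l ^+ n)%:E.
Proof.
elim: n a => [|n IH] a l0.
  by rewrite /= diracE mem_set// => -[].
rewrite /= /cons_measure /pushforward.
have -> : consRn (n := n) @^-1` hcube a l =
    `[thead a, thead a + l[%classic `*` hcube [tuple of behead a] l.
  apply/seteqP; split=> [[x y] /= Hxy|[x y] /= [Hx Hy]].
    split; first by have := Hxy ord0; rewrite (tnth_nth 0)/= -(tnth_nth _ _ ord0) in_itv.
    move=> i; have := Hxy (lift ord0 i).
    by rewrite [in X in X -> _](tuple_eta a) !tnthS.
  move=> i; rewrite [a]tuple_eta; case: (unliftP ord0 i) => [j|] ->.
    by rewrite !tnthS; exact: Hy.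
  by rewrite !tnth0; move: Hx; rewrite in_itv.
rewrite product_measure1E//; last exact: measurable_hcube.
rewrite IH// exprS EFinM; congr (_ * _)%E.
have := @lebesgue_measure_itv R `[thead a, thead a + l[.
rewrite /= lte_fin ltrDl => ->; case: ltP => l1.
  by rewrite -EFinB addrAC subrr add0r.
by congr EFin; apply/eqP; rewrite eq_le l0.
Qed.

Section dyadic_cells.
Context {R : realType} {n : nat}.
Variables (a : Rn R n) (l : R).
Hypothesis l0 : 0 < l.

(** The grid of side l / 2^N through the corner [a] is indexed over the whole space; the cube itself
    is the cell of generation 0 and index 0. *)
Definition dyadic_idx (N : nat) (x : Rn R n) : n.-tuple int :=
  [tuple Num.floor (2 ^+ N * (tnth x i - tnth a i) / l) | i < n].

Definition dyadic_corner (N : nat) (k : n.-tuple int) : Rn R n :=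
  [tuple tnth a i + (tnth k i)%:~R * (l / 2 ^+ N) | i < n].

Let p2 N : 0 < (2 : R) ^+ N. Proof. by rewrite exprn_gt0. Qed.

Lemma dyadic_cellE N k :
  [set x | dyadic_idx N x = k] = hcube (dyadic_corner N k) (l / 2 ^+ N).
Proof.
have E (x : Rn R n) i : (Num.floor (2 ^+ N * (tnth x i - tnth a i) / l) == tnth k i) =
    (tnth (dyadic_corner N k) i <= tnth x i < tnth (dyadic_corner N k) i + l / 2 ^+ N).
  rewrite floor_eq tnth_mktuple intrD.
  set K := (tnth k i)%:~R; set t := tnth x i; set b := tnth a i.
  have l' : 0 < l / 2 ^+ N by rewrite divr_gt0.
  have -> : 2 ^+ N * (t - b) / l = (t - b) / (l / 2 ^+ N).
    by field; rewrite !gt_eqF.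
  rewrite ler_pdivlMr// ltr_pdivrMr// mulrDl mul1r lerBrDl ltrBlDl addrA//.
apply/seteqP; split => x /=.
  by move=> xk i; rewrite -E -xk tnth_mktuple.
by move=> Hx; apply: eq_from_tnth => i; apply/eqP; rewrite tnth_mktuple E.
Qed.

Lemma measurable_dyadic_cell N k : measurable [set x | dyadic_idx N x = k].
Proof. by rewrite dyadic_cellE; exact: measurable_hcube. Qed.

(** From one generation to the previous one: the floor of 2 z determines the floor of z. *)
Lemma dyadic_idx_le M N x y : (M <= N)%N ->
  dyadic_idx N x = dyadic_idx N y -> dyadic_idx M x = dyadic_idx M y.
Proof.
move=> /subnKC <-; elim: (N - M)%N => [|k IH]; first by rewrite addn0.
rewrite addnS => H; apply: IH; move: (M + k)%N H => K H.
apply: eq_from_tnth => i; have := congr1 (fun t => tnth t i) H.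
rewrite !tnth_mktuple.
have half (z z' : R) : Num.floor (2 * z) = Num.floor (2 * z') ->
    (Num.floor z <= Num.floor z')%R.
  move=> zz'; rewrite floor_ge_int.
  have : ((2 * Num.floor z)%:~R <= 2 * z' :> R).
    by rewrite -floor_ge_int -zz' floor_ge_int intrM ler_pM2l// floor_le.
  by rewrite intrM ler_pM2l.
have E (u : R) : 2 ^+ K.+1 * u / l = 2 * (2 ^+ K * u / l) by rewrite exprS !mulrA.
rewrite !E => zz'; apply/eqP; rewrite eq_le; apply/andP; split; exact: half.
Qed.

Lemma dyadic_idx0 x : dyadic_idx 0 x = [tuple 0 | i < n] <-> hcube a l x.
Proof.
have -> : hcube a l = hcube (dyadic_corner 0 [tuple 0 | i < n]) (l / 2 ^+ 0).
  rewrite expr0 divr1; congr hcube; apply: eq_from_tnth => i.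
  by rewrite !tnth_mktuple mul0r addr0.
by rewrite -dyadic_cellE.
Qed.

(** The approximable sets form a sigma-algebra, so coordinate half-spaces suffice. Open ones are
    unions of cells because the sides of the cells tend to 0; their closed complements are countable
    intersections of open ones. *)
Lemma outer_approx_dyadic (mu : {measure set (Rn R n) -> \bar R}) :
  (mu setT < +oo)%E -> forall A, measurable A -> outer_approx mu dyadic_idx A.
Proof.
move=> mufin.
pose AA := [set A | [/\ measurable A, outer_approx mu dyadic_idx A &
  outer_approx mu dyadic_idx (~` A)]].
have sAA : sigma_algebra setT AA.
  exact: (outer_approx_sigma_algebra dyadic_idx_le mufin).
suff : @measurable _ (Rn R n) `<=` AA by move=> H A /H[].
apply: smallest_sub => //.
have open_approx V : measurable V -> cell_open dyadic_idx V -> outer_approx mu dyadic_idx V.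
  by move=> mV oV e e0; exists V; split => //; rewrite setDv measure0 lee_fin ltW.
have mj j (U : set R) : measurable U -> measurable [set x : Rn R n | U (tnth x j)].
  move=> mU; have := @measurable_tnth _ (measurableTypeR R) n j measurableT U mU.
  by rewrite setTI.
have mgt j c : measurable [set x : Rn R n | c < tnth x j].
  have -> : [set x : Rn R n | c < tnth x j] = [set x | `]c, +oo[%classic (tnth x j)].
    by apply/seteqP; split => x /=; rewrite in_itv/= andbT.
  by apply: mj; exact: measurable_itv.
have mlt j c : measurable [set x : Rn R n | tnth x j < c].
  have -> : [set x : Rn R n | tnth x j < c] = [set x | `]-oo, c[%classic (tnth x j)].
    by apply/seteqP; split => x /=; rewrite in_itv.
  by apply: mj; exact: measurable_itv.
have close N j (x y : Rn R n) : dyadic_idx N y = dyadic_idx N x ->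
    `|tnth y j - tnth x j| < l / 2 ^+ N.
  move=> yx; have : [set z | dyadic_idx N z = dyadic_idx N x] y by [].
  have : [set z | dyadic_idx N z = dyadic_idx N x] x by [].
  rewrite dyadic_cellE => /(_ j)/andP[? ?] /(_ j)/andP[? ?].
  by rewrite ltr_norml; apply/andP; split; lra.
have small (e : R) : 0 < e -> exists N, l / 2 ^+ N < e.
  move=> e0; exists (Num.bound (e / l)^-1).
  rewrite ltr_pdivrMr// -ltr_pdivrMl//.
  have := @upper_nthrootP _ (e / l)^-1 _ (leqnn (Num.bound (e / l)^-1)).
  by rewrite invf_div mulrC.
have gt_open j c : cell_open dyadic_idx [set x | c < tnth x j].
  move=> x /= cx; have [|N HN] := small (tnth x j - c); first by rewrite subr_gt0.
  by exists N => y /(close _ j); rewrite ltr_norml => /andP[+ _] /=; lra.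
have lt_open j c : cell_open dyadic_idx [set x | tnth x j < c].
  move=> x /= cx; have [|N HN] := small (c - tnth x j); first by rewrite subr_gt0.
  by exists N => y /(close _ j); rewrite ltr_norml => /andP[_ +] /=; lra.
have sub j : preimage_set_system setT (fun x : Rn R n => tnth x j) measurable `<=` AA.
  move=> _ [U mU <-].
  have : image_set_system setT (fun x : Rn R n => tnth x j) AA U.
    have E : @measurable _ (measurableTypeR R) = <<s @RGenOInfty.G R >> :=
      RGenOInfty.measurableE R.
    have {mU} : <<s @RGenOInfty.G R >> U by rewrite -E.
    move: U; apply: smallest_sub; first exact: sigma_algebra_image.
    move=> _ [c ->]; rewrite /image_set_system /= setTI.
    have -> : (fun x : Rn R n => tnth x j) @^-1` `]c, +oo[ = [set x | c < tnth x j].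
      by apply/seteqP; split => x /=; rewrite in_itv/= andbT.
    split.
    - exact: mgt.
    - exact: open_approx (mgt _ _) (gt_open _ _).
    - have -> : ~` [set x : Rn R n | c < tnth x j] =
          \bigcap_k [set x : Rn R n | tnth x j < c + k.+1%:R^-1].
        apply/seteqP; split => x /=.
          move=> /negP; rewrite -leNgt => xc k _ /=.
          by apply: le_lt_trans xc _; rewrite ltrDl invr_gt0.
        move=> H; apply/negP; rewrite -leNgt; apply/ler_addgt0Pr => e e0.
        apply: ltW; apply: lt_le_trans (H (Num.bound e^-1) Logic.I) _.
        rewrite lerD2l -[leRHS]invrK lef_pV2 ?posrE ?invr_gt0//.
        apply: ltW; apply: lt_le_trans (archi_boundP _) _; first by rewrite invr_ge0 ltW.
        by rewrite ler_nat.
      apply: (outer_approx_bigcap dyadic_idx_le mufin) => k; first exact: mlt.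
      exact: open_approx (mlt _ _) (lt_open _ _).
  by rewrite /image_set_system /=.
elim/big_ind : _ => [|A B HA HB|i _]; [exact: sub0set|by rewrite subUset; split|].
exact: sub.
Qed.

End dyadic_cells.

Section complex_norm.
Context {R : realType}.
Lemma normc_distC (x y : R[i]) : normc (x - y) = normc (y - x).
Proof. by rewrite -(opprB y x) -mulN1r normcM normcN normc1 mul1r. Qed.

Lemma normc_triangle (y x z : R[i]) : normc (x - z) <= normc (x - y) + normc (y - z).
Proof. by rewrite (_ : x - z = (x - y) + (y - z)) ?le_normcD// addrA subrK. Qed.

Lemma normc_ge0 (x : R[i]) : 0 <= normc x.
Proof. by case: x => a b; rewrite /normc sqrtr_ge0. Qed.

Lemma normc_Re_le (x : R[i]) : `|complex.Re x| <= normc x.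
Proof.
by case: x => a b /=; rewrite -sqrtr_sqr ler_wsqrtr// lerDl sqr_ge0.
Qed.

Lemma normc_Im_le (x : R[i]) : `|complex.Im x| <= normc x.
Proof.
by case: x => a b /=; rewrite -sqrtr_sqr ler_wsqrtr// lerDr sqr_ge0.
Qed.

Lemma normc_le_ReIm (x : R[i]) : normc x <= `|complex.Re x| + `|complex.Im x|.
Proof.
case: x => a b /=; rewrite -[leRHS]ger0_norm ?addr_ge0// -sqrtr_sqr ler_wsqrtr//.
rewrite sqrrD !real_normK ?num_real// lerD2r lerDl.
by rewrite mulrn_wge0// mulr_ge0.
Qed.

Lemma normcC (a : R) : normc (a%:C)%C = `|a|.
Proof. by rewrite /normc /= expr0n /= addr0 sqrtr_sqr. Qed.

Lemma measurable_normc d (T : measurableType d) (D : set T) (f : T -> R[i]) :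
  measurable D -> cmeasurable D f -> measurable_fun D (fun x => normc (f x)).
Proof.
move=> mD [mr mi].
rewrite (_ : (fun x => _) = fun x =>
  Num.sqrt ((complex.Re (f x)) ^+ 2 + (complex.Im (f x)) ^+ 2)); last first.
  by apply/funext => x; case: (f x).
apply: (measurableT_comp (continuous_measurable_fun (@sqrt_continuous R))) => //.
by apply: measurable_funD; apply: measurable_funX.
Qed.

Lemma cmeasurable_subr d (T : measurableType d) (D : set T) (f : T -> R[i]) c :
  cmeasurable D f -> cmeasurable D (fun x => f x - c).
Proof.
move=> [mr mi]; split.
  rewrite (_ : (fun x => _) = fun x => complex.Re (f x) - complex.Re c).
    exact: measurable_funB.
  by apply/funext => x; case: (f x) c => ? ? [].
rewrite (_ : (fun x => _) = fun x => complex.Im (f x) - complex.Im c).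
  exact: measurable_funB.
by apply/funext => x; case: (f x) c => ? ? [].
Qed.

End complex_norm.

Section john_nirenberg.
Context {R : realType} {n : nat}.
Variables (W : {measure set (Rn R n) -> \bar R}) (D : R).
Hypothesis W_gt0 : forall a l, 0 < l -> (0 < W (hcube a l))%E.
Hypothesis W_fin : forall a l, (W (hcube a l) < +oo)%E.
Hypothesis D0 : 0 <= D.
Hypothesis W_doubling : forall a b l, 0 < l -> hcube a l `<=` hcube b (2 * l) ->
  (W (hcube b (2 * l)) <= D%:E * W (hcube a l))%E.

(** The spacing of the oscillation levels: at least 1 + 2 D, the drift of the centre from a cube to
    a maximal selected subcube, and at least 2, the bound off the selected set. *)
Let K := 2 + 2 * D.
Let K2 : 2 <= K. Proof. by rewrite /K lerDl mulr_ge0. Qed.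
Let K0 : 0 < K. Proof. exact: lt_le_trans K2. Qed.

Section fixed_function.
Variables (b : Rn R n -> R[i]) (c : Rn R n -> R -> R[i]).
Hypothesis mb : cmeasurable setT b.
Let h a l x := normc (b x - c a l).
Hypothesis osc : forall a l, 0 < l ->
  (\int[W]_(x in hcube a l) (h a l x)%:E <= W (hcube a l))%E.

Let mh a l E : measurable_fun E (h a l).
Proof.
by apply: measurable_funTS; apply: measurable_normc => //; exact: cmeasurable_subr.
Qed.

Let h0 a l x : 0 <= h a l x. Proof. exact: normc_ge0. Qed.

Let mlev a l t : measurable [set x | t < h a l x].
Proof.
have -> : [set x | t < h a l x] = setT `&` h a l @^-1` `]t, +oo[.
  by rewrite setTI; apply/seteqP; split => x /=; rewrite in_itv/= andbT.
exact: (@mh a l setT measurableT).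
Qed.

Section stopping_step.
Variables (a : Rn R n) (l : R).
Hypothesis l0 : 0 < l.
Let Q := hcube a l.
Let mQ : measurable Q. Proof. exact: measurable_hcube. Qed.
Let idx := dyadic_idx a l.
Let side N := l / 2 ^+ N.
Let side0 N : 0 < side N. Proof. by rewrite divr_gt0// exprn_gt0. Qed.
Let mcell N i : measurable (cell idx N i).
Proof. exact: measurable_dyadic_cell. Qed.
Let idx_le M N x y : (M <= N)%N -> idx N x = idx N y -> idx M x = idx M y.
Proof. exact: dyadic_idx_le. Qed.
Let cellQ N x : Q x -> cell idx N (idx N x) `<=` Q.
Proof.
move=> /(dyadic_idx0 a l0) Qx y yx; apply/(dyadic_idx0 a l0).
by rewrite -Qx; exact: (idx_le (leq0n N)).
Qed.
Let cellE N i : cell idx N i = hcube (dyadic_corner a l N i) (side N).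
Proof. exact: dyadic_cellE. Qed.

(** Calderon-Zygmund selection at height 2. As the average of h over Q is at most 1, this height
    excludes Q itself and leaves at most half of its mass in [E]. *)
Let sel N i := cell idx N i `<=` Q /\
  (2%:E * W (cell idx N i) < \int[W]_(x in cell idx N i) (h a l x)%:E)%E.
Let E := stopped idx sel.
Let mE : measurable E. Proof. exact: measurable_stopped. Qed.
Let EQ : E `<=` Q.
Proof. by move=> x [N [NQ _]]; apply: NQ. Qed.
Let W_lty A : measurable A -> A `<=` Q -> (W A < +oo)%E.
Proof. by move=> mA AQ; apply: le_lt_trans (W_fin a l); apply: le_measure; rewrite ?inE. Qed.
Let mhE A : measurable_fun A (fun x => (h a l x)%:E).
Proof. by apply/measurable_EFinP; exact: mh. Qed.

Let W_selected : (2%:E * W E <= W Q)%E.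
Proof.
have := @stopped_integral_le _ _ R _ W idx mcell idx_le sel
  (cst 2%:E) (fun x => (h a l x)%:E) (measurable_cst _) (@mhE setT).
rewrite integral_cst// => H; apply: le_trans (H _ _ _) _.
- by move=> x; rewrite lee_fin.
- by move=> x; rewrite lee_fin.
- move=> N i [[NQ /ltW sN] _]; rewrite integral_cst//.
- apply: le_trans (osc a l0); apply: ge0_subset_integral => //.
  by move=> x _; rewrite lee_fin.
Qed.

(** A substitute for differentiation of integrals. Among the cells inside an approximating set V,
    take those that meet the exceptional set A. None is selected, so h has average at most 2 on
    their union, which exceeds A by mass at most d, whereas h > 2 + e on A. Hence e W(A) <= 2 d for
    every d > 0. *)
Let W_unselected_gt e : 0 < e -> W ((Q `\` E) `&` [set x | 2 + e < h a l x]) = 0.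
Proof.
move=> e0; set A := _ `&` _.
have mA : measurable A by apply: measurableI => //; exact: measurableD.
have AQ : A `<=` Q by move=> x [[]].
have Wfin : W A \is a fin_num by rewrite ge0_fin_numE// W_lty.
suff H d : 0 < d -> (e%:E * W A <= (2 * d)%:E)%E.
  apply/eqP; rewrite eq_le measure_ge0 andbT.
  rewrite -(fineK Wfin) lee_fin; apply/ler_addgt0Pr => d d0; rewrite add0r.
  have := H (e * d / 2); rewrite divr_gt0 ?mulr_gt0// => /(_ erefl).
  by rewrite -(fineK Wfin) -EFinM lee_fin mulrCA divff// mulr1 ler_pM2l.
move=> d0.
have mrfin : (mrestr W mQ setT < +oo)%E.
  by rewrite /mrestr setTI W_fin.
have [V [mV oV AV Vd]] := @outer_approx_dyadic _ _ a l l0 _ mrfin A mA d d0.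
pose S N i := [/\ cell idx N i `<=` V, cell idx N i `<=` Q &
  exists2 x, cell idx N i x & A x].
have mU : measurable (stopped idx S) by exact: measurable_stopped.
have UV : stopped idx S `<=` V by move=> x [N [NV _ _]]; exact: NV.
have UQ : stopped idx S `<=` Q by move=> x [N [_ NQ _]]; exact: NQ.
have AU : A `<=` stopped idx S.
  move=> x Ax; have [N xN] := oV _ (AV _ Ax).
  by exists N; split => //; [apply: cellQ; exact: AQ|exists x].
have HU : (\int[W]_(x in stopped idx S) (h a l x)%:E <= 2%:E * W (stopped idx S))%E.
  rewrite -integral_cst//; apply: (stopped_integral_le mcell idx_le) => //.
  - by move=> x; rewrite lee_fin.
  - by move=> x; rewrite lee_fin.
  move=> N i [[iV iQ [x xi [[_ nEx] _]]] _]; rewrite integral_cst//.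
  rewrite leNgt; apply/negP => lt; apply: nEx; exists N.
  by rewrite /sel (_ : idx N x = i).
have WU : (W (stopped idx S) <= W A + d%:E)%E.
  apply: (@le_trans _ _ (W (A `|` ((V `\` A) `&` Q)))%E).
    apply: le_measure; rewrite ?inE//.
      by apply: measurableU => //; apply: measurableI => //; exact: measurableD.
    move=> x Ux; have [Ax|nAx] := pselect (A x); [by left|right].
    by split; [split => //; exact: UV|exact: UQ].
  apply: le_trans (leeD (lexx _) Vd); apply: measureU2 => //.
  by apply: measurableI => //; exact: measurableD.
have : ((2 + e)%:E * W A <= 2%:E * (W A + d%:E))%E.
  apply: le_trans (lee_wpmul2l _ WU); last by rewrite lee_fin.
  apply: le_trans HU; rewrite -integral_cst//.
  apply: (@le_trans _ _ (\int[W]_(x in A) (h a l x)%:E)%E).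
    apply: ge0_le_integral => //.
    - by move=> x _; rewrite lee_fin addr_ge0// ltW.
    - by move=> x [_ /ltW].
  by apply: ge0_subset_integral => // x _; rewrite lee_fin.
by rewrite -(fineK Wfin) -EFinD -!EFinM !lee_fin mulrDl mulrDr lerD2l.
Qed.

Let W_unselected : W ((Q `\` E) `&` [set x | 2 < h a l x]) = 0.
Proof.
pose A k := (Q `\` E) `&` [set x | 2 + k.+1%:R^-1 < h a l x].
have mA k : measurable (A k) by apply: measurableI; [exact: measurableD|exact: mlev].
have -> : (Q `\` E) `&` [set x | 2 < h a l x] = \bigcup_k A k.
  apply/seteqP; split=> [x [Ex /= hx]|x [k _ [Ex /= hx]]]; last first.
    by split => //=; apply: lt_trans hx; rewrite ltrDl invr_gt0.
  have e0 : 0 < h a l x - 2 by rewrite subr_gt0.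
  exists (Num.bound (h a l x - 2)^-1) => //; split => //=.
  rewrite -ltrBrDl -[ltRHS]invrK ltf_pV2 ?posrE ?invr_gt0//.
  apply: lt_trans (archi_boundP _) _; first by rewrite invr_ge0 ltW.
  by rewrite ltr_nat.
apply/eqP; rewrite eq_le measure_ge0 andbT.
apply: le_trans (measure_sigma_subadditive _ mA _ (@subset_refl _ _)) _.
  exact: bigcupT_measurable.
by rewrite eseries0// => k _ _; apply: W_unselected_gt; rewrite invr_gt0.
Qed.

(** The parent of a maximal cell is not selected, so the integral of h over it is at most 2
    W(parent) <= 2 D W(cell). Integrating the constant |c_cell - c_Q| over the cell then gives at
    most 1 + 2 D times its mass. *)
Let first_sel_center N i : first_stop idx sel N i ->
  normc (c (dyadic_corner a l N i) (side N) - c a l) <= K.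
Proof.
move=> [[iQ seli] fN].
have mD : measurable (cell idx N i) by exact: mcell.
have [x xi] : exists x, cell idx N i x.
  apply/set0P; apply/eqP => i0; move: seli.
  by rewrite i0 measure0 mule0 integral_set0 ltxx.
(* A selected cell of generation 0 would be Q, which is excluded by the bound on its oscillation;
   hence a parent exists. *)
case: N => [|N] in i iQ seli fN mD xi *.
  move: seli; have -> : cell idx 0 i = Q.
    apply/seteqP; split => // y Qy; rewrite /cell/= -xi.
    by move: (iQ _ xi) Qy => /(dyadic_idx0 a l0) H /(dyadic_idx0 a l0) H'; rewrite /idx H H'.
  move=> /lt_le_trans /(_ (osc a l0)); rewrite -/Q.
  have WQ : W Q \is a fin_num by rewrite ge0_fin_numE// W_fin.
  have := W_gt0 a l0; rewrite -/Q -(fineK WQ) -EFinM !lte_fin => WQ0.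
  by rewrite gtr_pMl// => /lt_trans /(_ (ltr1n R 2)); rewrite ltxx.
pose P := cell idx N (idx N x).
have PQ : P `<=` Q by apply: cellQ; exact: iQ.
have iP : cell idx N.+1 i `<=` P.
  by move=> y yi; rewrite /P/cell/=; apply: (idx_le (leqnSn N)); rewrite yi xi.
have hP : (\int[W]_(y in P) (h a l y)%:E <= 2%:E * W P)%E.
  rewrite leNgt; apply/negP => lt; apply: (fN x xi N (ltnSn N)); split => //.
have sE : side N = 2 * side N.+1.
  by rewrite /side exprS; field; rewrite gt_eqF// exprn_gt0.
have WP : (W P <= D%:E * W (cell idx N.+1 i))%E.
  move: iP; rewrite /P !cellE sE; exact: W_doubling.

pose dst := normc (c (dyadic_corner a l N.+1 i) (side N.+1) - c a l).
have : (dst%:E * W (cell idx N.+1 i) <= (1 + 2 * D)%:E * W (cell idx N.+1 i))%E.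
  rewrite -integral_cst//.
  apply: (@le_trans _ _ (\int[W]_(y in cell idx N.+1 i)
     ((h (dyadic_corner a l N.+1 i) (side N.+1) y)%:E + (h a l y)%:E))%E).
    apply: ge0_le_integral => //.
    - by move=> y _; rewrite lee_fin normc_ge0.
    - by apply: emeasurable_funD; apply/measurable_EFinP; exact: mh.
    - move=> y _; rewrite -EFinD lee_fin /h (normc_distC (b y) (c (dyadic_corner _ _ _ _) _)).
      exact: normc_triangle.
  rewrite ge0_integralD//.
  - have -> : ((1 + 2 * D)%:E * W (cell idx N.+1 i) =
        W (cell idx N.+1 i) + (2 * D)%:E * W (cell idx N.+1 i))%E.
      have Wc : W (cell idx N.+1 i) \is a fin_num by rewrite ge0_fin_numE// W_lty.
      by rewrite -(fineK Wc) -!EFinM -EFinD mulrDl mul1r.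
    apply: leeD; first by rewrite cellE; apply: osc; exact: side0.
    apply: (@le_trans _ _ (\int[W]_(y in P) (h a l y)%:E)%E).
      apply: ge0_subset_integral => //; first exact: mcell.
      by move=> y _; rewrite lee_fin.
    by apply: le_trans hP _; rewrite EFinM -muleA lee_wpmul2l// lee_fin.
  - by move=> y _; rewrite lee_fin.
  - by apply/measurable_EFinP; exact: mh.
  - by move=> y _; rewrite lee_fin.
have Wc : W (cell idx N.+1 i) \is a fin_num.
  by rewrite ge0_fin_numE// W_lty.
have Wc0 : (0 < W (cell idx N.+1 i))%E by rewrite cellE; apply: W_gt0; exact: side0.
rewrite -(fineK Wc) -!EFinM lee_fin ler_pM2r; last by rewrite -lte_fin fineK.
by move=> /le_trans; apply; rewrite /K lerD2r ler1n.
Qed.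

(** Off [E] the oscillation is almost everywhere at most 2 <= K, so the level set lies essentially
    in the maximal cells. In each of them the loss of one [K] pays for the change of centre and the
    bound at level k applies; the factor 1/2 is W(E) <= W(Q) / 2. *)
Lemma oscillation_decay_step k t : 0 <= k -> 0 <= t ->
  (forall (a' : Rn R n) (l' : R), (0 < l')%R ->
    W (hcube a' l' `&` [set x | (k * K < h a' l' x)%R]) <= t%:E * W (hcube a' l'))%E ->
  (W (Q `&` [set x | ((k + 1) * K < h a l x)%R]) <= (t / 2)%:E * W Q)%E.
Proof.
move=> k0 t0 IH; set L := [set x | _].
have mL : measurable L by exact: mlev.
have WEL : (W (E `&` L) <= t%:E * W E)%E.
  rewrite -integral_cst//.
  have -> : (W (E `&` L) = \int[W]_(x in E) (\1_L x)%:E)%E.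
    by rewrite integral_indic// setIC.
  apply: (stopped_integral_le mcell idx_le) => //.
  - by apply/measurable_EFinP; exact: measurable_indic.
  - by move=> N i fi; rewrite integral_indic// integral_cst//;
      have Kd := first_sel_center fi; rewrite setIC cellE;
      apply: le_trans (IH _ _ (side0 N)); apply: le_measure; rewrite ?inE;
      [apply: measurableI => //; exact: measurable_hcube
      |apply: measurableI; [exact: measurable_hcube|exact: mlev]
      |move=> x [xD /= Lx]; split => //=; rewrite -(ltrD2r K) -{2}(mul1r K) -mulrDl;
       apply: lt_le_trans Lx _; apply: le_trans (normc_triangle (c (dyadic_corner a l N i) (side
         N)) _ _) _;
       rewrite lerD2l].
have WQ : W Q \is a fin_num by rewrite ge0_fin_numE// W_fin.
have WE : W E \is a fin_num by rewrite ge0_fin_numE// W_lty.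
apply: (@le_trans _ _ (W ((E `&` L) `|` ((Q `\` E) `&` [set x | (2 < h a l x)%R])))%E).
  apply: le_measure; rewrite ?inE.
  - exact: measurableI.
  - by apply: measurableU; apply: measurableI; [| |exact: measurableD|exact: mlev].
  - move=> x [Qx Lx]; have [Ex|nEx] := pselect (E x); [by left|right].
    split => //=; apply: le_lt_trans Lx; apply: le_trans K2 _.
    by rewrite ler_peMl ?lerDr// ltW.
apply: le_trans (measureU2 _ _ _) _.
- exact: measurableI.
- by apply: measurableI; [exact: measurableD|exact: mlev].
rewrite [X in (_ + X)%E](_ : _ = 0%E) ?adde0; last exact: W_unselected.
apply: le_trans WEL _.
move: W_selected; rewrite -(fineK WQ) -(fineK WE) -!EFinM !lee_fin => H.
by rewrite mulrAC -mulrA ler_wpM2l// ler_pdivlMr// mulrC.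
Qed.

End stopping_step.

Lemma oscillation_decay k a l : 0 < l ->
  (W (hcube a l `&` [set x | (k%:R * K < h a l x)%R]) <= ((2^-1) ^+ k)%:E * W (hcube a l))%E.
Proof.
elim: k a l => [|k IH] a l l0.
  rewrite expr0 mul1e; apply: le_measure; rewrite ?inE; last by move=> x [].
    by apply: measurableI; [exact: measurable_hcube|exact: mlev].
  exact: measurable_hcube.
rewrite exprSr -natr1; apply: oscillation_decay_step => //.
Qed.

Lemma oscillation_moment t C a l : 0 < t -> 0 <= C ->
  (\sum_(k <oo) (k.+1%:R `^ t * (2^-1) ^+ k)%:E <= C%:E)%E -> 0 < l ->
  (\int[W]_(x in hcube a l) (h a l x `^ t)%:E <= (K `^ t * C)%:E * W (hcube a l))%E.
Proof.
move=> t0 C0 HC l0.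
pose L k := [set x | (k%:R * K < h a l x)%R].
have mL k : measurable (L k) by exact: mlev.
have mQ := measurable_hcube a l.
(* Layer k has the value ((k+1) K)^t on {h > k K}; a point with h > 0 is charged to the least k with
   h <= (k+1) K. A zero of h lies in no layer and is treated apart. *)
pose u k x : \bar R := (((k.+1%:R * K) `^ t)%:E * (\1_(L k) x)%:E)%E.
have u0 k x : (0 <= u k x)%E by rewrite mule_ge0// lee_fin ?powR_ge0.
have mu k E : measurable_fun E (u k).
  by apply: measurable_funeM; apply: measurable_funTS; apply/measurable_EFinP;
    exact: measurable_indic.
apply: (@le_trans _ _ (\int[W]_(x in hcube a l) (\sum_(k <oo) u k x))%E).
  apply: ge0_le_integral => //.
  - by move=> x _; rewrite lee_fin powR_ge0.
  - by apply: measurable_powR_comp; exact: mh.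
  - by apply: ge0_emeasurable_sum => //.
  move=> x _; have [hx0|hxn0] := eqVneq (h a l x) 0.
    by rewrite hx0 powR0 ?gt_eqF// nneseries_ge0.
  have hx : 0 < h a l x by rewrite lt0r hxn0 h0.
  have exk : exists k : nat, h a l x <= k.+1%:R * K.
    exists (Num.bound (h a l x / K)); rewrite -ler_pdivrMr//.
    apply: ltW; apply: lt_le_trans (archi_boundP _) _; first by rewrite divr_ge0// ltW.
    by rewrite ler_nat.
  case: (ex_minnP exk) => k hk mink.
  apply: le_trans (nneseries_ge_term k (fun k => u0 k x)).
  rewrite /u indicE mem_set ?mule1 ?lee_fin; last first.
    rewrite /L /=; case: k => [|k] in hk mink *; first by rewrite mul0r.
    by rewrite ltNge; apply/negP => /mink; rewrite ltnn.
  by rewrite powR_gt0_le// ltW.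
rewrite integral_nneseries//.
have WQ : W (hcube a l) \is a fin_num by rewrite ge0_fin_numE// W_fin.
have WQ0 : 0 <= fine (W (hcube a l)) by exact: fine_ge0.
apply: (@le_trans _ _ (\sum_(k <oo) ((K `^ t * fine (W (hcube a l)))%:E * (k.+1%:R `^ t * (2^-1) ^+
  k)%:E))%E).
  apply: lee_nneseries => k *; first by apply: integral_ge0.
  rewrite /u ge0_integralZl_EFin ?powR_ge0//; last first.
    by apply: measurable_funTS; apply/measurable_EFinP; exact: measurable_indic.
  rewrite integral_indic//; apply: le_trans.
    apply: lee_wpmul2l; first by rewrite lee_fin powR_ge0.
    by rewrite setIC; exact: oscillation_decay.
  rewrite -(fineK WQ) -!EFinM lee_fin powRM ?(ltW K0)//.
  by apply: le_of_eq; ring.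
rewrite nneseriesZl; last by move=> k _; rewrite lee_fin mulr_ge0 ?powR_ge0// exprn_ge0// invr_ge0.
apply: le_trans; first by apply: lee_wpmul2l HC; rewrite lee_fin mulr_ge0// powR_ge0.
by rewrite -(fineK WQ) -!EFinM lee_fin mulrAC.
Qed.

End fixed_function.

(** The constant is uniform in b and in the centres. These are any family for which the oscillation
    is at most 1, not necessarily means over the cube in question. *)
Lemma john_nirenberg t : 0 < t -> exists C, 0 < C /\
  forall (b : Rn R n -> R[i]) (c : Rn R n -> R -> R[i]), cmeasurable setT b ->
  (forall (a : Rn R n) (l : R), (0 < l)%R ->
    \int[W]_(x in hcube a l) (normc (b x - c a l))%:E <= W (hcube a l))%E ->
  forall (a : Rn R n) (l : R), (0 < l)%R ->
    (\int[W]_(x in hcube a l) (normc (b x - c a l) `^ t)%:E <= C%:E * W (hcube a l))%E.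
Proof.
move=> t0; have [|C [C0 HC]] := @poly_geometric_series R t 2^-1 (ltW t0).
  by rewrite invr_gt0 ltr0n/= invf_lt1 ?ltr1n.
exists (K `^ t * C); split; first by rewrite mulr_gt0// powR_gt0.
move=> b c mb osc a l l0; apply: oscillation_moment => //; exact: ltW.
Qed.

End john_nirenberg.

Lemma powRE {R : realType} (x a : R) : 0 < x -> x `^ a = expR (a * ln x).
Proof. by move=> x0; rewrite /powR gt_eqF. Qed.

Lemma powR_inj_le {R : realType} (t x y : R) : 0 < t -> 0 <= x -> 0 <= y ->
  x `^ t <= y `^ t -> x <= y.
Proof.
move=> t0 x0 y0 xy; have ti : 0 <= t^-1 by rewrite invr_ge0 ltW.
have := powR_gt0_le ti (powR_ge0 x t) xy.
by rewrite -!powRrM mulfV ?gt_eqF// !powRr1.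
Qed.

Lemma powR_expR {R : realType} (x a : R) : expR x `^ a = expR (a * x).
Proof. by rewrite powRE ?expR_gt0// expRK. Qed.

Lemma pos_expR {R : realType} (x : R) : 0 < x -> exists y, x = expR y.
Proof. by move=> x0; exists (ln x); rewrite lnK. Qed.

(* Turns an identity between products of real powers of exponentials into a
   linear identity between the exponents. *)
Ltac exp_field :=
  rewrite ?(powR_expR, =^~ expRN, =^~ expRD); congr expR; field;
  rewrite ?gt_eqF//.

(** * Consequences of A_1 and of the reverse Hoelder inequality on cubes *)

Section cube_weights.
Context {R : realType} {n : nat}.
Variable leb : {measure set (Rn R n) -> \bar R}.
Hypothesis lebH : forall a l, 0 < l -> leb (hcube a l) = (l ^+ n)%:E.
Variables (w : Rn R n -> R) (mw : measurable_fun setT w) (w_gt0 : forall x, 0 < w x).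

Let w_ge0 x : 0 <= w x. Proof. exact: ltW. Qed.

Definition wdens := dens leb mw w_ge0.

Let mws t : measurable_fun setT (fun x => w x `^ t).
Proof. exact: (measurableT_comp (measurable_powR t)). Qed.

Definition wpow_dens t := dens leb (mws t) (fun x => powR_ge0 (w x) t).

Definition cmass a l := fine (wdens (hcube a l)).
Definition cmass_pow t a l := fine (wpow_dens t (hcube a l)).

Variables (C1 C2 r s : R).
Hypotheses (C10 : 0 < C1) (C20 : 0 < C2) (s1 : 1 < s) (sr : s < r).
Hypothesis wdens_fin : forall a l, (wdens (hcube a l) < +oo)%E.
Hypothesis w_A1 : forall a l, 0 < l ->
  {ae leb, forall y, hcube a l y -> cmass a l <= C1 * l ^+ n * w y}.
Hypothesis w_RH : forall a l, 0 < l ->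
  (\int[leb]_(x in hcube a l) (w x `^ r)%:E <=
   (C2 * l ^+ n * (cmass a l / l ^+ n) `^ r)%:E)%E.

Let vol l : 0 < l -> 0 < l ^+ n :> R. Proof. exact: exprn_gt0. Qed.
Let s0 : 0 < s. Proof. exact: lt_trans s1. Qed.
Let r0 : 0 < r. Proof. exact: lt_trans s0 sr. Qed.
Let r1 : 1 < r. Proof. exact: lt_trans s1 sr. Qed.
Let mH a l : measurable (hcube a l : set (Rn R n)). Proof. exact: measurable_hcube. Qed.
Let mwe E : measurable_fun E (fun x => (w x)%:E).
Proof. by apply/measurable_EFinP; exact: measurable_funTS. Qed.
Let mwse E t : measurable_fun E (fun x => (w x `^ t)%:E).
Proof. by apply/measurable_EFinP; apply: measurable_funTS; exact: mws. Qed.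

Lemma dens_gt0 (v : Rn R n -> R) (mv : measurable_fun setT v)
  (v_ge0 : forall x, 0 <= v x) a l : (forall x, 0 < v x) -> 0 < l ->
  (0 < dens leb mv v_ge0 (hcube a l))%E.
Proof.
move=> v0 l0; rewrite lt0e measure_ge0 andbT; apply/negP => /eqP; rewrite densE => v00.
have mvE : measurable_fun (hcube a l) (fun x => (v x)%:E).
  by apply/measurable_EFinP; exact: measurable_funTS.
have : (\int[leb]_(x in hcube a l) `|(v x)%:E| = 0)%E.
  by rewrite -v00; apply: eq_integral => x _; rewrite gee0_abs ?lee_fin.
move=> /(ae_eq_integral_abs _ (mH a l) mvE) [N [mN N0 HN]].
have : (leb (hcube a l) <= leb N)%E.
  apply: le_measure; rewrite ?inE// => x Hx; apply: HN => /= /(_ Hx) [] vx.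
  by move: (v0 x); rewrite vx ltxx.
by rewrite N0 lebH// lee_fin leNgt vol.
Qed.

Lemma wdensE a l : wdens (hcube a l) = (cmass a l)%:E.
Proof. by rewrite fineK// ge0_fin_numE. Qed.

Lemma cmass_gt0 a l : 0 < l -> 0 < cmass a l.
Proof. by move=> l0; rewrite -lte_fin -wdensE; exact: dens_gt0. Qed.

Lemma integral_w a l : (\int[leb]_(x in hcube a l) (w x)%:E)%E = (cmass a l)%:E.
Proof. by rewrite -wdensE densE. Qed.

(** By A_1, w >= W(Q) / (C1 |Q|) almost everywhere on Q, so a nonpositive power of w is at most the
    same power of that constant. This exchanges Lebesgue measure for w^(-e) dx at the price of a
    factor in the masses. *)
Lemma A1_integral_le a l e (F : Rn R n -> R) : 0 < l -> e <= 0 ->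
  measurable_fun (hcube a l) F -> (forall x, 0 <= F x) ->
  (\int[leb]_(x in hcube a l) (F x)%:E <=
   ((cmass a l / (C1 * l ^+ n)) `^ e)%:E *
     \int[leb]_(x in hcube a l) (F x * w x `^ (- e))%:E)%E.
Proof.
move=> l0 e0 mF F0.
have mFw : measurable_fun (hcube a l) (fun x => (F x * w x `^ (- e))%:E).
  by apply/measurable_EFinP; apply: measurable_funM => //; exact: measurable_funTS (@mws _).
have c0 : 0 < cmass a l / (C1 * l ^+ n).
  by rewrite divr_gt0 ?cmass_gt0// mulr_gt0// vol.
rewrite -ge0_integralZl_EFin ?powR_ge0//; last first.
  by move=> x _; rewrite lee_fin mulr_ge0// powR_ge0.
apply: ae_ge0_le_integral => //.
- by move=> x _; rewrite lee_fin.
- by apply/measurable_EFinP.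
- by move=> x _; rewrite mule_ge0 ?lee_fin ?mulr_ge0 ?powR_ge0.
- exact: measurable_funeM.
have := @w_A1 a l l0; apply: filterS => x /[apply] H.
rewrite -EFinM lee_fin mulrCA ler_peMr// powRN.
rewrite -(ler_pM2r (powR_gt0 e (w_gt0 x))) mul1r mulfVK ?gt_eqF ?powR_gt0//.
by apply: powR_le0_le => //; rewrite ler_pdivrMr ?mulr_gt0 ?vol// mulrC.
Qed.

(** The A_1 inequality of the large cube holds almost everywhere on the small one, and is integrated
    there. *)
Lemma cmass_doubling a b l k : 0 < l -> 0 < k -> hcube a l `<=` hcube b k ->
  cmass b k <= C1 * (k ^+ n / l ^+ n) * cmass a l.
Proof.
move=> l0 k0 ab; have vl := vol l0.
have : ((cmass b k)%:E * leb (hcube a l) <= (C1 * k ^+ n)%:E * (cmass a l)%:E)%E.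
  rewrite -(integral_w a l) -ge0_integralZl_EFin//; last 2 first.
  - by move=> x _; rewrite lee_fin.
  - by rewrite mulr_ge0 ?(ltW C10)// ltW// vol.
  rewrite -integral_cst//; apply: ae_ge0_le_integral => //.
  - by move=> x _; rewrite lee_fin ltW// cmass_gt0.
  - by move=> x _; rewrite mule_ge0 ?lee_fin// mulr_ge0 ?(ltW C10)// ltW// vol.
  - by apply: measurable_funeM.
  - have := @w_A1 b k k0; apply: filterS => x H xa.
    by rewrite -EFinM lee_fin; apply/H/ab.
rewrite lebH// -!EFinM lee_fin.
by rewrite -ler_pdivlMr// => /le_trans; apply; apply: le_of_eq; field; rewrite gt_eqF.
Qed.

(** Jensen's inequality on the small cube, then the reverse Hoelder inequality on the large one. The
    gain (|Q|/|Q'|)^(1 - 1/r) is the source of the decay across scales. *)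
Lemma cmass_reverse_doubling a b l k : 0 < l -> 0 < k -> hcube a l `<=` hcube b k ->
  cmass a l <= C2 `^ r^-1 * (l ^+ n / k ^+ n) `^ (1 - r^-1) * cmass b k.
Proof.
move=> l0 k0 ab; have vl := vol l0; have vk := vol k0.
have Ma := cmass_gt0 a l0; have Mb := cmass_gt0 b k0.
apply: (powR_inj_le r0); first exact: ltW.
  by rewrite !mulr_ge0 ?powR_ge0// ltW.
rewrite -lee_fin.
have := @integral_powR_le _ _ R leb (hcube a l) w r (mH a l)
  (measurable_funTS mw) (fun x _ => w_ge0 x) r1.
rewrite integral_w lebH// !poweR_EFin => H.
apply: le_trans H _.
apply: (@le_trans _ _ ((C2 * k ^+ n * (cmass b k / k ^+ n) `^ r)%:E * ((l ^+ n) `^ (r - 1))%:E)%E).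
  apply: lee_wpmul2r; first by rewrite lee_fin powR_ge0.
  apply: le_trans (w_RH b k0); apply: ge0_subset_integral => //.
  by move=> x _; rewrite lee_fin powR_ge0.
rewrite -EFinM lee_fin; apply: le_of_eq.
have [A ->] := pos_expR Mb; have [B ->] := pos_expR vl; have [K ->] := pos_expR vk.
have [E ->] := pos_expR C20.
by exp_field.
Qed.

Let intws_r a l : (\int[leb]_(x in hcube a l) (w x `^ s)%:E = wpow_dens s (hcube a l))%E.
Proof. by rewrite densE. Qed.

(** With [cmass_pow_ge], this makes S(Q) comparable to |Q| (W(Q)/|Q|)^s. The upper bound is Jensen's
    inequality with exponent r/s followed by reverse Hoelder; the lower one is A_1 raised to the
    power s. *)
Lemma wpow_dens_le a l : 0 < l ->
  (wpow_dens s (hcube a l) <= (C2 `^ (s / r) * l ^+ n * (cmass a l / l ^+ n) `^ s)%:E)%E.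
Proof.
move=> l0; have vl := vol l0; have Ma := cmass_gt0 a l0.
have rs : 1 < r / s by rewrite ltr_pdivlMr// mul1r.
have := @integral_powR_le _ _ R leb (hcube a l) (fun x => w x `^ s) (r / s) (mH a l)
  (measurable_funTS (@mws s)) (fun x _ => powR_ge0 _ _) rs.
rewrite intws_r lebH// poweR_EFin.
have -> : (\int[leb]_(x in hcube a l) ((w x `^ s) `^ (r / s))%:E =
    \int[leb]_(x in hcube a l) (w x `^ r)%:E)%E.
  apply: eq_integral => x _; rewrite -powRrM mulrCA divff ?mulr1//.
  by rewrite gt_eqF.
move=> H.
have := le_trans H (lee_wpmul2r _ (w_RH a l0)).
rewrite lee_fin powR_ge0 -EFinM => /(_ isT) {}H.
have rs0 : 0 < r / s by exact: lt_trans rs.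
have /le_poweR := H => /(_ (s / r)).
rewrite divr_ge0 ?(ltW s0) ?(ltW r0)// poweR_ge0 => /(_ isT isT).
rewrite -poweRrM (_ : r / s * (s / r) = 1); last by field; rewrite !gt_eqF.
rewrite poweRe1 ?measure_ge0// => /le_trans; apply.
rewrite poweR_EFin lee_fin; apply: le_of_eq.
have [A ->] := pos_expR Ma; have [B ->] := pos_expR vl; have [E ->] := pos_expR C20.
by exp_field.
Qed.

Lemma wpow_dens_fin a l : 0 < l -> (wpow_dens s (hcube a l) < +oo)%E.
Proof. by move=> l0; apply: le_lt_trans (wpow_dens_le a l0) _; rewrite ltry. Qed.

Lemma wpow_densE a l : 0 < l -> wpow_dens s (hcube a l) = (cmass_pow s a l)%:E.
Proof. by move=> l0; rewrite fineK// ge0_fin_numE// wpow_dens_fin. Qed.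

Lemma cmass_pow_gt0 a l : 0 < l -> 0 < cmass_pow s a l.
Proof.
move=> l0; rewrite -lte_fin -wpow_densE//; apply: dens_gt0 => // x.
exact: powR_gt0.
Qed.

Lemma cmass_pow_le a l : 0 < l ->
  cmass_pow s a l <= C2 `^ (s / r) * l ^+ n * (cmass a l / l ^+ n) `^ s.
Proof. by move=> l0; rewrite -lee_fin -wpow_densE// wpow_dens_le. Qed.

Lemma cmass_pow_ge a l : 0 < l ->
  l ^+ n * (cmass a l / l ^+ n) `^ s <= C1 `^ s * cmass_pow s a l.
Proof.
move=> l0; have vl := vol l0; have Ma := cmass_gt0 a l0.
have c0 : 0 < cmass a l / (C1 * l ^+ n) by rewrite divr_gt0// mulr_gt0.
have : (((cmass a l / (C1 * l ^+ n)) `^ s)%:E * leb (hcube a l) <= (cmass_pow s a l)%:E)%E.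
  rewrite -wpow_densE// densE -integral_cst//; apply: ae_ge0_le_integral => //.
  - by move=> x _; rewrite lee_fin powR_ge0.
  - by move=> x _; rewrite lee_fin powR_ge0.
  - have := @w_A1 a l l0; apply: filterS => x /[apply] H.
    rewrite lee_fin powR_gt0_le ?(ltW s0) ?(ltW c0)//.
    by rewrite ler_pdivrMr ?mulr_gt0// mulrC.
rewrite lebH// -EFinM lee_fin => H.
have := ler_wpM2l (powR_ge0 C1 s) H; apply: le_trans.
apply: le_of_eq.
have [A ->] := pos_expR Ma; have [B ->] := pos_expR vl; have [E ->] := pos_expR C10.
by exp_field.
Qed.

Lemma cmass_pow_doubling a b l k : 0 < l -> 0 < k -> hcube a l `<=` hcube b k ->
  cmass_pow s b k <= C2 `^ (s / r) * C1 `^ s * C1 `^ s * (k ^+ n / l ^+ n) * cmass_pow s a l.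
Proof.
move=> l0 k0 ab; have vl := vol l0; have vk := vol k0.
have Ma := cmass_gt0 a l0; have Mb := cmass_gt0 b k0.
apply: le_trans (cmass_pow_le b k0) _.
have H : (cmass b k / k ^+ n) `^ s <= C1 `^ s * (cmass a l / l ^+ n) `^ s.
  rewrite -powRM ?divr_ge0 ?(ltW C10) ?(ltW vl) ?(ltW Ma)//.
  rewrite powR_gt0_le ?divr_ge0 ?(ltW s0) ?(ltW vk) ?(ltW Mb)//.
  rewrite ler_pdivrMr//; apply: le_trans (cmass_doubling l0 k0 ab) _.
  by apply: le_of_eq; field; rewrite gt_eqF.
have H2 := cmass_pow_ge a l0.
apply: (@le_trans _ _ (C2 `^ (s / r) * k ^+ n * (C1 `^ s * (cmass a l / l ^+ n) `^ s))).
  by rewrite ler_wpM2l// mulr_ge0 ?powR_ge0 ?(ltW vk).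
rewrite [leLHS](_ : _ = (C2 `^ (s / r) * C1 `^ s * (k ^+ n / l ^+ n)) * (l ^+ n * (cmass a l / l ^+
  n) `^ s)); last first.
  by field; rewrite gt_eqF.
rewrite [leRHS](_ : _ = (C2 `^ (s / r) * C1 `^ s * (k ^+ n / l ^+ n)) * (C1 `^ s * cmass_pow s a
  l)); last by ring.
by rewrite ler_wpM2l// !mulr_ge0 ?powR_ge0 ?invr_ge0 ?(ltW vl) ?(ltW vk).
Qed.

(** Both masses are compared with those of W, whose reverse doubling is then raised to the power s.
    The exponent of the volume ratio is s (1 - 1/r) + 1 - s = 1 - s/r, positive because s < r. *)
Lemma cmass_pow_reverse_doubling a b l k : 0 < l -> 0 < k -> hcube a l `<=` hcube b k ->
  cmass_pow s a l <= C2 `^ (s / r) * C2 `^ (s / r) * C1 `^ s *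
    (l ^+ n / k ^+ n) `^ (1 - s / r) * cmass_pow s b k.
Proof.
move=> l0 k0 ab; have vl := vol l0; have vk := vol k0.
have Ma := cmass_gt0 a l0; have Mb := cmass_gt0 b k0.
apply: le_trans (cmass_pow_le a l0) _.
have H : (cmass a l / l ^+ n) `^ s <=
    C2 `^ (s / r) * ((l ^+ n / k ^+ n) `^ (- (s / r))) * (cmass b k / k ^+ n) `^ s.
  apply: (@le_trans _ _ ((C2 `^ r^-1 * (l ^+ n / k ^+ n) `^ (1 - r^-1) * cmass b k / l ^+ n) `^ s)).
    rewrite powR_gt0_le ?divr_ge0 ?(ltW s0) ?(ltW vl) ?(ltW Ma)//.
    by rewrite ler_pM2r ?invr_gt0//; exact: cmass_reverse_doubling.
  apply: le_of_eq.
  have [A ->] := pos_expR Mb; have [B ->] := pos_expR vl; have [K ->] := pos_expR vk.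
  have [E ->] := pos_expR C20.
  by exp_field.
have H2 := cmass_pow_ge b k0.
apply: (@le_trans _ _ (C2 `^ (s / r) * l ^+ n * (C2 `^ (s / r) * ((l ^+ n / k ^+ n) `^ (- (s / r)))
  * (cmass b k / k ^+ n) `^ s))).
  by rewrite ler_wpM2l// mulr_ge0 ?powR_ge0 ?(ltW vl).
apply: (@le_trans _ _ (C2 `^ (s / r) * C2 `^ (s / r) * (l ^+ n / k ^+ n) `^ (1 - s / r) * (k ^+ n *
  (cmass b k / k ^+ n) `^ s))).
  apply: le_of_eq.
  have [A ->] := pos_expR Mb; have [B ->] := pos_expR vl; have [K ->] := pos_expR vk.
  have [E ->] := pos_expR C20.
  by exp_field.
have := ler_wpM2l _ H2 => /(_ (C2 `^ (s / r) * C2 `^ (s / r) * (l ^+ n / k ^+ n) `^ (1 - s / r))).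
by rewrite !mulr_ge0 ?powR_ge0// => /(_ isT) /le_trans; apply; apply: le_of_eq; ring.
Qed.

Lemma wdens_doubling a b l : 0 < l -> hcube a l `<=` hcube b (2 * l) ->
  (wdens (hcube b (2 * l)) <= (C1 * 2 ^+ n)%:E * wdens (hcube a l))%E.
Proof.
move=> l0 ab; have l20 : 0 < 2 * l by rewrite mulr_gt0.
rewrite !wdensE -EFinM lee_fin; apply: le_trans (cmass_doubling l0 l20 ab) _.
by rewrite exprMn mulfK ?gt_eqF ?vol.
Qed.

Lemma john_nirenberg_wdens t : 0 < t -> exists C, 0 < C /\
  forall (b : Rn R n -> R[i]) (c : Rn R n -> R -> R[i]), cmeasurable setT b ->
  (forall (a : Rn R n) (l : R), (0 < l)%R ->
    \int[wdens]_(x in hcube a l) (normc (b x - c a l))%:E <= wdens (hcube a l))%E ->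
  forall (a : Rn R n) (l : R), (0 < l)%R ->
    (\int[wdens]_(x in hcube a l) (normc (b x - c a l) `^ t)%:E <= C%:E * wdens (hcube a l))%E.
Proof.
move=> t0; apply: (@john_nirenberg _ _ wdens (C1 * 2 ^+ n)) => //.
- by move=> a l l0; exact: dens_gt0.
- by rewrite mulr_ge0 ?(ltW C10)// exprn_ge0.
- exact: wdens_doubling.
Qed.

(** The oscillation is still measured in W. Hoelder's inequality splits w^s as w^(1/th) w^e with e
    th' = r: one factor is a W-moment of the higher order t th, the other is the reverse Hoelder
    integral. [cmass_pow_ge] turns the resulting power of W(Q) into S(Q). *)
Lemma john_nirenberg_wpow_dens t : 0 < t -> exists C, 0 < C /\
  forall (b : Rn R n -> R[i]) (c : Rn R n -> R -> R[i]), cmeasurable setT b ->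
  (forall (a : Rn R n) (l : R), (0 < l)%R ->
    \int[wdens]_(x in hcube a l) (normc (b x - c a l))%:E <= wdens (hcube a l))%E ->
  forall (a : Rn R n) (l : R), (0 < l)%R ->
    (\int[wpow_dens s]_(x in hcube a l) (normc (b x - c a l) `^ t)%:E <=
      C%:E * wpow_dens s (hcube a l))%E.
Proof.
move=> t0; pose th := (r - 1) / (r - s); pose th' := (r - 1) / (s - 1).
have rs0 : 0 < r - s by rewrite subr_gt0.
have s10 : 0 < s - 1 by rewrite subr_gt0.
have r10 : 0 < r - 1 by rewrite subr_gt0.
have th0 : 0 < th by rewrite divr_gt0.
have th'0 : 0 < th' by rewrite divr_gt0.
have thE : th^-1 + th'^-1 = 1 by rewrite /th /th'; field; rewrite !gt_eqF.
have [C [C0 HC]] := john_nirenberg_wdens (mulr_gt0 t0 th0).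
exists (C `^ th^-1 * C2 `^ th'^-1 * C1 `^ s); split.
  by rewrite !mulr_gt0 ?powR_gt0.
move=> b c mb osc a l l0; set h := fun x => normc (b x - c a l).
have vl := vol l0; have Ma := cmass_gt0 a l0.
have mh E : measurable_fun E h.
  by apply: measurable_funTS; apply: measurable_normc => //; exact: cmeasurable_subr.
have mht E u : measurable_fun E (fun x => (h x `^ u)%:E).
  by apply: measurable_powR_comp; exact: mh.
rewrite integral_dens//; last by move=> x _; rewrite lee_fin powR_ge0.
pose e := s - th^-1.
have := @hoelder_ge0 _ _ R leb (hcube a l) (fun x => h x `^ t * w x `^ th^-1)
  (fun x => w x `^ e) th th' (mH a l).
have mf1 : measurable_fun (hcube a l) (fun x => h x `^ t * w x `^ th^-1).
  by apply: measurable_funM; [apply/measurable_EFinP; exact: mht|exact: measurable_funTS (@mws _)].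
move=> /(_ mf1 (measurable_funTS (@mws _))) H.
have {}H := H (fun x _ => mulr_ge0 (powR_ge0 _ _) (powR_ge0 _ _)) (fun x _ => powR_ge0 _ _) th0
  th'0 thE.
apply: (@le_trans _ _ (\int[leb]_(x in hcube a l) (h x `^ t * w x `^ th^-1 * w x `^ e)%:E)%E).
  apply: le_of_eq; apply: eq_integral => x _.
  rewrite -EFinM -mulrA -powRD; last by rewrite (gt_eqF (w_gt0 x)) implybT.
  by rewrite /e subrKC.
apply: le_trans H _.
have -> : (\int[leb]_(x in hcube a l) ((w x `^ e) `^ th')%:E =
    \int[leb]_(x in hcube a l) (w x `^ r)%:E)%E.
  apply: eq_integral => x _; rewrite -powRrM (_ : e * th' = r)//.
  by rewrite /e /th /th'; field; rewrite !gt_eqF.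
have -> : (\int[leb]_(x in hcube a l) ((h x `^ t * w x `^ th^-1) `^ th)%:E =
    \int[wdens]_(x in hcube a l) (h x `^ (t * th))%:E)%E.
  rewrite integral_dens//; last by move=> x _; rewrite lee_fin powR_ge0.
  apply: eq_integral => x _; rewrite powRM ?powR_ge0// -!powRrM mulVf ?gt_eqF//.
  by rewrite powRr1.
apply: (@le_trans _ _ (((C%:E * wdens (hcube a l)) `^ th^-1) *
    (C2 * l ^+ n * (cmass a l / l ^+ n) `^ r)%:E `^ th'^-1)%E).
  apply: lee_pmul; rewrite ?poweR_ge0//; apply: le_poweR.
  - by rewrite invr_ge0 ltW.
  - by apply: integral_ge0 => x _; rewrite lee_fin powR_ge0.
  - exact: HC.
  - by rewrite invr_ge0 ltW.
  - by apply: integral_ge0 => x _; rewrite lee_fin powR_ge0.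
  - exact: w_RH.
rewrite wdensE wpow_densE//.
have -> : ((C%:E * (cmass a l)%:E) `^ th^-1 = ((C * cmass a l) `^ th^-1)%:E)%E by [].
rewrite poweR_EFin -!EFinM lee_fin.
apply: (@le_trans _ _ (C `^ th^-1 * C2 `^ th'^-1 * (l ^+ n * (cmass a l / l ^+ n) `^ s))).
  apply: le_of_eq.
  have [A ->] := pos_expR Ma; have [B ->] := pos_expR vl; have [E ->] := pos_expR C20.
  have [K ->] := pos_expR C0; rewrite /th /th'.
  by exp_field.
rewrite [leRHS](_ : _ = C `^ th^-1 * C2 `^ th'^-1 * (C1 `^ s * cmass_pow s a l)); last by ring.
by apply: ler_wpM2l; [rewrite mulr_ge0 ?powR_ge0|exact: cmass_pow_ge].
Qed.

End cube_weights.

Lemma exprzD_pow2 {R : realType} (k : int) (d : nat) : (2 : R) ^ (k + d%:Z) = 2 ^ k * 2 ^+ d.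
Proof. by rewrite exprzDr// unitfE. Qed.

Lemma sum_indicator_le (R : realType) (F : finType) (P : nat -> bool) (f : nat -> F) :
  (forall i j, P i -> P j -> f i = f j -> i = j) ->
  (\sum_(i <oo) (P i)%:R%:E <= (#|F|%:R : R)%:E)%E.
Proof.
move=> finj; apply: nneseries_le => [i|N]; first by rewrite lee_fin.
rewrite sumEFin lee_fin -natr_sum ler_nat -big_mkcond/= sum1_card.
rewrite -(card_in_imset (f := fun i : 'I_N => f i)); first exact: max_card.
by move=> i j Pi Pj /finj H; apply/val_inj/H.
Qed.

Lemma inord_absz_inj (K : nat) (x y : int) : 0 <= x <= K%:Z -> 0 <= y <= K%:Z ->
  inord (absz x) = inord (absz y) :> 'I_K.+1 -> x = y.
Proof. by move=> x0 y0 /(congr1 val)/=; rewrite !inordK; lia. Qed.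

(** * The estimate near a cube *)

Section grid.
Context {R : realType} {n : nat}.

Definition gcorner (k : int) (j : n.-tuple int) : Rn R n :=
  [tuple 2 ^ k * ((tnth j i)%:~R - 1) | i < n].

(** The dyadic cube of side 2^k and index j, tripled about itself. Thanks to the tripling, two
    points whose coordinates differ by less than 2^k always share a cube of one fixed grid. *)
Definition gcube (k : int) (j : n.-tuple int) : set (Rn R n) :=
  hcube (gcorner k j) (3 * 2 ^ k).

Definition gfloor (k : int) (x : Rn R n) : n.-tuple int :=
  [tuple Num.floor (tnth x i / 2 ^ k) | i < n].

Let e2 (k : int) : 0 < (2 : R) ^ k. Proof. exact: exprz_gt0. Qed.

Lemma gside_gt0 (k : int) : 0 < 3 * (2 : R) ^ k.
Proof. by rewrite mulr_gt0. Qed.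

Lemma gcubeP k j (x : Rn R n) : gcube k j x ->
  forall i, tnth (gfloor k x) i - 1 <= tnth j i <= tnth (gfloor k x) i + 1.
Proof.
move=> xQ i; have /andP[] := xQ i; rewrite !tnth_mktuple => H1 H2.

set z := tnth x i in H1 H2 *; set jj := tnth j i in H1 H2 *.
have Z1 : jj%:~R - 1 <= z / 2 ^ k by rewrite ler_pdivlMr// mulrC.
have Z2 : z / 2 ^ k < jj%:~R + 2.
  by rewrite ltr_pdivrMr//; apply: lt_le_trans H2 _; apply: le_of_eq; ring.
have /andP[F1 F2] := floor_itv (z / 2 ^ k).
set fl := Num.floor _ in F1 F2 *.
have A : fl%:~R < (jj + 2)%:~R :> R by rewrite intrD; exact: le_lt_trans F1 Z2.
have B : (jj - 1)%:~R < (fl + 1)%:~R :> R by rewrite intrD; exact: le_lt_trans Z1 F2.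
by move: A B; rewrite !ltr_int => A B; apply/andP; lia.
Qed.

Lemma gcube_pair k (x y : Rn R n) :
  (forall i, `|tnth x i - tnth y i| < 2 ^ k) ->
  gcube k (gfloor k x) x /\ gcube k (gfloor k x) y.
Proof.
move=> xy; suff H z : (forall i, `|tnth x i - tnth z i| < 2 ^ k) ->
    gcube k (gfloor k x) z.
  by split; apply: H => // i; rewrite subrr normr0.
move=> {}xy i; rewrite !tnth_mktuple.
have /andP[F1 F2] := floor_itv (tnth x i / 2 ^ k).
set fl := Num.floor _ in F1 F2 *.
move: F1 F2; rewrite ler_pdivlMr// ltr_pdivrMr// intrD => F1 F2.
move: (xy i); rewrite ltr_norml => /andP[].
by set e := 2 ^ k in F1 F2 *; set f := fl%:~R in F1 F2 *; lra.
Qed.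

(** Tripled cubes through a common point need not be nested; they all lie in a cube centred at that
    point with twice the larger side, through which their masses are compared. *)
Lemma gcube_sub k k' j (x : Rn R n) : k <= k' -> gcube k j x ->
  gcube k j `<=` hcube [tuple tnth x i - 3 * 2 ^ k' | i < n] (2 * (3 * 2 ^ k')).
Proof.
move=> kk' xQ y yQ i; have := yQ i; have := xQ i; rewrite !tnth_mktuple.
have : (2 : R) ^ k <= 2 ^ k' by rewrite ler_eXz2l ?ltr1n.
by set e := 2 ^ k; set e' := 2 ^ k'; set f := 2 ^ k * _; lra.
Qed.

(** Scales and positions are enumerated by [nat], to be summed as series; an integer that codes
    nothing yields the empty set in [gset] and hence no contribution. *)
Definition gidx (i : nat) : option (int * n.-tuple int) := pickle_inv i.

Definition gset i := if gidx i is Some u then gcube u.1 u.2 else set0.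

Lemma measurable_gset i : measurable (gset i).
Proof. by rewrite /gset; case: gidx => // u; exact: measurable_hcube. Qed.

Lemma gidx_inj i j u : gidx i = Some u -> gidx j = Some u -> i = j.
Proof.
move=> iu ju; have := pickle_invK i; have := pickle_invK j.
move: iu ju; rewrite /gidx => iu ju /(_ (int * n.-tuple int)%type) Hj /(_ (int * n.-tuple
  int)%type) Hi.
by rewrite /= iu/= in Hi; rewrite /= ju/= in Hj; rewrite -Hi -Hj.
Qed.

Lemma gidxK u : gidx (pickle u) = Some u.
Proof. exact: pickleK_inv. Qed.

(* Geometric growth confines the cubes of comparable mass through a point to a
   bounded window of scales. *)
Lemma gset_overlap (m : set (Rn R n) -> \bar R) (M : set (Rn R n) -> R) (D rho : R) :
  m set0 = 0%E -> (forall k j, m (gcube k j) = (M (gcube k j))%:E) ->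
  (forall k j, 0 < M (gcube k j)) ->
  0 < D -> 0 < rho < 1 ->
  (forall k j j' x (d : nat), gcube k j x -> gcube (k + d%:Z) j' x ->
     M (gcube k j) <= D * rho ^+ d * M (gcube (k + d%:Z) j')) ->
  exists N0 : R, 0 <= N0 /\ forall x t, 0 < t ->
    (\sum_(i <oo) ((x \in gset i) && (t < fine (m (gset i)) <= 2 * t)%R)%:R%:E <= N0%:E)%E.
Proof.
move=> m0 mM M0 D0 /andP[rho0 rho1] HD.
(* From [K] scales apart on, the larger of two cubes through x has more than twice the mass of the
   smaller one, so they cannot both have mass between t and 2 t. *)
have [K HK] : exists K : nat, D * rho ^+ K < 2^-1.
  have rn1 : `|rho| < 1 by rewrite ger0_norm ?ltW.
  have /cvgrPdist_lt H := cvg_expr rn1.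
  have e0 : 0 < 2^-1 / D by rewrite divr_gt0// invr_gt0.
  have [K _ /(_ K (leqnn K))/=] := H _ e0.
  rewrite sub0r normrN ger0_norm ?exprn_ge0 ?(ltW rho0)// => HK.
  by exists K; rewrite mulrC -ltr_pdivlMr.
(* At most 2 K + 1 scales relative to a reference cube, and 3 positions per coordinate relative to
   the dyadic cell of x: the cubes of one layer inject into this type. *)
pose F : finType := ('I_(2 * K).+1 * {ffun 'I_n -> 'I_3})%type.
exists #|F|%:R; split => [//|x t t0].
set P := fun i => (x \in gset i) && (t < fine (m (gset i)) <= 2 * t).
have PS i : P i -> exists u, [/\ gidx i = Some u, gcube u.1 u.2 x,
    t < M (gcube u.1 u.2) & M (gcube u.1 u.2) <= 2 * t].
  move=> /andP[/set_mem]; rewrite /gset; case: gidx => // u xu.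
  by rewrite mM/= => /andP[H1 H2]; exists u.
have near_scale k j j' (d : nat) : gcube k j x -> gcube (k + d%:Z) j' x ->
    t < M (gcube k j) -> M (gcube (k + d%:Z) j') <= 2 * t -> (d < K)%N.
  move=> xk xk' tk kt; rewrite ltnNge; apply/negP => Kd.
  have := HD _ _ _ _ _ xk xk'; apply/negP; rewrite -ltNge.
  apply: le_lt_trans tk.
  have H1 : D * rho ^+ d <= 2^-1.
    apply: le_trans (ltW HK); rewrite ler_pM2l//.
    by apply: ler_wiXn2l; rewrite ?(ltW rho0) ?(ltW rho1).
  apply: (@le_trans _ _ (2^-1 * (2 * t))).
    by apply: ler_pM => //; rewrite ?mulr_ge0 ?exprn_ge0 ?(ltW rho0) ?(ltW D0) ?(ltW (M0 _ _)).
  by rewrite mulKf.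
have scale k k' j j' : gcube k j x -> gcube k' j' x -> t < M (gcube k j) ->
    M (gcube k j) <= 2 * t -> t < M (gcube k' j') -> M (gcube k' j') <= 2 * t ->
    - K%:Z <= k' - k <= K%:Z.
  move=> xk xk' tk kt tk' kt'.
  have [kk'|kk'] := leP k k'.
    have E : k' = k + `|k' - k|%N%:Z by clear -kk'; lia.
    have := @near_scale k j j' `|k' - k|%N; rewrite -E => /(_ xk xk' tk kt'); clear -kk'; lia.
  have E : k = k' + `|k' - k|%N%:Z by clear -kk'; lia.
  have := @near_scale k' j' j `|k' - k|%N; rewrite -E => /(_ xk' xk tk' kt); clear -kk'; lia.
have [/asboolP[i0 /PS[u0 [iu0 xu0 tu0 ut0]]]|noP] := boolP `[< exists i, P i >]; last first.
  rewrite eseries0 ?lee_fin// => i _ _; rewrite -/(P i); case: (boolP (P i)) => // Pi.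
  by exfalso; move/asboolP: noP; apply; exists i.
pose f i : F := if gidx i is Some u then
  (inord (absz (u.1 - u0.1 + K%:Z)),
   [ffun d => inord (absz (tnth u.2 d - tnth (gfloor u.1 x) d + 1))])
  else (ord0, [ffun=> ord0]).
apply: (@sum_indicator_le R F P f) => i j /PS[u [iu xu tu ut]] /PS[v [jv xv tv vt]].
rewrite /f iu jv => -[E1 E2].
have uv1 : u.1 = v.1.
  have := scale _ _ _ _ xu0 xu tu0 ut0 tu ut; have := scale _ _ _ _ xu0 xv tu0 ut0 tv vt.
  move=> a b; apply: (addIr (- u0.1 + K%:Z)).
  rewrite !addrA; apply: inord_absz_inj E1; clear -a b; lia.
suff uv : u = v by rewrite uv in iu; exact: gidx_inj iu jv.
rewrite (surjective_pairing u) (surjective_pairing v) uv1; congr pair.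
apply: eq_from_tnth => d; move/ffunP/(_ d): E2; rewrite !ffunE.
have := gcubeP xu d; have := gcubeP xv d.
rewrite uv1; set fl := tnth (gfloor _ _) _ => a b E.
apply: (addIr (- fl + 1)); rewrite !addrA.
by apply: inord_absz_inj E; clear -a b; lia.
Qed.
End grid.

Lemma integral_powR_ltoo d (T : measurableType d) (R : realType)
  (mu : {measure set T -> \bar R}) (D : set T) (g : T -> R) (e p : R) :
  measurable D -> (mu D < +oo)%E -> measurable_fun D g -> (forall x, 0 <= g x) ->
  0 <= e <= p -> (\int[mu]_(x in D) (g x `^ p)%:E < +oo)%E ->
  (\int[mu]_(x in D) (g x `^ e)%:E < +oo)%E.
Proof.
move=> mD Doo mg g0 /andP[e0 ep] gp.
have mgt t : measurable_fun D (fun x => (g x `^ t)%:E) by exact: measurable_powR_comp.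
apply: (@le_lt_trans _ _ (\int[mu]_(x in D) (1%:E + (g x `^ p)%:E))%E).
  apply: ge0_le_integral => //.
  - by move=> x _; rewrite lee_fin powR_ge0.
  - by apply: emeasurable_funD => //; exact: measurable_cst.
  - move=> x _; rewrite -EFinD lee_fin; have [g1|g1] := leP (g x) 1.
      apply: (@le_trans _ _ 1); last by rewrite lerDl powR_ge0.
      by have := powR_gt0_le e0 (g0 x) g1; rewrite powR1.
    apply: (@le_trans _ _ (g x `^ p)); last by rewrite lerDr.
    by apply: ler_powR => //; exact: ltW.
rewrite ge0_integralD//.
- by rewrite integral_cst// mul1e lte_add_pinfty.
- by move=> x _; rewrite lee_fin powR_ge0.
Qed.

Lemma young_powR {R : realType} (S X Y P P' a b : R) : 0 <= X -> 0 <= Y ->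
  1 <= P -> 1 <= P' -> P^-1 + P'^-1 = 1 ->
  (S `^ a * X) * (S `^ b * Y) <= S `^ (P * a) * X `^ P + S `^ (P' * b) * Y `^ P'.
Proof.
move=> X0 Y0 P1 P'1 PP'.
have P0 : 0 < P by exact: lt_le_trans P1.
have P'0 : 0 < P' by exact: lt_le_trans P'1.
have := conjugate_powR (mulr_ge0 (powR_ge0 S a) X0) (mulr_ge0 (powR_ge0 S b) Y0) P0 P'0 PP'.
move=> H; apply: le_trans H _.
rewrite !powRM ?powR_ge0// -!powRrM [a * _]mulrC [b * _]mulrC.
apply: lerD; rewrite ler_pdivrMr//.
- by rewrite ler_peMr ?mulr_ge0 ?powR_ge0.
- by rewrite ler_peMr ?mulr_ge0 ?powR_ge0.
Qed.

Section local_estimate.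
Context {R : realType} {n : nat}.
Variable leb : {sigma_finite_measure set (Rn R n) -> \bar R}.
Hypothesis n0 : (0 < n)%N.
Hypothesis lebH : forall a l, 0 < l -> leb (hcube a l) = (l ^+ n)%:E.
Variables (w : Rn R n -> R) (mw : measurable_fun setT w) (w_gt0 : forall x, 0 < w x).
Variables (alpha p q C1 C2 r : R).
Hypotheses (p1 : 1 < p) (pq : p < q) (qE : q^-1 = p^-1 - alpha / n%:R).
Local Notation s := (q / p).
Hypotheses (C10 : 0 < C1) (C20 : 0 < C2) (sr : s < r).
Local Notation W := (wdens leb mw w_gt0).
Local Notation Sg := (wpow_dens leb mw s).
Local Notation cW := (cmass leb mw w_gt0).
Local Notation cS := (cmass_pow leb mw s).
Hypothesis wdens_fin : forall a l, (W (hcube a l) < +oo)%E.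
Hypothesis w_A1 : forall a l, 0 < l ->
  {ae leb, forall y, hcube a l y -> cW a l <= C1 * l ^+ n * w y}.
Hypothesis w_RH : forall a l, 0 < l ->
  (\int[leb]_(x in hcube a l) (w x `^ r)%:E <=
   (C2 * l ^+ n * (cW a l / l ^+ n) `^ r)%:E)%E.

Let p0 : 0 < p. Proof. exact: lt_trans p1. Qed.
Let q0 : 0 < q. Proof. exact: lt_trans pq. Qed.
Let s1 : 1 < s. Proof. by rewrite ltr_pdivlMr// mul1r. Qed.
Let N0 : 0 < n%:R :> R. Proof. by rewrite ltr0n. Qed.
Let vol l : 0 < l -> 0 < l ^+ n :> R. Proof. exact: exprn_gt0. Qed.
Let mH a l : measurable (hcube a l : set (Rn R n)). Proof. exact: measurable_hcube. Qed.
Let mws t : measurable_fun setT (fun x => w x `^ t).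
Proof. exact: (measurableT_comp (measurable_powR t)). Qed.
Let cS_gt0 a l : 0 < l -> 0 < cS a l.
Proof. exact: (cmass_pow_gt0 lebH C20 s1 sr wdens_fin w_RH). Qed.
Let SgE a l : 0 < l -> Sg (hcube a l) = (cS a l)%:E.
Proof. exact: (wpow_densE lebH C20 s1 sr wdens_fin w_RH). Qed.

Definition cavg e a l (g : Rn R n -> R) :=
  ((cS a l)^-1 * fine (\int[Sg]_(x in hcube a l) (g x `^ e)%:E)) `^ e^-1.

Lemma cube_average_le e Cb a l (beta g : Rn R n -> R) : 1 < e -> 0 <= Cb -> 0 < l ->
  measurable_fun setT beta -> measurable_fun setT g ->
  (forall x, 0 <= beta x) -> (forall x, 0 <= g x) ->
  (\int[Sg]_(x in hcube a l) (beta x `^ (e / (e - 1)))%:E <= Cb%:E * Sg (hcube a l))%E ->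
  (\int[Sg]_(x in hcube a l) (g x `^ e)%:E < +oo)%E ->
  (\int[Sg]_(x in hcube a l) (beta x * g x)%:E <=
    (Cb `^ (1 - e^-1) * cS a l * cavg e a l g)%:E)%E.
Proof.
move=> e1 Cb0 l0 mb mg b0 g0 Hb gfin.
have e0 : 0 < e by exact: lt_trans e1.
have e10 : 0 < e - 1 by rewrite subr_gt0.
have M0 := cS_gt0 a l0.
have conj : (e / (e - 1))^-1 + e^-1 = 1 by field; rewrite !gt_eqF.
have H := @hoelder_ge0 _ _ R Sg (hcube a l) beta g (e / (e - 1)) e (mH a l)
  (measurable_funTS mb) (measurable_funTS mg) (fun x _ => b0 x) (fun x _ => g0 x)
  (divr_gt0 e0 e10) e0 conj.
apply: le_trans H _; rewrite SgE// -EFinM in Hb.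
have gE : (\int[Sg]_(x in hcube a l) (g x `^ e)%:E =
    (fine (\int[Sg]_(x in hcube a l) (g x `^ e)%:E))%:E)%E.
  by rewrite fineK// ge0_fin_numE// integral_ge0// => x _; rewrite lee_fin powR_ge0.
set I := fine _ in gE; rewrite gE poweR_EFin.
have I0 : 0 <= I by rewrite fine_ge0// integral_ge0// => x _; rewrite lee_fin powR_ge0.
have conj' : (e / (e - 1))^-1 = 1 - e^-1 by field; rewrite !gt_eqF.
have ee : 0 <= 1 - e^-1 by rewrite -conj' invr_ge0 divr_ge0// ltW.
apply: (@le_trans _ _ ((Cb * cS a l) `^ (1 - e^-1) * I `^ e^-1)%:E).
  rewrite EFinM lee_wpmul2r ?lee_fin ?powR_ge0//.
  rewrite conj' -poweR_EFin; apply: le_poweR => //.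
  by apply: integral_ge0 => x _; rewrite lee_fin powR_ge0.
rewrite lee_fin /cavg -/I; apply: le_of_eq.
rewrite !powRM ?invr_ge0 ?(ltW M0)// -!mulrA; congr (_ * _).
rewrite mulrA; congr (_ * _).
by have [A ->] := pos_expR M0; rewrite -expRN; exp_field.
Qed.

(* g = f w^((1-s)/p) turns the L^p norm of f for w into that of g for w^s. *)
Lemma cube_fractional_le e Cb : 1 < e -> 0 < Cb -> exists C, 0 < C /\
  forall a l (beta g : Rn R n -> R), 0 < l ->
  measurable_fun setT beta -> measurable_fun setT g ->
  (forall x, 0 <= beta x) -> (forall x, 0 <= g x) ->
  (\int[Sg]_(x in hcube a l) (beta x `^ (e / (e - 1)))%:E <= Cb%:E * Sg (hcube a l))%E ->
  (\int[Sg]_(x in hcube a l) (g x `^ e)%:E < +oo)%E ->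
  ((l `^ (alpha - n%:R))%:E *
   \int[leb]_(x in hcube a l) (beta x * (g x * w x `^ ((s - 1) / p)))%:E <=
    (C * cS a l `^ (alpha / n%:R) * cavg e a l g)%:E)%E.
Proof.
move=> e1 Cb0.
(* The power of w left once w^s is set aside for the measure S. It is negative, so A_1 estimates it
   by the mass of the cube. *)
pose t := (s - 1) / p - s.
have t0 : t < 0.
  rewrite subr_lt0 ltr_pdivrMr//; apply: (@lt_le_trans _ _ s); first by rewrite gtrBl.
  by rewrite ler_peMr// ltW// ?(lt_trans ltr01 s1)//.
exists (C1 `^ (- t) * C2 `^ (- (t / r)) * Cb `^ (1 - e^-1)); split.
  by rewrite !mulr_gt0// powR_gt0.
move=> a l beta g l0 mb mg b0 g0 Hb gfin.
have H1 := cube_average_le e1 (ltW Cb0) l0 mb mg b0 g0 Hb gfin.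
have vl := vol l0; have M0 := cS_gt0 a l0; have A0 := cmass_gt0 lebH wdens_fin a l0.
pose F x := beta x * (g x * w x `^ ((s - 1) / p)).
have mF : measurable_fun (hcube a l) F.
  by apply: measurable_funTS; do 2 (apply: measurable_funM => //).
have F0 x : 0 <= F x by rewrite !mulr_ge0// powR_ge0.
have H2 := A1_integral_le lebH C10 wdens_fin w_A1 l0 (ltW t0) mF F0.
have H3 : (\int[leb]_(x in hcube a l) (F x * w x `^ (- t))%:E =
    \int[Sg]_(x in hcube a l) (beta x * g x)%:E)%E.
  rewrite integral_dens; [|exact: mH| |].
  - apply: eq_integral => x _; rewrite -EFinM /F -!mulrA; congr (_ * (_ * _))%:E.
    rewrite -powRD; last by rewrite (gt_eqF (w_gt0 x)) implybT.
    by congr (_ `^ _); rewrite /t; ring.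
  - by apply/measurable_EFinP; apply: measurable_funTS; exact: measurable_funM.
  - by move=> x _; rewrite lee_fin mulr_ge0.
apply: (@le_trans _ _ ((l `^ (alpha - n%:R))%:E * (((cW a l / (C1 * l ^+ n)) `^ t)%:E *
    (Cb `^ (1 - e^-1) * cS a l * cavg e a l g)%:E))%E).
  apply: lee_wpmul2l; first by rewrite lee_fin powR_ge0.
  apply: le_trans H2 _; rewrite H3; apply: lee_wpmul2l => //.
  by rewrite lee_fin powR_ge0.
rewrite -!EFinM lee_fin.
have H4 : (cW a l / (C1 * l ^+ n)) `^ t <= 
    C1 `^ (- t) * C2 `^ (- (t / r)) * (cS a l / l ^+ n) `^ (t / s).
  have := cmass_pow_le lebH C20 s1 sr wdens_fin w_RH a l0 => H.
  have ts : t / s <= 0 by rewrite ltW// pmulr_llt0// invr_gt0 (lt_trans ltr01 s1).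
  have u0 : 0 < cS a l / (C2 `^ (s / r) * l ^+ n) by rewrite divr_gt0// mulr_gt0// powR_gt0.
  have : cS a l / (C2 `^ (s / r) * l ^+ n) <= (cW a l / l ^+ n) `^ s.
    by rewrite ler_pdivrMr ?mulr_gt0 ?powR_gt0// [leRHS]mulrC.
  move=> /(powR_le0_le ts u0) H5.
  have -> : (cW a l / (C1 * l ^+ n)) `^ t = C1 `^ (- t) * ((cW a l / l ^+ n) `^ s) `^ (t / s).
    have [A ->] := pos_expR A0; have [B ->] := pos_expR vl; have [E ->] := pos_expR C10.
    by exp_field.
  rewrite -[leRHS]mulrA; apply: ler_wpM2l; first exact: powR_ge0.
  apply: le_trans H5 _.
  apply: le_of_eq.
  have [A ->] := pos_expR M0; have [B ->] := pos_expR vl; have [E ->] := pos_expR C20.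
  by exp_field; rewrite (lt_trans _ sr) ?(lt_trans _ s1).
have c0 : 0 <= cavg e a l g by exact: powR_ge0.
apply: (@le_trans _ _ (l `^ (alpha - n%:R) * (C1 `^ (- t) * C2 `^ (- (t / r)) * (cS a l / l ^+ n)
  `^ (t / s) *
    (Cb `^ (1 - e^-1) * cS a l * cavg e a l g)))).
  apply: ler_wpM2l; first exact: powR_ge0.
  by apply: ler_wpM2r => //; rewrite !mulr_ge0 ?powR_ge0 ?(ltW M0).
apply: le_of_eq.
(* With this value the powers of the side l cancel and only S(Q)^(alpha/n) is left. *)
have ts : t / s = alpha / n%:R - 1.
  have -> : alpha / n%:R = p^-1 - q^-1 by rewrite qE; ring.
  by rewrite /t; field; rewrite !gt_eqF.
have E : l `^ (alpha - n%:R) * ((cS a l / l ^+ n) `^ (t / s) * cS a l) = cS a l `^ (alpha / n%:R).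
  rewrite ts -powR_mulrn ?(ltW l0)//.
  have [A ->] := pos_expR M0; have [B ->] := pos_expR l0.
  by exp_field.
rewrite -E; ring.
Qed.

(** Pass from the small cube up to the common cube by reverse doubling of S, then down to the large
    grid cube by doubling. The decay per scale is 2^(-n (1 - s/r)). *)
Lemma gset_overlap_pow : exists N0 : R, 0 <= N0 /\ forall x t, 0 < t ->
  (\sum_(i <oo) ((x \in @gset R n i) && (t < fine (Sg (gset i)) <= 2 * t)%R)%:R%:E <= N0%:E)%E.
Proof.
pose d := 1 - s / r.
have s0 : 0 < s by exact: lt_trans s1.
have r0 : 0 < r by exact: lt_trans sr.
have d0 : 0 < d by rewrite subr_gt0 ltr_pdivrMr// mul1r.
pose A := C2 `^ (s / r) * C2 `^ (s / r) * C1 `^ s.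
pose B := C2 `^ (s / r) * C1 `^ s * C1 `^ s * 2 ^+ n.
have A0 : 0 < A by rewrite /A !mulr_gt0// powR_gt0.
have B0 : 0 < B by rewrite /B !mulr_gt0// ?powR_gt0// exprn_gt0.
pose h : R := ((2^-1 : R) ^+ n) `^ d.
have hn : 0 < (2^-1 : R) ^+ n < 1.
  by rewrite exprn_gt0//= exprn_ilt1// -?lt0n// invf_lt1// ltr1n.
have h01 : 0 < h < 1.
  case/andP: hn => a b; rewrite powR_gt0//= /h powRE// expR_lt1 pmulr_rlt0//.
  by rewrite ln_lt0// a.
apply: (@gset_overlap _ _ Sg (fun Q => fine (Sg Q)) (A * B) h) => //.
- by move=> k j; rewrite SgE ?gside_gt0.
- by move=> k j; exact/cS_gt0/gside_gt0.
- by rewrite mulr_gt0.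
move=> k j j' x e xk xk'.
have kk' : k <= k + e%:Z by rewrite lerDl.
have S1 := gcube_sub kk' xk; have S2 := gcube_sub (lexx _) xk'.
have k0 := gside_gt0 (R := R) k; have k'0 := gside_gt0 (R := R) (k + e%:Z).
set G := hcube _ _ in S1 S2.
have l0 : 0 < 2 * (3 * (2:R) ^ (k + e%:Z)) by rewrite mulr_gt0.
have H1 := cmass_pow_reverse_doubling lebH C10 C20 s1 sr wdens_fin w_A1 w_RH k0 l0 S1.
have H2 := cmass_pow_doubling lebH C10 C20 s1 sr wdens_fin w_A1 w_RH k'0 l0 S2.
apply: le_trans H1 _; rewrite -/A.
apply: (@le_trans _ _ (A * h ^+ e * (B * fine (Sg (gcube (k + e%:Z) j'))))); last first.
  by apply: le_of_eq; ring.
apply: ler_pM; first by apply: mulr_ge0; [exact: ltW|exact: powR_ge0].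

- exact/ltW/cS_gt0/l0.
- rewrite ler_pM2l// /h -powR_mulrn ?powR_ge0// -powRrM [d * _]mulrC powRrM.
  apply: powR_gt0_le; [exact: ltW|by rewrite divr_ge0// exprn_ge0// ltW|].
  rewrite powR_mulrn ?exprn_ge0// -expr_div_n -exprM [(n * _)%N]mulnC exprM.
  rewrite lerXn2r// ?nnegrE ?divr_ge0 ?exprn_ge0 ?(ltW k0) ?(ltW l0)//.
  rewrite exprzD_pow2 exprVn.
  have u0 : 0 < (2 : R) ^ k by exact: exprz_gt0.
  have v0 : 0 < (2 : R) ^+ e by exact: exprn_gt0.
  rewrite [leLHS](_ : _ = 2^-1 * (2 ^+ e)^-1); last by field; rewrite !gt_eqF.
  by rewrite ger_pMl ?invr_gt0// invf_le1// ler1n.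
- apply: le_trans H2 _.
  rewrite ler_pM2r; last exact: cS_gt0.
  rewrite /B ler_pM2l ?mulr_gt0 ?powR_gt0//.
  by rewrite exprMn mulfK// gt_eqF// exprn_gt0.
Qed.

(** On each grid cube the distance is replaced by the side and the kernel by a product of a function
    of x and a function of y, which decouples the two variables. *)
Definition gterm (beta : Rn R n -> R -> Rn R n -> R) (f : Rn R n -> R) i (x : Rn R n) : \bar R :=
  if gidx i is Some u then
    let a := gcorner u.1 u.2 in let l := 3 * 2 ^ u.1 in
    ((\1_(hcube a l) x * beta a l x)%:E * ((l `^ (alpha - n%:R))%:E *
      \int[leb]_(y in hcube a l) (beta a l y * f y)%:E))%E
  else 0%E.

Definition gop beta f x := (\sum_(i <oo) gterm beta f i x)%E.

Lemma gterm_ge0 beta f i x : (forall a l y, 0 <= beta a l y) -> (forall y, 0 <= f y) ->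
  (0 <= gterm beta f i x)%E.
Proof.
move=> b0 f0; rewrite /gterm; case: gidx => // u.
rewrite !mule_ge0 ?lee_fin ?mulr_ge0 ?powR_ge0//.
by apply: integral_ge0 => y _; rewrite lee_fin mulr_ge0.
Qed.

Lemma measurable_gterm beta f i : (forall a l, measurable_fun setT (beta a l)) ->
  measurable_fun setT (gterm beta f i).
Proof.
move=> mb; rewrite /gterm; case: gidx => [u|]; last exact: measurable_cst.
set c := ((_ `^ _)%:E * _)%E.
apply: emeasurable_funM; last exact: measurable_cst.
by apply/measurable_EFinP; apply: measurable_funM => //; exact: measurable_indic.
Qed.

(** After pairing with h, each cube contributes a product of an average of g and an average of h.
    Since alpha/n = 1/p - 1/q, the power of S(Q) splits into 1/p for g and 1/q' for h, the exponents
    for which [embedding_sum_le] is scaled. *)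
Lemma local_estimate Cb : (forall t, 0 < t -> 0 < Cb t) -> exists C, 0 < C /\
  forall (beta : Rn R n -> R -> Rn R n -> R) (f : Rn R n -> R),
  (forall a l, measurable_fun setT (beta a l)) -> (forall a l y, 0 <= beta a l y) ->
  (forall t a l, 0 < t -> 0 < l ->
    (\int[Sg]_(x in hcube a l) (beta a l x `^ t)%:E <= (Cb t)%:E * Sg (hcube a l))%E) ->
  measurable_fun setT f -> (forall x, 0 <= f x) ->
  (\int[W]_x (f x `^ p)%:E <= 1)%E ->
  (\int[Sg]_x (gop beta f x `^ q) <= C%:E)%E.
Proof.
move=> Cb0.
pose q' := q / (q - 1).
have q1 : 1 < q by exact: lt_trans pq.
have q10 : 0 < q - 1 by rewrite subr_gt0.
have q'1 : 1 < q' by rewrite /q' ltr_pdivlMr// mul1r gtrBl.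
have q'0 : 0 < q' by exact: lt_trans q'1.
(* An exponent above 1 but below both p and q' leaves room in Hoelder's inequality for [beta], all
   of whose moments are bounded. *)
have [e [e1 ep eq']] : exists e, [/\ 1 < e, e < p & e < q'].
  exists ((1 + Num.min p q') / 2).
  have m1 : 1 < Num.min p q' by rewrite lt_min p1.
  split; first by rewrite (midf_lt m1).
    by apply: (@lt_le_trans _ _ (Num.min p q')); [rewrite (midf_lt m1)|rewrite ge_min lexx].
  by apply: (@lt_le_trans _ _ (Num.min p q')); [rewrite (midf_lt m1)|rewrite ge_min lexx orbT].
have e0 : 0 < e by exact: lt_trans e1.
(* P > p and, because P < q, also P' > q': both factors fall in the strict range of the
   embedding. *)
pose P := (p + q) / 2; pose P' := P / (P - 1).
have pP : p < P by rewrite /P (midf_lt pq).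
have Pq : P < q by rewrite /P (midf_lt pq).
have P1 : 1 < P by exact: lt_trans pP.
have P10 : 0 < P - 1 by rewrite subr_gt0.
have P0 : 0 < P by exact: lt_trans P1.
have P'0 : 0 < P' by rewrite divr_gt0.
have q'P' : q' < P'.
  by rewrite /q' /P' ltr_pdivrMr// mulrAC ltr_pdivlMr//; lra.
have PP' : P^-1 + P'^-1 = 1 by rewrite /P'; field; rewrite !gt_eqF.
have t0 : 0 < e / (e - 1) by rewrite divr_gt0// subr_gt0.
have [A [A0 HA]] := cube_fractional_le e1 (Cb0 _ t0).
pose B := Cb (e / (e - 1)) `^ (1 - e^-1).
have B0 : 0 < B by rewrite powR_gt0// Cb0.
have [N1 [N10 overlap]] := gset_overlap_pow.
pose K r p := 2 `^ (r / e) * (N1 / (1 - 2 `^ (- (r / p - 1))) + N1 / (1 - 2 `^ (- (1 - e / p)))).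
pose D := A * B * (K P p + K P' q').
(* The added 1 makes the constant positive without a sign analysis of the series bounds in [D]. *)
exists ((`|D| + 1) `^ q); split; first by rewrite powR_gt0// ltr_wpDl.
move=> beta f mb b0 Hb mf f0 fp.
apply: (@Lnorm_dual_le _ _ R Sg (fun k => hcube [tuple - k%:R | i < n] (2 * k.+1%:R))) => //.
- move=> k l kl; apply/subsetPset; apply: hcube_sub => i; rewrite !tnth_mktuple.
    by rewrite lerN2 ler_nat.
  rewrite -!natr1 !mulrDr; have : (k%:R : R) <= l%:R by rewrite ler_nat.
  lra.
- rewrite predeqE => x; split=> // _.
  pose M := \sum_(i < n) `|tnth x i|.
  have [k Hk] : exists k : nat, M < k%:R by exists (Num.bound M); rewrite archi_boundP// sumr_ge0.
  exists k => // i; rewrite tnth_mktuple.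
  have : `|tnth x i| <= M by rewrite /M (bigD1 i)//= lerDl sumr_ge0.
  rewrite -natr1 => H; have /ltr_normlP[] : `|tnth x i| < k%:R by exact: le_lt_trans Hk.
  lra.
- by move=> k; rewrite SgE ?ltry// mulr_gt0.
- apply: ge0_emeasurable_sum => *; first exact: gterm_ge0.
  exact: measurable_gterm.
- by move=> x; apply: nneseries_ge0 => i _ _; exact: gterm_ge0.
move=> h mh h0 hq.
pose z := (s - 1) / p.
pose g x := f x * w x `^ (- z).
have mg : measurable_fun setT g by exact: measurable_funM.
have g0 x : 0 <= g x by rewrite mulr_ge0// powR_ge0.
have fE x : f x = g x * w x `^ z.
  by rewrite /g -mulrA -powRD ?addNr ?powRr0 ?mulr1// (gt_eqF (w_gt0 x)) implybT.
have gp : (\int[Sg]_x (g x `^ p)%:E <= 1)%E.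
  apply: le_trans fp; apply: le_of_eq.
  rewrite !integral_dens//; last 4 first.
  - exact: measurable_powR_comp.
  - by move=> x _; rewrite lee_fin powR_ge0.
  - exact: measurable_powR_comp.
  - by move=> x _; rewrite lee_fin powR_ge0.
  apply: eq_integral => x _; rewrite -!EFinM /g powRM ?powR_ge0// -mulrA; congr (_ * _)%:E.
  rewrite -powRrM -powRD; last by rewrite (gt_eqF (w_gt0 x)) implybT.
  rewrite (_ : _ + _ = 1); first by rewrite powRr1// ltW.
  by rewrite /z; field; rewrite gt_eqF.
have gfin (Q : set (Rn R n)) : measurable Q -> (Sg Q < +oo)%E -> (\int[Sg]_(x in Q) (g x `^ e)%:E <
  +oo)%E.
  move=> mQ Qoo; apply: (@integral_powR_ltoo _ _ _ _ _ _ _ p) => //.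
  - exact: measurable_funTS.
  - by rewrite !ltW.
  - apply: (@le_lt_trans _ _ 1%E); last exact: ltry.
    apply: le_trans gp; apply: ge0_subset_integral => //; first exact: measurable_powR_comp.
    by move=> x _; rewrite lee_fin powR_ge0.
have hfin (Q : set (Rn R n)) : measurable Q -> (Sg Q < +oo)%E -> (\int[Sg]_(x in Q) (h x `^ e)%:E <
  +oo)%E.
  move=> mQ Qoo; apply: (@integral_powR_ltoo _ _ _ _ _ _ _ q') => //.
  - exact: measurable_funTS.
  - by rewrite !ltW.
  - apply: (@le_lt_trans _ _ 1%E); last exact: ltry.
    apply: le_trans hq; apply: ge0_subset_integral => //; first exact: measurable_powR_comp.
    by move=> x _; rewrite lee_fin powR_ge0.
pose sz i := fine (Sg (@gset R n i)).
have szE i : Sg (gset i) = (sz i)%:E.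
  rewrite fineK// ge0_fin_numE// /gset; case: gidx => [u|]; last by rewrite measure0.
  by rewrite SgE ?ltry// gside_gt0.
pose av t (v : Rn R n -> R) i := ((sz i)^-1 * fine (\int[Sg]_(x in gset i) (v x `^ e)%:E)) `^ t.
have E1 := @embedding_sum_le _ _ _ Sg (@gset R n) sz N1 e p P (@measurable_gset R n) szE overlap
  N10 (ltW e1) ep pP g mg g0 gp.
have E2 := @embedding_sum_le _ _ _ Sg (@gset R n) sz N1 e q' P' (@measurable_gset R n) szE overlap
  N10 (ltW e1) eq' q'P' h mh h0 hq.
have term_le i : (\int[Sg]_x (gterm beta f i x * (h x)%:E) <=
   (A * B)%:E * ((sz i `^ (P / p) * av (P / e) g i)%:E + (sz i `^ (P' / q') * av (P' / e) h
     i)%:E))%E.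
  have av0 v t : 0 <= av t v i by exact: powR_ge0.
  have T0 : (0 <= (A * B)%:E * ((sz i `^ (P / p) * av (P / e) g i)%:E + (sz i `^ (P' / q') * av (P'
    / e) h i)%:E))%E.
    by rewrite -EFinD -EFinM lee_fin !(mulr_ge0, addr_ge0)// ?powR_ge0 ?(ltW A0) ?(ltW B0).
  case E : (@gidx n i) => [u|]; last first.
    by rewrite integral0_eq// => x _; rewrite /gterm E mul0e.
  pose a : Rn R n := gcorner u.1 u.2; pose l := 3 * (2 : R) ^ u.1.
  have l0 : 0 < l by exact: gside_gt0.
  have gE : gset i = hcube a l by rewrite /gset E.
  have SE : sz i = cS a l by rewrite /sz gE.
  have S0 := cS_gt0 a l0.
  have Hoo : (Sg (hcube a l) < +oo)%E by rewrite SgE ?ltry.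
  have H1 := HA a l (beta a l) g l0 (mb a l) mg (b0 a l) g0 (Hb _ _ _ t0 l0) (gfin _ (mH a l) Hoo).
  have H2 := cube_average_le e1 (ltW (Cb0 _ t0)) l0 (mb a l) mh (b0 a l) h0 (Hb _ _ _ t0 l0) (hfin
    _ (mH a l) Hoo).
  pose c := ((l `^ (alpha - n%:R))%:E * \int[leb]_(y in hcube a l) (beta a l y * f y)%:E)%E.
  have c0 : (0 <= c)%E.
    rewrite mule_ge0 ?lee_fin ?powR_ge0//; apply: integral_ge0 => y _.
    by rewrite lee_fin mulr_ge0.
  have cle : (c <= (A * cS a l `^ (alpha / n%:R) * cavg e a l g)%:E)%E.
    apply: le_trans H1; apply: le_of_eq; congr (_ * _)%E.
    by apply: eq_integral => y _; rewrite -fE.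
  have -> : (\int[Sg]_x (gterm beta f i x * (h x)%:E) = c * \int[Sg]_(x in hcube a l) (beta a l x *
    h x)%:E)%E.
    rewrite [in RHS]integral_mkcond -ge0_integralZl//; last 2 first.
    - apply/(measurable_restrictT _ (mH a l)); apply: measurable_funTS.
      by apply/measurable_EFinP; apply: measurable_funM.
    - by move=> x _; rewrite patchE; case: ifPn => // _; rewrite lee_fin mulr_ge0.
    apply: eq_integral => x _; rewrite /gterm E -/a -/l -/c patchE indicE.
    by case: ifPn => _; rewrite ?mul1r ?mul0r ?mul0e ?mule0// muleAC [RHS]muleC.
  apply: (@le_trans _ _ ((A * cS a l `^ (alpha / n%:R) * cavg e a l g)%:E *
     (B * cS a l * cavg e a l h)%:E)%E).
    apply: lee_pmul; [exact: c0| |exact: cle|exact: H2].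
    by apply: integral_ge0 => x _; rewrite lee_fin mulr_ge0.
  have avE v t : av (t / e) v i = cavg e a l v `^ t.
    by rewrite /av /cavg SE gE -powRrM [e^-1 * t]mulrC.
  rewrite !avE SE -EFinD -!EFinM lee_fin.
  set X := cavg e a l g; set Y := cavg e a l h.
  have X0 : 0 <= X by exact: powR_ge0.
  have Y0 : 0 <= Y by exact: powR_ge0.
  rewrite [leLHS](_ : _ = A * B * ((cS a l `^ p^-1 * X) * (cS a l `^ q'^-1 * Y))); last first.
    have SS : cS a l `^ (alpha / n%:R) * cS a l = cS a l `^ p^-1 * cS a l `^ q'^-1.
      have -> : alpha / n%:R = p^-1 - q^-1 by rewrite qE; ring.
      have q'E : q'^-1 = 1 - q^-1 by rewrite /q'; field; rewrite !gt_eqF.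
      by have [V ->] := pos_expR S0; rewrite q'E; exp_field.
    transitivity (A * B * (cS a l `^ (alpha / n%:R) * cS a l) * X * Y); first by ring.
    by rewrite SS; ring.
  apply: ler_wpM2l; first by rewrite mulr_ge0 ?(ltW A0) ?(ltW B0).
  have P'1 : 1 <= P' by rewrite ler_pdivlMr ?mul1r ?gerBl.
  exact: (young_powR _ _ _ X0 Y0 (ltW P1) P'1 PP').
apply: (@le_trans _ _ D%:E); last by rewrite lee_fin (le_trans (ler_norm D))// lerDl.
rewrite (eq_integral (fun x => \sum_(i <oo) (gterm beta f i x * (h x)%:E)))%E; last first.
  move=> x _; rewrite muleC /gop -nneseriesZl//; last by move=> i _; exact: gterm_ge0.
  by apply: eq_eseriesr => i _; rewrite muleC.
have gt0 i x : (0 <= gterm beta f i x)%E by exact: gterm_ge0.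
rewrite integral_nneseries//; last 2 first.
- by move=> i; apply: emeasurable_funM; [exact: measurable_gterm|apply/measurable_EFinP].
- by move=> i x _; rewrite mule_ge0// lee_fin.
apply: (@le_trans _ _ (\sum_(i <oo) ((A * B)%:E * ((sz i `^ (P / p) * av (P / e) g i)%:E + (sz i `^
  (P' / q') * av (P' / e) h i)%:E)))%E).
  apply: lee_nneseries => [i _ _|i _]; last exact: term_le.
  by apply: integral_ge0 => x _; rewrite mule_ge0// lee_fin.
have AB0 : 0 <= A * B by rewrite mulr_ge0// ltW.
have av0 t v i : 0 <= sz i `^ t * av (P / e) v i by rewrite mulr_ge0// powR_ge0.
have av0' t v i : 0 <= sz i `^ t * av (P' / e) v i by rewrite mulr_ge0// powR_ge0.
rewrite nneseriesZl//; last by move=> i _; rewrite adde_ge0// lee_fin.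
rewrite nneseriesD//; last 2 first.
- by move=> i _ _; rewrite lee_fin.
- by move=> i _ _; rewrite lee_fin.
rewrite (_ : D%:E = (A * B)%:E * ((K P p)%:E + (K P' q')%:E))%E; last by rewrite -EFinD -EFinM.
apply: lee_wpmul2l; first by rewrite lee_fin.
by apply: leeD; [exact: E1|exact: E2].
Qed.

End local_estimate.

Section euclidean_distance.
Context {R : realType} {n : nat}.
Implicit Types x y z : Rn R n.

Lemma edistRn_ge0 x y : 0 <= edist x y. Proof. exact: sqrtr_ge0. Qed.

Lemma edistRnxx x : edist x x = 0.
Proof. by rewrite /edist big1 ?sqrtr0// => i _; rewrite subrr expr0n. Qed.

Lemma tnth_edistRn_le x y i : `|tnth x i - tnth y i| <= edist x y.
Proof.
rewrite -sqrtr_sqr ler_wsqrtr// (bigD1 i)//= lerDl.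
by apply: sumr_ge0 => j _; exact: sqr_ge0.
Qed.

Lemma edistRn_eq0 x y : edist x y = 0 -> x = y.
Proof.
move=> xy; apply: eq_from_tnth => i; apply/eqP.
by rewrite -subr_eq0 -normr_le0 -xy tnth_edistRn_le.
Qed.

Lemma edistRn_le (l : R) x y : 0 <= l -> (forall i, `|tnth x i - tnth y i| <= l) ->
  edist x y <= n%:R * l.
Proof.
move=> l0 xy; rewrite -[leRHS]ger0_norm ?mulr_ge0// -sqrtr_sqr ler_wsqrtr//.
apply: (@le_trans _ _ (\sum_(i < n) l ^+ 2)).
  by apply: ler_sum => i _; rewrite -real_normK ?num_real// lerXn2r ?nnegrE.
rewrite big_const_ord iter_addr_0 -[leLHS]mulr_natl exprMn.
apply: ler_wpM2r; first exact: sqr_ge0.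
by rewrite -natrX ler_nat; case: (n) => // k; rewrite leq_pmulr.
Qed.

Lemma measurable_edist : measurable_fun setT (fun z : Rn R n * Rn R n => edist z.1 z.2).
Proof.
apply: (measurableT_comp (continuous_measurable_fun (@sqrt_continuous R))).
apply: measurable_sum => i.
apply: measurable_funX; apply: measurable_funB.
- by apply: (measurableT_comp (measurable_tnth i)); exact: measurable_fst.
- by apply: (measurableT_comp (measurable_tnth i)); exact: measurable_snd.
Qed.

End euclidean_distance.

(** For t < 1 the scale is 2^(1-l) whenever 2^(-l-1) < t <= 2^(-l): it stays strictly above t at the
    closed end, and is only below 4 t near the open one. *)
Lemma dyadic_scale {R : realType} (t : R) : 0 < t -> exists k : int, 2 ^ k <= 4 * t /\ t < 2 ^ k.
Proof.
move=> t0; have [t1|t1] := leP 1 t.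
  have [l /andP[l1 l2]] := dyadic_below t1.
  exists (l.+1%:Z); rewrite -exprnP; split => //.
  by rewrite exprS; move: l1; set u := 2 ^+ l; lra.
have t1' : 1 <= t^-1 by rewrite invf_ge1// ltW.
have [l /andP[l1 l2]] := dyadic_below t1'.
have u0 : 0 < (2:R) ^+ l by exact: exprn_gt0.
exists (1 - l%:Z); rewrite expfzDr// -invr_expz -exprnP expr1z.
move: l1 l2; rewrite -[t^-1]mul1r ler_pdivlMr// ltr_pdivrMr// exprS => l1 l2.
rewrite ler_pdivrMr// ltr_pdivlMr//; move: l1 l2; rewrite -mulrA -[4 * t * _]mulrA [t * _]mulrC.
by set v := _ * t; lra.
Qed.

(** * Positive kernel operators and their dyadic majorants *)

Section kernel_operator.
Context {R : realType} {n : nat}.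
Variable leb : {sigma_finite_measure set (Rn R n) -> \bar R}.
Variable alpha : R.
Hypothesis alpha_lt : alpha < n%:R.
Implicit Types (K : Rn R n -> Rn R n -> R) (f : Rn R n -> R)
  (beta : Rn R n -> R -> Rn R n -> R).

(** A Riesz potential with an additional kernel. On the diagonal the negative power of the distance
    0 is 0 by the convention of [powR]. *)
Definition kop (K : Rn R n -> Rn R n -> R) (f : Rn R n -> R) x : \bar R :=
  (\int[leb]_y (K x y * f y * edist x y `^ (alpha - n%:R))%:E)%E.

Let an : alpha - n%:R < 0. Proof. by rewrite subr_lt0. Qed.

Lemma measurable_kop_kernel K f D : measurable_fun setT (fun z => K z.1 z.2) ->
  measurable_fun setT f ->
  measurable_fun D (fun z : Rn R n * Rn R n => (K z.1 z.2 * f z.2 * edist z.1 z.2 `^ (alpha -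
    n%:R))%:E).
Proof.
move=> mK mf; apply/measurable_EFinP; apply: measurable_funTS.
apply: measurable_funM; last exact: (measurableT_comp (measurable_powR _) measurable_edist).
by apply: measurable_funM => //; apply: (measurableT_comp mf); exact: measurable_snd.
Qed.

Lemma measurable_kop K f : measurable_fun setT (fun z => K z.1 z.2) ->
  measurable_fun setT f -> (forall x y, 0 <= K x y) -> (forall y, 0 <= f y) ->
  measurable_fun setT (kop K f).
Proof.
move=> mK mf K0 f0.
apply: (@measurable_fun_fubini_tonelli_F _ _ _ _ R leb
  (fun z => (K z.1 z.2 * f z.2 * edist z.1 z.2 `^ (alpha - n%:R))%:E)).
  exact: measurable_kop_kernel.
by move=> z; rewrite lee_fin !mulr_ge0// powR_ge0.
Qed.

Lemma measurable_kop_section K f x : measurable_fun setT (fun z => K z.1 z.2) ->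
  measurable_fun setT f ->
  measurable_fun setT (fun y => (K x y * f y * edist x y `^ (alpha - n%:R))%:E).
Proof.
move=> mK mf.
pose G (z : Rn R n * Rn R n) := (K z.1 z.2 * f z.2 * edist z.1 z.2 `^ (alpha - n%:R))%:E.
have mG : measurable_fun setT G by exact: measurable_kop_kernel.
by apply: (measurableT_comp mG (f := G) (g := fun y => (x, y))); exact: pair1_measurable.
Qed.

(** A point y other than x shares with x a grid cube of the scale just above their distance, and
    that one term already dominates the kernel. Its side l = 3 2^k is at most 12 |x - y|, hence the
    constant. *)
Lemma kop_le_gop (K : Rn R n -> Rn R n -> R) (A : R) beta f x : 0 <= A ->
  measurable_fun setT (fun z => K z.1 z.2) -> measurable_fun setT f ->
  (forall a l, measurable_fun setT (beta a l)) ->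
  (forall y, 0 <= K x y) -> (forall y, 0 <= f y) -> (forall a l y, 0 <= beta a l y) ->
  (forall a l y, K x y <= A * beta a l x * beta a l y) ->
  (kop K f x <= (A * 12 `^ (n%:R - alpha))%:E * gop leb alpha beta f x)%E.
Proof.
move=> A0 mK mf mb K0 f0 b0 Kb.
pose c := A * 12 `^ (n%:R - alpha).
have c0 : 0 <= c by rewrite mulr_ge0// powR_ge0.
pose phi i y : \bar R := if gidx i is Some u then
    let a := gcorner u.1 u.2 in let l := 3 * 2 ^ u.1 in
    (\1_(hcube a l) x * beta a l x * (l `^ (alpha - n%:R)) * (\1_(hcube a l) y * (beta a l y * f
      y)))%:E
  else 0%E.
have phi0 i y : (0 <= phi i y)%E.
  by rewrite /phi; case: gidx => // u; rewrite lee_fin !mulr_ge0 ?powR_ge0.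
have mphi i : measurable_fun setT (phi i).
  rewrite /phi; case: gidx => [u|]; last exact: measurable_cst.
  apply/measurable_EFinP; apply: measurable_funM => //.
  apply: measurable_funM; last exact: measurable_funM.
  by apply: measurable_indic; exact: measurable_hcube.
have -> : gop leb alpha beta f x = (\int[leb]_y (\sum_(i <oo) phi i y))%E.
  rewrite integral_nneseries//; apply: eq_eseriesr => i _.
  rewrite /gterm /phi; case: gidx => [u|]; last by rewrite integral0.
  set a := gcorner _ _; set l := 3 * _.
  rewrite [(\int[_]_(y in hcube _ _) _)%E]integral_mkcond muleA -EFinM -ge0_integralZl//.
  - apply: eq_integral => y _; rewrite patchE indicE [in RHS]indicE.
    by case: ifPn => _; rewrite ?mul1r ?mul0r ?mule0 ?mulr0// EFinM.
  - apply/(measurable_restrictT _ (measurable_hcube _ _)); apply: measurable_funTS.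
    by apply/measurable_EFinP; apply: measurable_funM.
  - by move=> y _; rewrite patchE; case: ifPn => // _; rewrite lee_fin mulr_ge0.
  - by rewrite lee_fin !mulr_ge0 ?powR_ge0.
rewrite -ge0_integralZl//; last 2 first.
- exact: ge0_emeasurable_sum.
- by move=> y _; apply: nneseries_ge0.
apply: ge0_le_integral => //.
- by move=> y _; rewrite lee_fin !mulr_ge0 ?powR_ge0.
- exact: measurable_kop_section.
- by apply: measurable_funeM; exact: ge0_emeasurable_sum.
move=> y _; have [xy|xy] := eqVneq x y.
  rewrite xy edistRnxx powR0 ?lt_eqF// mulr0.
  by rewrite mule_ge0 ?lee_fin// nneseries_ge0.
have t0 : 0 < edist x y.
  by rewrite lt_def edistRn_ge0 andbT; apply: contra_neq xy; exact: edistRn_eq0.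
have [k [k1 k2]] := dyadic_scale t0.
have [xQ yQ] : gcube k (gfloor k x) x /\ gcube k (gfloor k x) y.
  by apply: gcube_pair => i; apply: le_lt_trans k2; exact: tnth_edistRn_le.
pose i := pickle (k, gfloor k x).
apply: (@le_trans _ _ (c%:E * phi i y)%E); last first.
  by apply: lee_wpmul2l; [rewrite lee_fin|exact: nneseries_ge_term].
rewrite /phi gidxK/= -/(gcube k (gfloor k x)) !indicE !mem_set// !mul1r -EFinM lee_fin.
set a := gcorner _ _; set l := 3 * 2 ^ k.
have l0 : 0 < l by exact: gside_gt0.
have H : edist x y `^ (alpha - n%:R) <= 12 `^ (n%:R - alpha) * l `^ (alpha - n%:R).
  have lt : l / 12 <= edist x y by move: k1; rewrite /l; set e := 2 ^ k; lra.
  have l12 : 0 < l / 12 by rewrite divr_gt0.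
  apply: le_trans (powR_le0_le (ltW an) l12 lt) _.
  rewrite powRM ?(ltW l0)// mulrC ler_wpM2r ?powR_ge0//.
  by rewrite -powR_inv1// -powRrM mulN1r opprB.
apply: (@le_trans _ _ (A * beta a l x * beta a l y * f y * (12 `^ (n%:R - alpha) * l `^ (alpha -
  n%:R)))).
  by apply: ler_pM => //; rewrite ?powR_ge0 ?mulr_ge0 ?ler_wpM2r.
by apply: le_of_eq; rewrite /c; ring.
Qed.

End kernel_operator.

(** For k = 0 this is the tripled cube. For larger k the dilate is not concentric, but the family is
    nested, consecutive sides have ratio 2, and the margin around the original cube is at least 2^k
    l on every side. *)
Definition dilc {R : realType} {n : nat} (k : nat) (a : Rn R n) (l : R) : Rn R n :=
  [tuple tnth a i - 2 ^+ k * l | i < n].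

Definition dils {R : realType} (k : nat) (l : R) : R := 3 * 2 ^+ k * l.

Section dilations.
Context {R : realType} {n : nat}.
Implicit Types (a x y : Rn R n) (l : R).

Lemma dils_gt0 k l : 0 < l -> 0 < dils k l.
Proof. by move=> l0; rewrite /dils !mulr_gt0// exprn_gt0. Qed.

Lemma dil_sub0 k a l : 0 < l -> hcube a l `<=` hcube (dilc k a l) (dils k l).
Proof.
move=> l0; have e1 : 1 <= (2 : R) ^+ k by rewrite exprn_ege1// ler1n.
have : l <= 2 ^+ k * l by rewrite ler_peMl// ltW.
by move=> el; apply: hcube_sub => i; rewrite tnth_mktuple /dils -?mulrA; move: el; set u := _ * l;
  lra.
Qed.

Lemma dil_subS k a l : 0 < l ->
  hcube (dilc k a l) (dils k l) `<=` hcube (dilc k.+1 a l) (dils k.+1 l).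
Proof.
move=> l0; have u0 : 0 < (2 : R) ^+ k * l by rewrite mulr_gt0// exprn_gt0.
by apply: hcube_sub => i; rewrite !tnth_mktuple /dils exprS -!mulrA; move: u0; set u := 2 ^+ k * l;
  lra.
Qed.

Lemma dil_far k a l x y : 0 < l -> hcube a l x -> ~ hcube (dilc k a l) (dils k l) y ->
  2 ^+ k * l <= edist x y.
Proof.
move=> l0 xa /existsNP[i /negP]; rewrite tnth_mktuple negb_and -ltNge -leNgt /dils -mulrA.
have e1 : 1 <= (2 : R) ^+ k by rewrite exprn_ege1// ler1n.
have el : l <= 2 ^+ k * l by rewrite ler_peMl// ltW.
have /andP[x1 x2] := xa i => H.
apply: le_trans (tnth_edistRn_le x y i).
move: el H; set u := 2 ^+ k * l => el /orP[H|H].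
- apply: le_trans (ler_norm _); lra.
- rewrite distrC; apply: le_trans (ler_norm _); lra.
Qed.

Lemma dil_cover a l : 0 < l -> \bigcup_k hcube (dilc k a l) (dils k l) = setT.
Proof.
move=> l0; rewrite predeqE => y; split=> // _.
pose M : R := \sum_(i < n) `|tnth y i - tnth a i|.
have M0 : 0 <= M by exact: sumr_ge0.
have M1 : 1 <= 1 + M / l by rewrite lerDl divr_ge0// ltW.
have [k' /andP[_ k1]] := dyadic_below M1; pose k := k'.+1.
have {}k1 : M <= 2 ^+ k * l by rewrite -ler_pdivrMr//; rewrite /k; lra.
exists k => // i; rewrite tnth_mktuple /dils -mulrA.
have : `|tnth y i - tnth a i| <= M by rewrite /M (bigD1 i)//= lerDl sumr_ge0.
have u0 : 0 < 2 ^+ k * l by rewrite mulr_gt0// exprn_gt0.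
rewrite ler_norml => /andP[]; move: k1 u0; set u := 2 ^+ k * l.
move=> *; apply/andP; split; lra.
Qed.

End dilations.

Lemma poweR_addr_le {R : realType} (u v : \bar R) (t : R) : 0 <= t ->
  (0 <= u)%E -> (0 <= v)%E -> ((u + v) `^ t <= (2 `^ t)%:E * (u `^ t + v `^ t))%E.
Proof.
move=> t0; have [->|tn0] := eqVneq t 0.
  move=> u0 v0; rewrite !poweRe0 powRr0 mul1e -EFinD lee_fin; lra.
have t1 : 0 < t by rewrite lt_def tn0.
have e2 : (0 < (2 `^ t)%:E)%E by rewrite lte_fin powR_gt0.
case: u => [u| |]//; case: v => [v| |]// u0 v0.
- rewrite -EFinD !poweR_EFin -EFinD -EFinM lee_fin; exact: powR_addr_le.
- rewrite [(+oo `^ t)%E]poweRyr// addey; last by rewrite poweR_EFin.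
  by rewrite gt0_muley// leey.
- rewrite [(+oo `^ t)%E]poweRyr// addye; last by rewrite poweR_EFin.
  by rewrite gt0_muley// leey.
- by rewrite poweRyr// addye// gt0_muley// leey.
Qed.

(** * The estimate away from a cube *)

Section tail_estimate.
Context {R : realType} {n : nat}.
Variable leb : {sigma_finite_measure set (Rn R n) -> \bar R}.
Hypothesis n0 : (0 < n)%N.
Hypothesis lebH : forall a l, 0 < l -> leb (hcube a l) = (l ^+ n)%:E.
Variables (w : Rn R n -> R) (mw : measurable_fun setT w) (w_gt0 : forall x, 0 < w x).
Variables (alpha p q C1 C2 r kappa : R).
Hypotheses (p1 : 1 < p) (pq : p < q) (qE : q^-1 = p^-1 - alpha / n%:R).
Local Notation s := (q / p).
Hypotheses (C10 : 0 < C1) (C20 : 0 < C2) (sr : s < r).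
Local Notation W := (wdens leb mw w_gt0).
Local Notation Sg := (wpow_dens leb mw s).
Local Notation cW := (cmass leb mw w_gt0).
Local Notation cS := (cmass_pow leb mw s).
Hypothesis wdens_fin : forall a l, (W (hcube a l) < +oo)%E.
Hypothesis w_A1 : forall a l, 0 < l ->
  {ae leb, forall y, hcube a l y -> cW a l <= C1 * l ^+ n * w y}.
Hypothesis w_RH : forall a l, 0 < l ->
  (\int[leb]_(x in hcube a l) (w x `^ r)%:E <=
   (C2 * l ^+ n * (cW a l / l ^+ n) `^ r)%:E)%E.
Hypothesis alpha_lt : alpha < n%:R.
Hypotheses (kappa0 : 0 <= kappa) (kappa_lt : kappa < p / q)
  (kappa_r : (1 - kappa) / (p / q - kappa) < r).

Let p0 : 0 < p. Proof. exact: lt_trans p1. Qed.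
Let q0 : 0 < q. Proof. exact: lt_trans pq. Qed.
Let s1 : 1 < s. Proof. by rewrite ltr_pdivlMr// mul1r. Qed.
Let r1 : 1 < r. Proof. exact: lt_trans sr. Qed.
Let N0 : 0 < n%:R :> R. Proof. by rewrite ltr0n. Qed.
Let vol l : 0 < l -> 0 < l ^+ n :> R. Proof. exact: exprn_gt0. Qed.
Let mH a l : measurable (hcube a l : set (Rn R n)). Proof. exact: measurable_hcube. Qed.
Let cS_gt0 a l : 0 < l -> 0 < cS a l.
Proof. exact: (cmass_pow_gt0 lebH C20 s1 sr wdens_fin w_RH). Qed.
Let cW_gt0 a l : 0 < l -> 0 < cW a l.
Proof. exact: (cmass_gt0 lebH wdens_fin). Qed.
Let SgE a l : 0 < l -> Sg (hcube a l) = (cS a l)%:E.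
Proof. exact: (wpow_densE lebH C20 s1 sr wdens_fin w_RH). Qed.
Let WE a l : W (hcube a l) = (cW a l)%:E.
Proof. exact: (wdensE wdens_fin). Qed.

(** A_1 with exponent -1 turns Lebesgue measure into W, where Hoelder's inequality combines the
    moments of [beta] with the Morrey bound. *)
Lemma cube_integral_le Cb a l (beta f : Rn R n -> R) : 0 < Cb -> 0 < l ->
  measurable_fun setT beta -> measurable_fun setT f ->
  (forall x, 0 <= beta x) -> (forall x, 0 <= f x) ->
  (\int[W]_(x in hcube a l) (beta x `^ (p / (p - 1)))%:E <= Cb%:E * W (hcube a l))%E ->
  (\int[W]_(x in hcube a l) (f x `^ p)%:E <= (cW a l `^ kappa)%:E)%E ->
  (\int[leb]_(x in hcube a l) (beta x * f x)%:E <=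
    (C1 * Cb `^ (1 - p^-1) * l ^+ n * cW a l `^ ((kappa - 1) / p))%:E)%E.
Proof.
move=> Cb0 l0 mb mf b0 f0 Hb Hf.
have vl := vol l0; have M0 := cW_gt0 a l0.
have p10 : 0 < p - 1 by rewrite subr_gt0.
have mF : measurable_fun (hcube a l) (fun x => beta x * f x).
  by apply: measurable_funTS; exact: measurable_funM.
have F0 x : 0 <= beta x * f x by rewrite mulr_ge0.
have N10 : -1 <= 0 :> R by rewrite lerN10.
have H1 := A1_integral_le lebH C10 wdens_fin w_A1 l0 N10 mF F0.
apply: le_trans H1 _.
have -> : (\int[leb]_(x in hcube a l) (beta x * f x * w x `^ (- -1))%:E =
    \int[W]_(x in hcube a l) (beta x * f x)%:E)%E.
  rewrite integral_dens; [|exact: mH|by apply/measurable_EFinP|by move=> x _; rewrite lee_fin].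
  by apply: eq_integral => x _; rewrite opprK powRr1 ?EFinM// ltW.
have conj : (p / (p - 1))^-1 + p^-1 = 1 by field; rewrite !gt_eqF.
have H2 := @hoelder_ge0 _ _ R W (hcube a l) beta f (p / (p - 1)) p (mH a l)
  (measurable_funTS mb) (measurable_funTS mf) (fun x _ => b0 x) (fun x _ => f0 x)
  (divr_gt0 p0 p10) p0 conj.
have conj' : (p / (p - 1))^-1 = 1 - p^-1 by field; rewrite !gt_eqF.
have pp : 0 <= 1 - p^-1 by rewrite -conj' invr_ge0 divr_ge0// ltW.
have H3 : (\int[W]_(x in hcube a l) (beta x * f x)%:E <=
    ((Cb * cW a l) `^ (1 - p^-1) * (cW a l `^ kappa) `^ p^-1)%:E)%E.
  apply: le_trans H2 _; rewrite EFinM -!poweR_EFin conj'.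
  rewrite WE -EFinM in Hb.
  apply: lee_pmul; [exact: poweR_ge0|exact: poweR_ge0| |].
  - by apply: le_poweR => //; apply: integral_ge0 => x _; rewrite lee_fin powR_ge0.
  - apply: le_poweR => //; first by rewrite invr_ge0 ltW.
    by apply: integral_ge0 => x _; rewrite lee_fin powR_ge0.
have := lee_wpmul2l _ H3 => /(_ ((cW a l / (C1 * l ^+ n)) `^ (-1))%:E).
rewrite lee_fin powR_ge0 => /(_ isT) /le_trans; apply.
rewrite -EFinM lee_fin; apply: le_of_eq.
have [A ->] := pos_expR M0; have [B ->] := pos_expR vl; have [E ->] := pos_expR C10.
have [K ->] := pos_expR Cb0.
by exp_field.
Qed.

(** This is the exponent of 2^k in the k-th annulus: alpha from kernel times volume, the rest from
    the power (1 - kappa)/p of W(Q)/W(2^k Q). It equals (n/p) (kappa - p/q + (1 - kappa)/r), whose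
    negativity is exactly the lower bound on r. *)
Lemma tail_exponent_lt0 : alpha - n%:R * (1 - r^-1) * ((1 - kappa) / p) < 0.
Proof.
have r0 : 0 < r by exact: lt_trans r1.
have pk : 0 < p / q - kappa by rewrite subr_gt0.
have -> : alpha = n%:R * (p^-1 - q^-1) by rewrite qE; field; rewrite !gt_eqF.
rewrite -!mulrA -mulrBr pmulr_rlt0//.
move: kappa_r; rewrite ltr_pdivrMr// -ltr_pdivrMl// => H.
have : p^-1 * (r^-1 * (1 - kappa)) < p^-1 * (p / q - kappa) by rewrite ltr_pM2l ?invr_gt0.
rewrite [ltRHS](_ : _ = q^-1 - kappa / p); last by field; rewrite !gt_eqF.
move=> {}H; rewrite [ltLHS](_ : _ = p^-1 * (r^-1 * (1 - kappa)) - (q^-1 - kappa / p)); last by ring.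
by rewrite subr_lt0.
Qed.

(** All that the operator estimates use of the oscillation of b: domination of the kernel by
    products of functions attached to cubes, with polynomial growth along dilates, and moments of
    these functions for both measures. *)
Record admissible (A t : R) (Cb : R -> R) (K : Rn R n -> Rn R n -> R)
    (beta : Rn R n -> R -> Rn R n -> R) : Prop := Admissible {
  adm_mK : measurable_fun setT (fun z : Rn R n * Rn R n => K z.1 z.2);
  adm_K0 : forall x y, 0 <= K x y;
  adm_mb : forall a l, measurable_fun setT (beta a l);
  adm_b0 : forall a l y, 0 <= beta a l y;
  adm_near : forall a l x y, K x y <= A * beta a l x * beta a l y;
  adm_far : forall a l k x y, 0 < l ->
    K x y <= A * k.+1%:R `^ t * beta a l x * beta (dilc k a l) (dils k l) y;
  adm_pow : forall u a l, 0 < u -> 0 < l ->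
    (\int[Sg]_(x in hcube a l) (beta a l x `^ u)%:E <= (Cb u)%:E * Sg (hcube a l))%E;
  adm_w : forall u a l, 0 < u -> 0 < l ->
    (\int[W]_(x in hcube a l) (beta a l x `^ u)%:E <= (Cb u)%:E * W (hcube a l))%E }.

Definition morrey_le1 (f : Rn R n -> R) := forall a l, 0 < l ->
  (\int[W]_(x in hcube a l) (f x `^ p)%:E <= (cW a l `^ kappa)%:E)%E.

Lemma kop_tail_le A t Cb : 0 < A -> 0 <= t -> (forall u, 0 < u -> 0 < Cb u) ->
  exists C, 0 < C /\ forall K beta (f : Rn R n -> R), admissible A t Cb K beta ->
  measurable_fun setT f -> (forall x, 0 <= f x) -> morrey_le1 f ->
  forall (a : Rn R n) (l : R) x, 0 < l -> hcube a l x ->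
  (kop leb alpha K (fun y => \1_(~` hcube (dilc 0 a l) (dils 0 l)) y * f y)%R x <=
    (C * beta a l x * l `^ alpha * cW a l `^ ((kappa - 1) / p))%:E)%E.
Proof.
move=> A0 t0 Cb0.
pose d := alpha - n%:R * (1 - r^-1) * ((1 - kappa) / p).
have d0 : d < 0 by exact: tail_exponent_lt0.
pose rho : R := 2 `^ d.
have rho01 : 0 < rho < 1.
  by rewrite powR_gt0//=; have /andP[_] := @powRN_lt1 R (- d) (ltac:(by rewrite oppr_gt0));
    rewrite opprK.
have [S [S0 HS]] := poly_geometric_series t0 rho01.
pose B := Cb (p / (p - 1)).
have p'0 : 0 < p / (p - 1) by rewrite divr_gt0// subr_gt0.
have B0 : 0 < B by exact: Cb0.
have r0 : 0 < r by exact: lt_trans r1.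
have k1 : kappa < 1.
  by apply: (lt_trans kappa_lt); rewrite ltr_pdivrMr// mul1r.
have kp : (kappa - 1) / p < 0 by rewrite pmulr_llt0 ?invr_gt0// subr_lt0.
(* These gather the powers produced by reverse doubling and by the volume of the dilate. In [C], the
   base 6 is the ratio of the side 3 2^(k+1) l of the dilate to the distance 2^k l. *)
pose c1 := C2 `^ (- (r^-1 * ((kappa - 1) / p))).
pose e := n%:R + n%:R * (1 - r^-1) * ((kappa - 1) / p).
pose C := A * 2 `^ t * (C1 * B `^ (1 - p^-1)) * c1 * (6 `^ e) * S.
have C0 : 0 < C by rewrite /C /c1 !mulr_gt0// powR_gt0.
exists C; split => // K beta f [mK K0 mb b0 near far bS bW] mf f0 fm a l x l0 xa.
have vl := vol l0.
pose D k := hcube (dilc k a l) (dils k l).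
have mD k : measurable (D k) by exact: mH.
(* Term k stands for the points of D (k+1) outside D k: the distance is at least 2^k l, while the
   kernel bound is that of the dilate k+1, whence the k+2 in the polynomial factor. *)
pose coef k : R := A * k.+2%:R `^ t * beta a l x * (2 ^+ k * l) `^ (alpha - n%:R).
have coef0 k : 0 <= coef k by rewrite /coef !mulr_ge0 ?powR_ge0 ?(ltW A0).
pose phi k (y : Rn R n) :=
  ((coef k)%:E * (\1_(D k.+1) y * (beta (dilc k.+1 a l) (dils k.+1 l) y * f y))%:E)%E.
have phi0 k y : (0 <= phi k y)%E by apply: mule_ge0; rewrite lee_fin;
  [exact: coef0|rewrite !mulr_ge0].
have mphi k : measurable_fun setT (phi k).
  apply: measurable_funeM; apply/measurable_EFinP; apply: measurable_funM;
    last exact: measurable_funM.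
  exact: measurable_indic.
apply: (@le_trans _ _ (\int[leb]_y (\sum_(k <oo) phi k y))%E).
  apply: ge0_le_integral => //.
  - by move=> y _; rewrite lee_fin !mulr_ge0 ?powR_ge0.
  - apply: measurable_kop_section => //; apply: measurable_funM => //.
    by apply: measurable_indic; apply: measurableC.
  - exact: ge0_emeasurable_sum.
  move=> y _; rewrite indicE in_setC; case: (boolP (y \in hcube (dilc 0 a l) (dils 0 l))) => [|yD0].
    by rewrite mul0r mulr0 mul0r nneseries_ge0.
  rewrite mul1r.
  have exk : exists k, y \in D k.
    have : [set: Rn R n] y by []; rewrite -(dil_cover a l0) => -[k _ yk].
    by exists k; rewrite inE.
  case: (ex_minnP exk) => -[|k] yk mink; first by rewrite yk in yD0.
  have yNk : ~ D k y by move=> /mem_set/mink; rewrite ltnn.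
  apply: le_trans (nneseries_ge_term k (fun k => phi0 k y)).
  rewrite /phi indicE yk mul1r -EFinM lee_fin /coef.
  have H1 := far a l k.+1 x y l0.
  have ek0 : 0 < 2 ^+ k * l by rewrite mulr_gt0// exprn_gt0.
  have H2 : edist x y `^ (alpha - n%:R) <= (2 ^+ k * l) `^ (alpha - n%:R).
    by apply: powR_le0_le; [rewrite subr_le0 ltW|exact: ek0|exact: dil_far yNk].
  rewrite mulrAC; rewrite [leRHS](_ : _ = (A * k.+2%:R `^ t * beta a l x * beta (dilc k.+1 a l)
    (dils k.+1 l) y) *
     (2 ^+ k * l) `^ (alpha - n%:R) * f y); last by ring.
  apply: ler_wpM2r; first exact: f0.
  by apply: ler_pM; [exact: K0|exact: powR_ge0|exact: H1|exact: H2].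
rewrite integral_nneseries//.
have kp0 : 0 <= l `^ alpha * cW a l `^ ((kappa - 1) / p) by rewrite mulr_ge0 ?powR_ge0.
have term k : (\int[leb]_y phi k y <=
    (A * 2 `^ t * (C1 * B `^ (1 - p^-1)) * c1 * (6 `^ e) * beta a l x * (l `^ alpha * cW a l `^
      ((kappa - 1) / p)))%:E * 
    (k.+1%:R `^ t * rho ^+ k)%:E)%E.
  have L0 : 0 < dils k.+1 l by exact: dils_gt0.
  rewrite ge0_integralZl//; last 2 first.
  - by move=> y _; rewrite lee_fin !mulr_ge0.
  - by rewrite lee_fin coef0.
  rewrite (_ : (\int[leb]_y (\1_(D k.+1) y * (beta (dilc k.+1 a l) (dils k.+1 l) y * f y))%:E) =
    \int[leb]_(y in D k.+1) (beta (dilc k.+1 a l) (dils k.+1 l) y * f y)%:E)%E; last first.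
    rewrite [in RHS]integral_mkcond; apply: eq_integral => y _; rewrite patchE indicE.
    by case: ifPn => _; rewrite ?mul1r ?mul0r.
  have H1 := cube_integral_le B0 L0 (mb _ _) mf (b0 _ _) f0 (bW _ _ _ p'0 L0) (fm (dilc k.+1 a l) _
    L0).
  apply: (le_trans (lee_wpmul2l _ H1)); first by rewrite lee_fin.
  rewrite -!EFinM lee_fin /coef.
  have Q0 := cW_gt0 a l0; have D0 := cW_gt0 (dilc k.+1 a l) L0.
  have H2 := cmass_reverse_doubling lebH C20 s1 sr wdens_fin w_RH l0 L0 (@dil_sub0 R n k.+1 a l l0).
  set V := cmass leb mw w_gt0 (dilc k.+1 a l) (dils k.+1 l) in D0 H2 *.
  set U := cmass leb mw w_gt0 a l in Q0 H2 *.
  have e0 : 0 < (2 : R) ^+ k by exact: exprn_gt0.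
  have kt : (k.+2%:R : R) `^ t <= 2 `^ t * k.+1%:R `^ t.
    by rewrite -powRM//; apply: powR_gt0_le => //;
      rewrite -natrM ler_nat mul2n -addnn addSn ltnS leq_addl.
  have VU : V `^ ((kappa - 1) / p) <=
      (C2 `^ r^-1 * (l ^+ n / dils k.+1 l ^+ n) `^ (1 - r^-1)) `^ (- ((kappa - 1) / p)) * U `^
        ((kappa - 1) / p).
    set Z := _ * _ `^ _ in H2 *.
    have Z0 : 0 < Z by rewrite mulr_gt0 ?powR_gt0// divr_gt0// exprn_gt0.
    have : U / Z <= V by rewrite ler_pdivrMr// mulrC.
    move=> /(powR_le0_le (ltW kp) (divr_gt0 Q0 Z0)) /le_trans; apply.
    apply: le_of_eq.
    have [z ->] := pos_expR Z0; have [u ->] := pos_expR Q0.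
    by exp_field.
  set Y := C1 * B `^ (1 - p^-1).
  have Y0 : 0 <= Y by rewrite mulr_ge0 ?powR_ge0// ltW.
  apply: (@le_trans _ _ (A * (2 `^ t * k.+1%:R `^ t) * beta a l x * (2 ^+ k * l) `^ (alpha - n%:R) *
    (Y * dils k.+1 l ^+ n * ((C2 `^ r^-1 * (l ^+ n / dils k.+1 l ^+ n) `^ (1 - r^-1)) `^ (- ((kappa
      - 1) / p)) * U `^ ((kappa - 1) / p))))).
    apply: ler_pM.
    - exact: coef0.
    - by apply: mulr_ge0; [apply: mulr_ge0 => //; exact/exprn_ge0/ltW|exact: powR_ge0].
    - by apply: ler_wpM2r; [exact: powR_ge0|apply: ler_wpM2r => //; apply: ler_wpM2l => //;
      exact: ltW].
    - by apply: ler_wpM2l => //; rewrite mulr_ge0// exprn_ge0// ltW.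
  apply: le_of_eq.
  have key : (2 ^+ k * l) `^ (alpha - n%:R) * dils k.+1 l ^+ n * (C2 `^ r^-1 * (l ^+ n / dils k.+1
    l ^+ n) `^ (1 - r^-1)) `^ (- ((kappa - 1) / p)) =
     c1 * 6 `^ e * l `^ alpha * rho ^+ k.
    rewrite /c1 /rho -(powR_mulrn k (powR_ge0 2 d)) -powRrM [d * _]mulrC powRrM powR_mulrn//.
    rewrite -expr_div_n /dils exprS; set ek := 2 ^+ k in e0 *.
    rewrite -!powR_mulrn; [|by rewrite ?divr_ge0 ?mulr_ge0 ?(ltW e0) ?(ltW l0)..].
    have [E Ee] := pos_expR e0; have [L ->] := pos_expR l0; have [G ->] := pos_expR C20.
    rewrite (_ : 3 * (2 * ek) = 6 * ek); last by ring.
    have [F ->] : exists F, 6 = expR F :> R by exact: pos_expR.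
    by rewrite !Ee /e /d; exp_field.
  rewrite [LHS](_ : _ = A * 2 `^ t * k.+1%:R `^ t * beta a l x * Y * U `^ ((kappa - 1) / p) * ((2
    ^+ k * l) `^ (alpha - n%:R) * dils k.+1 l ^+ n * (C2 `^ r^-1 * (l ^+ n / dils k.+1 l ^+ n) `^
      (1 - r^-1)) `^ (- ((kappa - 1) / p)))); last by ring.
  by rewrite key; ring.
  apply/measurable_EFinP; apply: measurable_funM; last exact: measurable_funM.
  exact: measurable_indic.
apply: (@le_trans _ _ (\sum_(k <oo) ((A * 2 `^ t * (C1 * B `^ (1 - p^-1)) * c1 * (6 `^ e) * beta a
  l x * (l `^ alpha * cW a l `^ ((kappa - 1) / p)))%:E * 
    (k.+1%:R `^ t * rho ^+ k)%:E))%E).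
  apply: lee_nneseries => [k _ _|k _]; last exact: term.
  by apply: integral_ge0 => y _; exact: phi0.
set X := (A * _ * _ * _ * _ * _ * _).
have X0 : 0 <= X.
  by rewrite /X /c1 !mulr_ge0 ?powR_ge0// ?(ltW A0) ?(ltW C10).
rewrite nneseriesZl//; last first.
  by move=> k _; rewrite lee_fin mulr_ge0 ?powR_ge0// exprn_ge0// powR_ge0.
apply: (le_trans (lee_wpmul2l _ HS)); first by rewrite lee_fin.
rewrite -EFinM lee_fin; apply: le_of_eq.
by rewrite /X /C; ring.
Qed.

(** The near part of f, divided by V^(kappa/p) with V the mass of the tripled cube, meets the
    normalisation of [local_estimate], and V is comparable to W(Q) by doubling. The far part is
    bounded pointwise by a multiple of [beta], whose q-th moment for S concludes. *)
Lemma kop_morrey_le A t Cb : 0 < A -> 0 <= t -> (forall u, 0 < u -> 0 < Cb u) ->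
  exists C, 0 < C /\ forall K beta (f : Rn R n -> R), admissible A t Cb K beta ->
  measurable_fun setT f -> (forall x, 0 <= f x) -> morrey_le1 f ->
  forall (a : Rn R n) (l : R), 0 < l ->
  (\int[Sg]_(x in hcube a l) (kop leb alpha K f x `^ q) <=
    (C * cW a l `^ (kappa * q / p))%:E)%E.
Proof.
move=> A0 t0 Cb0.
have [CT [CT0 HT]] := kop_tail_le A0 t0 Cb0.
have [CL [CL0 HL]] := local_estimate n0 lebH p1 pq qE C10 C20 sr wdens_fin w_A1 w_RH Cb0.
pose c := A * 12 `^ (n%:R - alpha).
have c0 : 0 < c by rewrite mulr_gt0// powR_gt0.
pose D3 := C1 * 3 ^+ n.
have D30 : 0 < D3 by rewrite mulr_gt0// exprn_gt0.
pose S2 := C2 `^ (s / r).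
have S20 : 0 < S2 by exact: powR_gt0.
exists (2 `^ q * (c `^ q * CL * D3 `^ (kappa * q / p) + CT `^ q * Cb q * S2)); split.
  by rewrite mulr_gt0 ?powR_gt0// addr_gt0// !mulr_gt0 ?powR_gt0// Cb0.
move=> K beta f adm mf f0 fm a l l0; have [mK K0 mb b0 near far bS bW] := adm.
have vl := vol l0; have M0 := cW_gt0 a l0.
pose D0 := hcube (dilc 0 a l) (dils 0 l).
have mD0 : measurable D0 by exact: mH.
have L0 : 0 < dils 0 l by exact: dils_gt0.
have [V [V0 VE]] : exists V, 0 < V /\ V = cW (dilc 0 a l) (dils 0 l).
  by exists (cW (dilc 0 a l) (dils 0 l)); split => //; exact: cW_gt0.
pose f1 x := \1_D0 x * f x; pose f2 x := \1_(~` D0) x * f x.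
have mf1 : measurable_fun setT f1 by apply: measurable_funM => //; exact: measurable_indic.
have mf2 : measurable_fun setT f2.
  by apply: measurable_funM => //; apply: measurable_indic; exact: measurableC.
have f10 x : 0 <= f1 x by rewrite mulr_ge0.
have f20 x : 0 <= f2 x by rewrite mulr_ge0.
have [v [v0 vE]] : exists v, 0 < v /\ v = V `^ (kappa / p).
  by exists (V `^ (kappa / p)); split => //; exact: powR_gt0.
pose g x := v^-1 * f1 x.
have mg : measurable_fun setT g by exact: measurable_funM.
have g0 x : 0 <= g x by rewrite mulr_ge0// invr_ge0 ltW.
have gp : (\int[W]_x (g x `^ p)%:E <= 1)%E.
  have -> : (\int[W]_x (g x `^ p)%:E = (v `^ (- p))%:E * \int[W]_(x in D0) (f x `^ p)%:E)%E.
    rewrite [in RHS]integral_mkcond -ge0_integralZl_EFin ?powR_ge0//; last 2 first.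
    - by move=> x _; rewrite patchE; case: ifPn => // _; rewrite lee_fin powR_ge0.
    - apply/(measurable_restrictT _ mD0); apply: measurable_powR_comp; exact: measurable_funTS.
    apply: eq_integral => x _; rewrite /g /f1 patchE indicE; case: ifPn => xD.
      by rewrite mul1r powRM ?invr_ge0 ?(ltW v0)// -powR_inv1 ?(ltW v0)// -powRrM mulN1r EFinM.
    by rewrite mul0r mulr0 powR0 ?gt_eqF// mule0.
  apply: (le_trans (lee_wpmul2l _ (fm (dilc 0 a l) _ L0))); first by rewrite lee_fin powR_ge0.
  rewrite -VE -EFinM lee_fin; apply: le_of_eq.
  rewrite vE; have [e ->] := pos_expR V0.
  by rewrite -expR0; exp_field.
have kopD x : kop leb alpha K f x = (kop leb alpha K f1 x + kop leb alpha K f2 x)%E.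
  rewrite /kop -ge0_integralD//; last 4 first.
  - by move=> y _; rewrite lee_fin !mulr_ge0 ?powR_ge0.
  - exact: measurable_kop_section.
  - by move=> y _; rewrite lee_fin !mulr_ge0 ?powR_ge0.
  - exact: measurable_kop_section.
  apply: eq_integral => y _; rewrite -EFinD -mulrDl -mulrDr; congr (_ * _ * _)%:E.
  rewrite /f1 /f2 !indicE in_setC; case: (y \in D0); rewrite /= ?mul1r ?mul0r ?addr0 ?add0r//.
have kopV x : kop leb alpha K f1 x = (v%:E * kop leb alpha K g x)%E.
  rewrite /kop -ge0_integralZl_EFin ?(ltW v0)//; last 2 first.
  - by move=> y _; rewrite lee_fin; apply: mulr_ge0; [exact: mulr_ge0|exact: powR_ge0].
  - exact: measurable_kop_section.
  apply: eq_integral => y _; rewrite -EFinM; congr (_%:E); rewrite /g.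
  by field; rewrite gt_eqF.
have mk (h : Rn R n -> R) : measurable_fun setT h -> (forall x,
  0 <= h x) -> measurable_fun setT (kop leb alpha K h).
  by move=> mh h0; exact: measurable_kop.
have k0 (h : Rn R n -> R) x : (forall x, 0 <= h x) -> (0 <= kop leb alpha K h x)%E.
  by move=> h0; apply: integral_ge0 => y _; rewrite lee_fin !mulr_ge0 ?powR_ge0.
have gop0 x : (0 <= gop leb alpha beta g x)%E.
  by apply: nneseries_ge0 => i _ _; exact: gterm_ge0.
have mgop : measurable_fun setT (gop leb alpha beta g).
  by apply: ge0_emeasurable_sum => *; [exact: gterm_ge0|exact: measurable_gterm].
have mgopq : measurable_fun setT (fun x => gop leb alpha beta g x `^ q)%E.
  exact: (measurableT_comp (measurable_poweR q)).
pose X := CT * l `^ alpha * cW a l `^ ((kappa - 1) / p).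
have X0 : 0 <= X by rewrite /X !mulr_ge0 ?powR_ge0// ltW.
have mbq E : measurable_fun E (fun x => (beta a l x `^ q)%:E).
  by apply: measurable_powR_comp; exact: measurable_funTS.
have bq0 x : (0 <= (beta a l x `^ q)%:E)%E by rewrite lee_fin powR_ge0.
have vc0 : 0 <= v `^ q * c `^ q by rewrite mulr_ge0 ?powR_ge0.
have gq0 x : (0 <= gop leb alpha beta g x `^ q)%E by exact: poweR_ge0.
apply: (@le_trans _ _ (\int[Sg]_(x in hcube a l) ((2 `^ q)%:E *
  ((v `^ q * c `^ q)%:E * (gop leb alpha beta g x `^ q) + (X `^ q)%:E * (beta a l x `^ q)%:E)))%E).
  apply: ge0_le_integral => //.
  - by move=> x _; exact: poweR_ge0.
  - by apply: measurable_funTS; apply: (measurableT_comp (measurable_poweR q)); exact: mk.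
  - apply: measurable_funTS; apply: measurable_funeM; apply: emeasurable_funD;
    exact: measurable_funeM.
  move=> x xa; rewrite kopD kopV.
  have H1 : (kop leb alpha K g x <= c%:E * gop leb alpha beta g x)%E.
    by apply: kop_le_gop => //; exact: ltW.
  have H2 := HT K beta f adm mf f0 fm a l x l0 xa.
  have H3 : (v%:E * kop leb alpha K g x + kop leb alpha K f2 x <=
      v%:E * (c%:E * gop leb alpha beta g x) + (X * beta a l x)%:E)%E.
    apply: leeD; first by apply: lee_wpmul2l; [rewrite lee_fin ltW|].
    apply: le_trans H2 _; rewrite lee_fin; apply: le_of_eq; rewrite /X; ring.
  apply: (@le_trans _ _ ((v%:E * (c%:E * gop leb alpha beta g x) + (X * beta a l x)%:E) `^ q)%E).
    apply: le_poweR => //; first exact: ltW.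
    by apply: adde_ge0; [apply: mule_ge0; [rewrite lee_fin ltW|exact: k0]|exact: k0].
  have u0 : (0 <= v%:E * (c%:E * gop leb alpha beta g x))%E.
    by rewrite !mule_ge0// lee_fin ltW.
  apply: le_trans (poweR_addr_le (ltW q0) u0 _) _; first by rewrite lee_fin mulr_ge0.
  apply: lee_wpmul2l; first by rewrite lee_fin powR_ge0.
  have vq : (0 <= v%:E)%E by rewrite lee_fin ltW.
  have cq : (0 <= c%:E)%E by rewrite lee_fin ltW.
  rewrite (poweRM _ vq (mule_ge0 cq (gop0 x))) (poweRM _ cq (gop0 x)) !poweR_EFin muleA -EFinM.
  by rewrite (powRM q X0 (b0 a l x)) [((X `^ q * _)%R)%:E]EFinM.
rewrite ge0_integralZl_EFin ?powR_ge0//; last 2 first.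
- by move=> x _; rewrite adde_ge0// mule_ge0// lee_fin ?powR_ge0.
- by apply: measurable_funTS; apply: emeasurable_funD; exact: measurable_funeM.
rewrite ge0_integralD//; last 4 first.
- by move=> x _; rewrite mule_ge0// lee_fin.
- by apply: measurable_funTS; exact: measurable_funeM.
- by move=> x _; rewrite mule_ge0// lee_fin powR_ge0.
- exact: measurable_funeM.
rewrite !ge0_integralZl_EFin ?powR_ge0//; last first.
  exact: measurable_funTS.
have H1 : (\int[Sg]_(x in hcube a l) gop leb alpha beta g x `^ q <= CL%:E)%E.
  apply: (@le_trans _ _ (\int[Sg]_x gop leb alpha beta g x `^ q)%E).
    by apply: ge0_subset_integral.
  by apply: HL.
have H2 := bS q a l q0 l0.
rewrite SgE// -EFinM in H2.
apply: (@le_trans _ _ ((2 `^ q)%:E * ((v `^ q * c `^ q)%:E * CL%:E + (X `^ q)%:E * (Cb q * cS a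
  l)%:E))%E).
  apply: lee_wpmul2l; first by rewrite lee_fin powR_ge0.
  apply: leeD; apply: lee_wpmul2l => //; by rewrite lee_fin ?powR_ge0.
rewrite [leLHS](_ : _ = (2 `^ q * (v `^ q * c `^ q * CL + X `^ q * (Cb q * cS a l)))%:E)%E;
  last by [].
rewrite lee_fin -[leRHS]mulrA; apply: ler_wpM2l; first exact: powR_ge0.
rewrite [leRHS]mulrDl; apply: lerD.
- rewrite [leRHS](_ : _ = (c `^ q * CL) * (D3 `^ (kappa * q / p) * cW a l `^ (kappa * q / p)));
  last by ring.
  rewrite [leLHS](_ : _ = (c `^ q * CL) * (v `^ q)); last by ring.
  apply: ler_wpM2l; first by rewrite mulr_ge0 ?powR_ge0 ?(ltW CL0).
  rewrite vE -powRrM -powRM; [|exact: ltW|exact: ltW].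
  rewrite (_ : kappa / p * q = kappa * q / p); last by ring.
  apply: powR_gt0_le; [by rewrite !mulr_ge0 ?invr_ge0 ?(ltW p0) ?(ltW q0)|exact: ltW|].
  have := cmass_doubling lebH C10 wdens_fin w_A1 l0 L0 (@dil_sub0 R n 0 a l l0).
  by rewrite -VE /dils expr0 mulr1 exprMn mulfK ?gt_eqF.
(* The powers of l add up to q alpha + n - n q/p = 0, and those of W(Q) to (kappa - 1) q/p + q/p =
   kappa q/p. *)
- have Z : X `^ q * cS a l <= CT `^ q * S2 * cW a l `^ (kappa * q / p).
    have H := cmass_pow_le lebH C20 s1 sr wdens_fin w_RH a l0.
    apply: (le_trans (ler_wpM2l (powR_ge0 X q) H)).
    apply: le_of_eq; rewrite /X -/S2.
    have E : alpha = n%:R * (p^-1 - q^-1) by rewrite qE; field; rewrite !gt_eqF.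
    rewrite E -!powR_mulrn ?(ltW l0)//.
    have [A1 ->] := pos_expR M0; have [A2 ->] := pos_expR l0; have [A3 ->] := pos_expR CT0.
    have [A4 ->] := pos_expR S20.
    by exp_field.
  rewrite [leRHS](_ : _ = Cb q * (CT `^ q * S2 * cW a l `^ (kappa * q / p))); last by ring.
  rewrite [leLHS](_ : _ = Cb q * (X `^ q * cS a l)); last by ring.
  by apply: ler_wpM2l => //; exact/ltW/Cb0.
Qed.

End tail_estimate.

Lemma exprD3_le {R : realDomainType} m (u v z : R) : 0 <= u -> 0 <= v -> 0 <= z ->
  (u + v + z) ^+ m <= 3 ^+ m * (u ^+ m + v ^+ m + z ^+ m).
Proof.
move=> u0 v0 z0.
have H M : 0 <= M -> u <= M -> v <= M -> z <= M -> M ^+ m <= u ^+ m + v ^+ m + z ^+ m ->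
    (u + v + z) ^+ m <= 3 ^+ m * (u ^+ m + v ^+ m + z ^+ m).
  move=> M0 uM vM zM MM; apply: (@le_trans _ _ ((3 * M) ^+ m)).
    by rewrite lerXn2r// ?nnegrE ?addr_ge0 ?mulr_ge0//; lra.
  by rewrite exprMn ler_wpM2l// exprn_ge0.
have um : 0 <= u ^+ m by exact: exprn_ge0.
have vm : 0 <= v ^+ m by exact: exprn_ge0.
have zm : 0 <= z ^+ m by exact: exprn_ge0.
have [uv|uv] := leP u v; have [vz|vz] := leP v z; have [uz|uz] := leP u z.
all: solve [by apply: (H u) => //; lra | by apply: (H v) => //; lra | by apply: (H z) => //; lra].
Qed.

(** The summands 1 allow the passage from an additive triangle inequality to a product: 1, u^m and
    v^m are each at most (1 + u^m)(1 + v^m). The term G k will be the drift between the centres of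
    two cubes. *)
Lemma osc_kernel_arith {R : realDomainType} m (d u v k G : R) : 0 <= d -> 0 <= u -> 0 <= v ->
  1 <= k -> 0 <= G -> d <= u + v + G * k ->
  1 + d ^+ m <= (1 + 3 ^+ m * (2 + G ^+ m)) * k ^+ m * (1 + u ^+ m) * (1 + v ^+ m).
Proof.
move=> d0 u0 v0 k1 G0 H; have k0 : 0 <= k by exact: le_trans k1.
have um : 0 <= u ^+ m by exact: exprn_ge0.
have vm : 0 <= v ^+ m by exact: exprn_ge0.
have km : 1 <= k ^+ m by exact: exprn_ege1.
have gm : 0 <= G ^+ m by exact: exprn_ge0.
have t0 : 0 <= 3 ^+ m :> R by exact: exprn_ge0.
have H1 : d ^+ m <= 3 ^+ m * (u ^+ m + v ^+ m + G ^+ m * k ^+ m).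
  rewrite -exprMn; apply: le_trans (exprD3_le m u0 v0 (mulr_ge0 G0 k0)).
  by rewrite lerXn2r// nnegrE !addr_ge0// mulr_ge0.
set P := k ^+ m * (1 + u ^+ m) * (1 + v ^+ m).
have u1 : 1 <= 1 + u ^+ m by rewrite lerDl.
have v1 : 1 <= 1 + v ^+ m by rewrite lerDl.
have P1 : 1 <= P by apply: mulr_ege1 => //; exact: mulr_ege1.
have kP : k ^+ m <= P.
  by rewrite /P -mulrA; apply: ler_peMr; [exact: le_trans km|exact: mulr_ege1].
have uP : u ^+ m <= P.
  apply: (@le_trans _ _ (1 + u ^+ m)); first by rewrite lerDr.
  rewrite /P mulrAC; apply: ler_peMl; [exact: le_trans u1|exact: mulr_ege1].
have vP : v ^+ m <= P.
  apply: (@le_trans _ _ (1 + v ^+ m)); first by rewrite lerDr.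
  by rewrite /P; apply: ler_peMl; [exact: le_trans v1|exact: mulr_ege1].
rewrite [leRHS](_ : _ = P + 3 ^+ m * (P + P + G ^+ m * P)); last by rewrite /P; ring.
apply: lerD => //; apply: (le_trans H1); apply: ler_wpM2l => //.
by apply: lerD; [exact: lerD|exact: ler_wpM2l].
Qed.

(** * Oscillation kernels are admissible *)

Section oscillation.
Context {R : realType} {n : nat}.
Variable leb : {sigma_finite_measure set (Rn R n) -> \bar R}.
Hypothesis lebH : forall a l, 0 < l -> leb (hcube a l) = (l ^+ n)%:E.
Variables (w : Rn R n -> R) (mw : measurable_fun setT w) (w_gt0 : forall x, 0 < w x).
Variables (p q C1 C2 r : R).
Local Notation s := (q / p).
Hypotheses (C10 : 0 < C1) (C20 : 0 < C2) (s1 : 1 < s) (sr : s < r).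
Local Notation W := (wdens leb mw w_gt0).
Local Notation cW := (cmass leb mw w_gt0).
Hypothesis wdens_fin : forall a l, (W (hcube a l) < +oo)%E.
Hypothesis w_A1 : forall a l, 0 < l ->
  {ae leb, forall y, hcube a l y -> cW a l <= C1 * l ^+ n * w y}.
Hypothesis w_RH : forall a l, 0 < l ->
  (\int[leb]_(x in hcube a l) (w x `^ r)%:E <=
   (C2 * l ^+ n * (cW a l / l ^+ n) `^ r)%:E)%E.

Let mH a l : measurable (hcube a l : set (Rn R n)). Proof. exact: measurable_hcube. Qed.

Definition osc_le1 (b : Rn R n -> R[i]) (c : Rn R n -> R -> R[i]) := forall a l, 0 < l ->
  (\int[W]_(x in hcube a l) (normc (b x - c a l))%:E <= W (hcube a l))%E.

(** Integrate the distance of the centres over the smaller cube: one oscillation is bounded by its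
    mass, the other by the mass of the larger cube, and doubling compares the two. *)
Lemma osc_center_le b c a l a' l' : cmeasurable setT b -> osc_le1 b c -> 0 < l -> 0 < l' ->
  hcube a l `<=` hcube a' l' ->
  normc (c a l - c a' l') <= 1 + C1 * (l' ^+ n / l ^+ n).
Proof.
move=> mb osc l0 l'0 sub.
have M0 := cmass_gt0 lebH wdens_fin a l0.
have mbc E (z : R[i]) : measurable_fun E (fun x => (normc (b x - z))%:E).
  by apply/measurable_EFinP; apply: measurable_funTS; apply: measurable_normc => //;
    exact: cmeasurable_subr.
have b0 E (z : R[i]) x : E x -> (0 <= (normc (b x - z))%:E)%E.
  by move=> _; rewrite lee_fin normc_ge0.
have H : ((normc (c a l - c a' l'))%:E * W (hcube a l) <= W (hcube a l) + W (hcube a' l'))%E.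
  rewrite -integral_cst//.
  apply: (@le_trans _ _ (\int[W]_(x in hcube a l) ((normc (b x - c a l))%:E + (normc (b x - c a'
    l'))%:E))%E).
    apply: ge0_le_integral => //.
    - by move=> x _; rewrite lee_fin normc_ge0.
    - exact: emeasurable_funD.
    - move=> x _; rewrite -EFinD lee_fin.
      by rewrite (normc_distC (b x)); exact: normc_triangle.
  rewrite ge0_integralD//; [|by move=> x; exact: b0|by move=> x; exact: b0].
  apply: leeD; first exact: osc.
  apply: le_trans (osc a' l' l'0); apply: ge0_subset_integral => //; first by move=> x; exact: b0.
move: H; rewrite !(wdensE wdens_fin) -EFinM -EFinD lee_fin.
rewrite -ler_pdivlMr// => /le_trans; apply.
rewrite ler_pdivrMr// mulrDl mul1r lerD2l.
exact: (cmass_doubling lebH C10 wdens_fin w_A1 l0 l'0 sub).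
Qed.

(** Telescoping along the dilates makes the drift linear in k, where a single comparison would give
    exponential growth. The side ratio is 3 at the first step and 2 afterwards, so 3^n covers
    both. *)
Lemma osc_center_dil_le b c a l k : cmeasurable setT b -> osc_le1 b c -> 0 < l ->
  normc (c a l - c (dilc k a l) (dils k l)) <= (1 + C1 * 3 ^+ n) * k.+1%:R.
Proof.
move=> mb osc l0; have vl : l ^+ n != 0 by rewrite gt_eqF// exprn_gt0.
elim: k => [|k IH].
  rewrite mulr1; have := osc_center_le mb osc l0 (dils_gt0 0 l0) (@dil_sub0 R n 0 a l l0).
  by rewrite /dils expr0 mulr1 exprMn mulfK.
have L0 := dils_gt0 k l0; have L1 := dils_gt0 k.+1 l0.
apply: le_trans (normc_triangle (c (dilc k a l) (dils k l)) _ _) _.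
rewrite -[k.+2%:R]natr1 mulrDr mulr1; apply: lerD => //.
apply: le_trans (osc_center_le mb osc L0 L1 (@dil_subS R n k a l l0)) _.
rewrite lerD2l; apply: ler_wpM2l; first exact: ltW.
rewrite -expr_div_n (_ : dils k.+1 l / dils k l = 2).
  by rewrite lerXn2r ?nnegrE//; lra.
by rewrite /dils exprS; field; rewrite !gt_eqF ?exprn_gt0.
Qed.

(** The summand 1 serves twice: for the product form in [admissible], and to control integrals with
    the factors 1 + |b_j(y)|, on which the convergence of the commutator rests. *)
Definition osc_kernel m (b : Rn R n -> R[i]) x y : R := 1 + normc (b x - b y) ^+ m.

Definition osc_beta m (b : Rn R n -> R[i]) (c : Rn R n -> R -> R[i]) a l y : R :=
  1 + normc (b y - c a l) ^+ m.

Lemma measurable_osc_kernel m b : cmeasurable setT b ->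
  measurable_fun setT (fun z : Rn R n * Rn R n => osc_kernel m b z.1 z.2).
Proof.
move=> [mr mi]; apply: measurable_funD; first exact: measurable_cst.
apply: measurable_funX; apply: measurable_normc => //; split.
- rewrite (_ : (fun _ => _) = (fun z : Rn R n * Rn R n => complex.Re (b z.1) - complex.Re (b
  z.2))); last first.
    by apply/funext => z; case: (b z.1); case: (b z.2).
  by apply: measurable_funB; [apply: (measurableT_comp mr)|apply: (measurableT_comp mr)].
- rewrite (_ : (fun _ => _) = (fun z : Rn R n * Rn R n => complex.Im (b z.1) - complex.Im (b
  z.2))); last first.
    by apply/funext => z; case: (b z.1); case: (b z.2).
  by apply: measurable_funB; [apply: (measurableT_comp mi)|apply: (measurableT_comp mi)].
Qed.

Lemma admissible_osc m : (0 < m)%N -> exists A Cb, [/\ 0 < A, forall u, 0 < u -> 0 < Cb u &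
  forall b c, cmeasurable setT b -> osc_le1 b c ->
    admissible leb mw w_gt0 p q A m%:R Cb (osc_kernel m b) (osc_beta m b c)].
Proof.
move=> m0; have m0' : 0 < m%:R :> R by rewrite ltr0n.
have G0 : 0 <= 1 + C1 * 3 ^+ n by rewrite addr_ge0// mulr_ge0 ?exprn_ge0// ltW.
set G := 1 + C1 * 3 ^+ n in G0 *.
pose A := 1 + 3 ^+ m * (2 + G ^+ m).
(* The John-Nirenberg constants are chosen as functions of the order u; for u <= 0 the value 0 is a
   mere placeholder. *)
have /choice[F1 HF1] u : exists C, 0 < u -> 0 < C /\
    forall b c, cmeasurable setT b -> osc_le1 b c -> forall a l, 0 < l ->
    (\int[W]_(x in hcube a l) (normc (b x - c a l) `^ (u * m%:R))%:E <= C%:E * W (hcube a l))%E.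
  have [u0|] := ltP 0 u; last by exists 0.
  have [C [C0 HC]] := john_nirenberg_wdens lebH C10 wdens_fin w_A1 (mulr_gt0 u0 m0').
  by exists C => _; split => // b c mb osc a l l0; exact: HC.
have /choice[F2 HF2] u : exists C, 0 < u -> 0 < C /\
    forall b c, cmeasurable setT b -> osc_le1 b c -> forall a l, 0 < l ->
    (\int[wpow_dens leb mw s]_(x in hcube a l) (normc (b x - c a l) `^ (u * m%:R))%:E <=
      C%:E * wpow_dens leb mw s (hcube a l))%E.
  have [u0|] := ltP 0 u; last by exists 0.
  have [C [C0 HC]] := john_nirenberg_wpow_dens lebH C10 C20 s1 sr wdens_fin w_A1 w_RH (mulr_gt0 u0
    m0').
  by exists C => _; split => // b c mb osc a l l0; exact: HC.
have A0 : 0 < A.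
  by rewrite ltr_pwDl// mulr_ge0 ?exprn_ge0// addr_ge0// exprn_ge0.
exists A, (fun u => 2 `^ u * (1 + (F1 u + F2 u))); split => // [u u0|b c mb osc].
  have [a1 _] := HF1 u u0; have [a2 _] := HF2 u u0.
  by rewrite mulr_gt0 ?powR_gt0// !addr_gt0.
have nc0 (z : R[i]) : 0 <= normc z ^+ m by rewrite exprn_ge0// normc_ge0.
have mb' a l : measurable_fun setT (fun x => normc (b x - c a l)).
  by apply: measurable_normc => //; exact: cmeasurable_subr.
have moment (mu : {measure set (Rn R n) -> \bar R}) F u a l : 0 < u -> 0 <= F ->
    (\int[mu]_(x in hcube a l) (normc (b x - c a l) `^ (u * m%:R))%:E <= F%:E * mu (hcube a l))%E ->
    (\int[mu]_(x in hcube a l) (osc_beta m b c a l x `^ u)%:E <= (2 `^ u * (1 + F))%:E * mu (hcube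
      a l))%E.
  move=> u0 F0 HF.
  have mN E : measurable_fun E (fun x => (normc (b x - c a l) `^ (u * m%:R))%:E).
    by apply: measurable_powR_comp; exact: measurable_funTS.
  apply: (@le_trans _ _ (\int[mu]_(x in hcube a l) ((2 `^ u)%:E * (1%:E + (normc (b x - c a l) `^
    (u * m%:R))%:E)))%E).
    apply: ge0_le_integral => //.
    - by move=> x _; rewrite lee_fin powR_ge0.
    - apply: measurable_powR_comp; apply: measurable_funTS; apply: measurable_funD => //.
      exact: measurable_funX.
    - by apply: measurable_funeM; apply: emeasurable_funD => //; exact: measurable_cst.
    move=> x _; rewrite -EFinD -EFinM lee_fin.
    have := powR_addr_le (ltW u0) (@ler01 R) (nc0 (b x - c a l)).
    have -> : (normc (b x - c a l) ^+ m) `^ u = normc (b x - c a l) `^ (u * m%:R).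
      by rewrite -powR_mulrn ?normc_ge0// -powRrM [m%:R * u]mulrC.
    by rewrite powR1.
  rewrite ge0_integralZl_EFin ?powR_ge0//; last 2 first.
  - by move=> x _; rewrite adde_ge0// lee_fin powR_ge0.
  - by apply: emeasurable_funD => //; exact: measurable_cst.
  rewrite EFinM -muleA; apply: lee_wpmul2l; first by rewrite lee_fin powR_ge0.
  rewrite ge0_integralD//; last by move=> x _; rewrite lee_fin powR_ge0.
  rewrite integral_cst// EFinD ge0_muleDl ?lee_fin//.
  by apply: leeD.
split.
- exact: measurable_osc_kernel.
- by move=> x y; rewrite addr_ge0.
- by move=> a l; apply: measurable_funD => //; exact: measurable_funX.
- by move=> a l y; rewrite addr_ge0.
- move=> a l x y; have H : normc (b x - b y) <= normc (b x - c a l) + normc (b y - c a l) + G * 1.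
    apply: (le_trans (normc_triangle (c a l) _ _)).
    by rewrite (normc_distC (c a l)) lerDl mulr1.
  have := osc_kernel_arith m (normc_ge0 _) (normc_ge0 _) (normc_ge0 _) (lexx 1) G0 H.
  by rewrite expr1n mulr1.
- move=> a l k x y l0.
  have H : normc (b x - b y) <= normc (b x - c a l) + normc (b y - c (dilc k a l) (dils k l)) + G *
    k.+1%:R.
    apply: (le_trans (normc_triangle (c a l) _ _)); rewrite -addrA lerD2l.
    apply: (le_trans (normc_triangle (c (dilc k a l) (dils k l)) _ _)).
    rewrite [leRHS]addrC (normc_distC _ (b y)) lerD2r.
    exact: (osc_center_dil_le a k mb osc l0).
  have k1 : 1 <= k.+1%:R :> R by rewrite ler1n.
  have := osc_kernel_arith m (normc_ge0 _) (normc_ge0 _) (normc_ge0 _) k1 G0 H.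
  by rewrite powR_mulrn.
- move=> u a l u0 l0; have [a1 _] := HF1 u u0; have [a2 H2] := HF2 u u0.
  apply: (le_trans (moment _ _ _ _ _ u0 (ltW a2) (H2 b c mb osc a l l0))).
  apply: lee_wpmul2r => //; rewrite lee_fin ler_wpM2l ?powR_ge0// lerD2l lerDr.
  exact: ltW.
- move=> u a l u0 l0; have [a1 H1] := HF1 u u0; have [a2 _] := HF2 u u0.
  apply: (le_trans (moment _ _ _ _ _ u0 (ltW a1) (H1 b c mb osc a l l0))).
  apply: lee_wpmul2r => //; rewrite lee_fin ler_wpM2l ?powR_ge0// lerD2l lerDl.
  exact: ltW.
Qed.

End oscillation.

Lemma expRN_le_powR {R : realType} (c t z : R) : 0 < c -> 0 < t -> 0 < z ->
  expR (- c * z) <= (t / c) `^ t * z `^ (- t).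
Proof.
move=> c0 t0 z0; rewrite mulNr expRN powRN -[leLHS]mul1r.
rewrite ler_pdivrMr ?expR_gt0// mulrAC ler_pdivlMr ?powR_gt0// mul1r.
exact: powR_le_expR (ltW z0).
Qed.

(** * The kernel of the commutator *)

Section gaussian_integral.
Context {R : realType}.
Local Notation mu := (@lebesgue_measure R).

(** Split at t = u^2. Below, the exponential is at most a multiple of (u^2/t)^(-N) with N = d + 1,
    which cancels the singularity exactly. Above, it is at most 1 and the power of t is summed over
    dyadic intervals. *)
Lemma gaussian_integral_le (c d : R) : 0 < c -> 0 < d -> exists C : R, 0 < C /\
  forall u : R, 0 < u ->
  (\int[mu]_(t in [set t : measurableTypeR R | (0 < t)%R]) (t `^ (- d - 1) * expR (- c * (u ^+ 2 /
    t)))%:E <=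
    (C * u `^ (- (2 * d)))%:E)%E.
Proof.
move=> c0 d0; pose N := d + 1; have N0 : 0 < N by rewrite addr_gt0.
have r01 : 0 <= 2 `^ (- d) < 1 by exact: powRN_lt1.
pose A := (N / c) `^ N.
exists (A + (1 - 2 `^ (- d))^-1); split.
  by rewrite addr_gt0// ?powR_gt0 ?divr_gt0// invr_gt0 subr_gt0; case/andP: r01.
move=> u u0; have v0 : 0 < u ^+ 2 by exact: exprn_gt0.
set v := u ^+ 2 in v0 *.
have uE : u `^ (- (2 * d)) = v `^ (- d).
  by rewrite /v -powR_mulrn ?(ltW u0)// -powRrM mulrN.
pose I k : set (measurableTypeR R) := `[2 ^+ k * v, 2 ^+ k.+1 * v[%classic.
have mI k : measurable (I k) by exact: measurable_itv.
pose phi0 (t : measurableTypeR R) : R := A * v `^ (- N) * \1_(`]0, v]%classic) t.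
pose phi k (t : measurableTypeR R) : R := (2 ^+ k * v) `^ (- N) * \1_(I k) t.
have phi00 t : 0 <= phi0 t by rewrite !mulr_ge0 ?powR_ge0.
have phik0 k t : 0 <= phi k t by rewrite mulr_ge0 ?powR_ge0.
have mphi0 (D : set (measurableTypeR R)) : measurable_fun D (fun t => (phi0 t)%:E).
  by apply/measurable_EFinP; apply: measurable_funM => //; exact: measurable_funTS.
have mphi k (D : set (measurableTypeR R)) : measurable_fun D (fun t => (phi k t)%:E).
  by apply/measurable_EFinP; apply: measurable_funM => //; apply: measurable_funTS;
    exact: measurable_indic.
have mS (D : set (measurableTypeR R)) : measurable_fun D (fun t => \sum_(k <oo) (phi k t)%:E)%E.
  apply: (@ge0_emeasurable_sum _ _ R D (fun k t => (phi k t)%:E) xpredT) => [k t _ _|k _].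
    by rewrite lee_fin.
  exact: mphi.
have mpos : measurable [set t : measurableTypeR R | 0 < t].
  by rewrite (_ : mkset _ = `]0, +oo[%classic)//; apply/seteqP; split => t /=;
    rewrite in_itv/= andbT.
apply: (@le_trans _ _ (\int[mu]_(t in [set t : measurableTypeR R | (0 < t)%R]) ((phi0 t)%:E +
  \sum_(k <oo) (phi k t)%:E))%E).
  apply: ge0_le_integral => //.
  - by move=> t _; rewrite lee_fin mulr_ge0 ?powR_ge0// expR_ge0.
  - apply/measurable_EFinP; apply: measurable_funM.
      by apply: measurable_funTS; exact: measurable_powR.
    apply: (eq_measurable_fun (fun t => expR (- c * (v * t `^ (-1))))).
      by move=> t; rewrite inE/= => t0; rewrite powR_inv1// ltW.
    apply: measurable_funTS; apply: measurableT_comp; first exact: measurable_expR.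
    by apply: measurable_funM => //; apply: measurable_funM => //; exact: measurable_powR.
  - exact: emeasurable_funD.
  move=> t /= t0; have [tv|tv] := leP t v.
    apply: (@le_trans _ _ (phi0 t)%:E); last by rewrite leeDl// nneseries_ge0// => k _ _;
      rewrite lee_fin.
    rewrite lee_fin /phi0 indicE mem_set ?mulr1; last by rewrite /= in_itv/= t0.
    have H := expRN_le_powR c0 N0 (divr_gt0 v0 t0).
    apply: (le_trans (ler_wpM2l (powR_ge0 _ _) H)).
    apply: le_of_eq; rewrite /A /N.
    have [T ->] := pos_expR t0; have [V ->] := pos_expR v0.
    rewrite [LHS]mulrCA; congr (_ * _).
    by exp_field.
  have tv1 : 1 <= t / v by rewrite ler_pdivlMr// mul1r ltW.
  have [k /andP[k1 k2]] := dyadic_below tv1.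
  move: k1 k2; rewrite ler_pdivlMr// ltr_pdivrMr// => k1 k2.
  apply: (@le_trans _ _ (phi k t)%:E); last first.
    apply: (@le_trans _ _ (\sum_(k <oo) (phi k t)%:E)%E); last by rewrite leeDr// lee_fin.
    by apply: (nneseries_ge_term (u := fun k => (phi k t)%:E)) => j; rewrite lee_fin.
  rewrite lee_fin /phi indicE mem_set ?mulr1; last by rewrite /I/= in_itv/= k1.
  have kv : 0 < 2 ^+ k * v by rewrite mulr_gt0// exprn_gt0.
  apply: (@le_trans _ _ (t `^ (- d - 1))).
    rewrite ler_piMr ?powR_ge0// -expR0 ler_expR mulNr oppr_le0 mulr_ge0 ?(ltW c0)//.
    by rewrite divr_ge0// ltW.
  by rewrite /N opprD; apply: powR_le0_le => //; rewrite subr_le0 (le_trans _ ler01)// oppr_le0 ltW.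
rewrite ge0_integralD//; last 2 first.
- by move=> t _; rewrite lee_fin.
- by move=> t _; rewrite nneseries_ge0// => k _ _; rewrite lee_fin.
rewrite integral_nneseries//; last by move=> k t _; rewrite lee_fin.
rewrite uE mulrDl EFinD; apply: leeD.
  apply: (@le_trans _ _ (\int[mu]_t (phi0 t)%:E)%E).
    by apply: ge0_subset_integral => // t _; rewrite lee_fin.
  rewrite /phi0; under eq_integral do rewrite EFinM.
  rewrite ge0_integralZl_EFin//; last by rewrite mulr_ge0 ?powR_ge0.
  rewrite integral_indic// setIT.
  have := lebesgue_measure_itv `]0, v]; rewrite /= lte_fin v0 => ->.
  rewrite -EFinB -EFinM lee_fin subr0 -mulrA ler_wpM2l ?powR_ge0//.
  apply: le_of_eq; rewrite /N.
  by have [V ->] := pos_expR v0; exp_field.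
  by apply/measurable_EFinP; exact: measurable_indic.
apply: (@le_trans _ _ (\sum_(k <oo) (v `^ (- d) * (2 `^ (- d)) ^+ k)%:E)%E); last first.
  by rewrite mulrC; exact: nneseries_geometric_le (powR_ge0 _ _) r01.
apply: lee_nneseries => [k _ _|k _]; first by apply: integral_ge0 => t _; rewrite lee_fin.
apply: (@le_trans _ _ (\int[mu]_t (phi k t)%:E)%E).
  by apply: ge0_subset_integral => // t _; rewrite lee_fin.
rewrite /phi; under eq_integral do rewrite EFinM.
rewrite ge0_integralZl_EFin ?powR_ge0//.
rewrite integral_indic// setIT.
have kv : 0 < 2 ^+ k * v by rewrite mulr_gt0// exprn_gt0.
have e0 : 0 < (2 : R) ^+ k by exact: exprn_gt0.
have := lebesgue_measure_itv `[2 ^+ k * v, 2 ^+ k.+1 * v[.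
have kk : 2 ^+ k * v < 2 ^+ k.+1 * v by rewrite exprS -mulrA ltr_pMl// ltr1n.
rewrite /= lte_fin kk => ->.
rewrite -EFinB -EFinM lee_fin exprS [_ - _](_ : _ = 2 ^+ k * v); last by ring.
rewrite -(powR_mulrn k (powR_ge0 2 (- d))) -powRrM [- d * _]mulrC powRrM powR_mulrn//.
  apply: le_of_eq; rewrite /N.
  have [V ->] := pos_expR v0; have [E ->] := pos_expR e0.
  by exp_field.
by apply/measurable_EFinP; exact: measurable_indic.
Qed.

End gaussian_integral.

Section complex_integrals.
Context d (T : measurableType d) (R : realType).
Implicit Types (mu : {measure set T -> \bar R}) (D : set T) (f g : T -> R[i]).

Lemma cReM (a b : R[i]) : complex.Re (a * b) =
  complex.Re a * complex.Re b - complex.Im a * complex.Im b.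
Proof. by case: a => ? ?; case: b. Qed.

Lemma cImM (a b : R[i]) : complex.Im (a * b) =
  complex.Re a * complex.Im b + complex.Im a * complex.Re b.
Proof. by case: a => ? ?; case: b. Qed.

Lemma cReB (a b : R[i]) : complex.Re (a - b) = complex.Re a - complex.Re b.
Proof. by case: a => ? ?; case: b. Qed.

Lemma cImB (a b : R[i]) : complex.Im (a - b) = complex.Im a - complex.Im b.
Proof. by case: a => ? ?; case: b. Qed.

Lemma cmeasurableM D f g : cmeasurable D f -> cmeasurable D g ->
  cmeasurable D (fun x => f x * g x).
Proof.
move=> [f1 f2] [g1 g2]; split.
- under eq_fun do rewrite cReM.
  by apply: measurable_funB; apply: measurable_funM.
- under eq_fun do rewrite cImM.
  by apply: measurable_funD; apply: measurable_funM.
Qed.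

Lemma cmeasurableB D f g : cmeasurable D f -> cmeasurable D g ->
  cmeasurable D (fun x => f x - g x).
Proof.
move=> [f1 f2] [g1 g2]; split.
- by under eq_fun do rewrite cReB; exact: measurable_funB.
- by under eq_fun do rewrite cImB; exact: measurable_funB.
Qed.

Lemma cmeasurable_real D (f : T -> R) : measurable_fun D f -> cmeasurable D (fun x => (f x)%:C%C).
Proof. by move=> mf; split => //=; exact: measurable_cst. Qed.

Lemma cmeasurable_cst D (z : R[i]) : cmeasurable D (fun=> z).
Proof. by split; exact: measurable_cst. Qed.

Lemma eq_cmeasurable D f g : {in D, f =1 g} -> cmeasurable D f -> cmeasurable D g.
Proof.
move=> fg [f1 f2]; split.
- by apply: eq_measurable_fun f1 => x xD; rewrite fg.
- by apply: eq_measurable_fun f2 => x xD; rewrite fg.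
Qed.

Lemma eq_cintegral mu D f g : {in D, f =1 g} -> cintegral mu D f = cintegral mu D g.
Proof.
by move=> fg; rewrite /cintegral; congr Complex; apply: eq_Rintegral => x xD; rewrite fg.
Qed.

Lemma cintegrable_normc mu D f : measurable D -> cmeasurable D f ->
  (\int[mu]_(x in D) (normc (f x))%:E < +oo)%E -> cintegrable mu D f.
Proof.
move=> mD [f1 f2] foo.
have nfoo : mu.-integrable D (fun x => (normc (f x))%:E).
  apply/integrableP; split; first by apply/measurable_EFinP; exact: measurable_normc.
  by under eq_integral do rewrite gee0_abs ?lee_fin ?normc_ge0//.
split; apply: le_integrable nfoo => //; try exact/measurable_EFinP.
- by move=> x _; rewrite !abse_EFin lee_fin (ger0_norm (normc_ge0 _)) normc_Re_le.
- by move=> x _; rewrite !abse_EFin lee_fin (ger0_norm (normc_ge0 _)) normc_Im_le.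
Qed.

(** The factor 2 comes from treating real and imaginary parts separately. An infinite right side is
    allowed. *)
Lemma normc_cintegral_le mu D f : measurable D -> cmeasurable D f ->
  ((normc (cintegral mu D f))%:E <= 2%:E * \int[mu]_(x in D) (normc (f x))%:E)%E.
Proof.
move=> mD mf; have [foo|] := ltP (\int[mu]_(x in D) (normc (f x))%:E)%E +oo%E; last first.
  by rewrite leye_eq => /eqP ->; rewrite gt0_muley ?leey// lte_fin.
have [i1 i2] := cintegrable_normc mD mf foo; have [f1 f2] := mf.
have mn : measurable_fun D (fun x => (normc (f x))%:E) by apply/measurable_EFinP;
  exact: measurable_normc.
apply: (@le_trans _ _ (`|Rintegral mu D (fun x => complex.Re (f x))|%:E + `|Rintegral mu D (fun x
  => complex.Im (f x))|%:E)%E).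
  by rewrite -EFinD lee_fin; exact: normc_le_ReIm.
rewrite (_ : 2%:E = 1%:E + 1%:E :> \bar R)%E; last by rewrite -EFinD.
rewrite ge0_muleDl ?lee_fin// mul1e; apply: leeD.
- apply: (@le_trans _ _ (\int[mu]_(x in D) `|(complex.Re (f x))%:E|)%E).
    rewrite EFin_normr_Rintegral//; exact: le_abse_integral (measurable_int _ i1).
  apply: ge0_le_integral => //.
  + by apply: measurableT_comp => //; exact/measurable_EFinP.
  + by move=> x _; rewrite abse_EFin lee_fin normc_Re_le.
- apply: (@le_trans _ _ (\int[mu]_(x in D) `|(complex.Im (f x))%:E|)%E).
    rewrite EFin_normr_Rintegral//; exact: le_abse_integral (measurable_int _ i2).
  apply: ge0_le_integral => //.
  + by apply: measurableT_comp => //; exact/measurable_EFinP.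
  + by move=> x _; rewrite abse_EFin lee_fin normc_Im_le.
Qed.

Lemma cintegral_mulB mu D (a : R[i]) f g : measurable D ->
  cintegrable mu D f -> cintegrable mu D g ->
  cintegral mu D (fun x => a * f x - g x) = a * cintegral mu D f - cintegral mu D g.
Proof.
move=> mD [f1 f2] [g1 g2].
have Z (k : R) (h : T -> R) : mu.-integrable D (EFin \o h) -> mu.-integrable D (EFin \o (fun x => k
  * h x)).
  move=> ih; rewrite (_ : EFin \o _ = (fun x => k%:E * (EFin \o h) x)%E)//.
  exact: integrableZl.
apply/eqP; rewrite eq_complex cReB cImB cReM cImM /cintegral /=; apply/andP; split; apply/eqP.
- rewrite -!RintegralZl// -!RintegralB//.
  + by apply: eq_Rintegral => x _; rewrite cReB cReM.
  + by apply: (@integrableB _ _ _ _ _ mD _ _ (Z _ _ f1) (Z _ _ f2)).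
  + exact: Z.
  + exact: Z.
- rewrite -!RintegralZl// -RintegralD//; [|exact: Z|exact: Z].
  rewrite -RintegralB//; last by apply: (@integrableD _ _ _ _ _ mD _ _ (Z _ _ f2) (Z _ _ f1)).
  by apply: eq_Rintegral => x _; rewrite cImB cImM.
Qed.

End complex_integrals.

Section parameter_integrals.
Context d1 d2 (X : measurableType d1) (Y : measurableType d2) (R : realType).
Variable mu : {sigma_finite_measure set Y -> \bar R}.

(** The real integral is [fine] of a difference of two Tonelli integrals, and each of these is
    measurable in the parameter; the domain enters the integrand as an indicator. *)
Lemma measurable_Rintegral_param (D : set Y) (f : X * Y -> R) : measurable D ->
  measurable_fun setT f -> measurable_fun setT (fun x => Rintegral mu D (fun y => f (x, y))).
Proof.
move=> mD mf; pose F z := ((f z)%:E * (\1_D z.2)%:E)%E.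
have mF : measurable_fun setT F.
  apply: emeasurable_funM; first exact/measurable_EFinP.
  by apply/measurable_EFinP; apply: (measurableT_comp (f := \1_D : Y -> R) (g := @snd X Y)).
have -> : (fun x => Rintegral mu D (fun y => f (x, y))) =
    (fun x => fine (\int[mu]_y (F^\+ (x, y)) - \int[mu]_y (F^\- (x, y)))%E).
  apply/funext => x; rewrite /Rintegral; congr fine; rewrite integral_mkcond integralE.
  by congr (_ - _)%E; apply: eq_integral => y _; rewrite ?funeposE ?funenegE /F patchE indicE;
    case: ifPn; rewrite ?mule1 ?mule0.
apply: measurableT_comp => //; apply: emeasurable_funB.
- apply: (measurable_fun_fubini_tonelli_F (F^\+)%E) => //; exact: measurable_funepos.
- apply: (measurable_fun_fubini_tonelli_F (F^\-)%E) => //; exact: measurable_funeneg.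
Qed.

Lemma cmeasurable_cintegral_param (D : set Y) (f : X * Y -> R[i]) : measurable D ->
  cmeasurable setT f -> cmeasurable setT (fun x => cintegral mu D (fun y => f (x, y))).
Proof.
move=> mD [f1 f2]; split => /=.
- exact: (measurable_Rintegral_param mD f1).
- exact: (measurable_Rintegral_param mD f2).
Qed.

End parameter_integrals.

Lemma measurable_Rn_point (R : realType) n (x : Rn R n) : measurable [set x].
Proof.
rewrite (_ : [set x] = \bigcap_(i in [set: 'I_n]) ((fun y : Rn R n => tnth y i) @^-1` [set tnth x
  i])).
  apply: fin_bigcap_measurable => // i _; rewrite -[X in measurable X]setTI.
  by apply: measurable_tnth => //; exact: measurable_set1.
by apply/seteqP; split => [y -> i _//|y xy]; apply: eq_from_tnth => i; exact: xy.
Qed.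

(** Small cubes with corner at the point; a side l <= 1 gives l^n <= l. In dimension 0 the measure
    is a Dirac mass, hence the condition on n. *)
Lemma lebesgueRn_point (R : realType) n (x : Rn R n) : (0 < n)%N ->
  lebesgueRn R n [set x] = 0%E.
Proof.
move=> n0; apply/eqP; rewrite eq_le measure_ge0 andbT; apply/lee_addgt0Pr => e e0.
rewrite add0e; pose l := Num.min e 1.
have l0 : 0 < l by rewrite lt_min e0 ltr01.
apply: (@le_trans _ _ (lebesgueRn R n (hcube x l))).
  apply: le_measure; rewrite ?inE.
  - exact: measurable_Rn_point.
  - exact: measurable_hcube.
  - by move=> _ ->; exact: hcube_corner.
rewrite lebesgueRn_hcube ?(ltW l0)// lee_fin.
apply: (@le_trans _ _ l); last by rewrite ge_min lexx.
rewrite -[leRHS]expr1; apply: ler_wiXn2l => //; [exact: ltW|by rewrite ge_min lexx orbT].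
Qed.

Section fractional_kernel.
Context {R : realType} {n : nat}.
Local Notation leb := (lebesgueRn R n).
Local Notation CRn := (Rn R n -> R[i]).
Local Notation mu := (@lebesgue_measure R).
Variables (pt : R -> Rn R n -> Rn R n -> R[i]) (C0 c alpha : R).
Let P : set (measurableTypeR R) := [set t | 0 < t].
Hypothesis mpt : cmeasurable (P `*` [set: Rn R n * Rn R n]) (fun z => pt z.1 z.2.1 z.2.2).
Hypotheses (C00 : 0 < C0) (c0 : 0 < c) (gauss : Gaussian_bound C0 c pt).
Hypotheses (alpha0 : 0 < alpha) (alpha_lt : alpha < n%:R).

Let n0 : (0 < n)%N.
Proof. by have := lt_trans alpha0 alpha_lt; rewrite ltr0n. Qed.

Let mP : measurable P.
Proof.
by rewrite (_ : P = `]0, +oo[%classic)//; apply/seteqP; split => t /=; rewrite in_itv/= andbT.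
Qed.

(** Extended by zero to t <= 0, where nothing is known of the kernel, so that measurability holds on
    the full product space. *)
Let pt0 (z : measurableTypeR R * (Rn R n * Rn R n)) : R[i] :=
  if 0 < z.1 then pt z.1 z.2.1 z.2.2 else 0.

Let pt0E t x y : 0 < t -> pt0 (t, (x, y)) = pt t x y.
Proof. by rewrite /pt0 /= => ->. Qed.

Let mpt0 : cmeasurable setT pt0.
Proof.
have [m1 m2] := mpt.
have mD : measurable (P `*` [set: Rn R n * Rn R n]) by exact: measurableX.
have E (g : R[i] -> R) : g 0 = 0 -> (fun z => g (pt0 z)) =
    (fun z : measurableTypeR R * (Rn R n * Rn R n) => g (pt z.1 z.2.1 z.2.2)) \_ (P `*` setT).
  move=> g0; apply/funext => z; rewrite patchE /pt0 in_setX in_setT andbT.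
  rewrite (_ : (z.1 \in P) = (0 < z.1)); first by case: ifP.
  by apply/idP/idP; rewrite inE.
split.
- by rewrite (E (@complex.Re R))//; apply/(measurable_restrictT _ mD).
- by rewrite (E (@complex.Im R))//; apply/(measurable_restrictT _ mD).
Qed.

Let cmeasurable_comp d1 d2 (T1 : measurableType d1) (T2 : measurableType d2)
  (f : T2 -> R[i]) (g : T1 -> T2) : cmeasurable setT f -> measurable_fun setT g ->
  cmeasurable setT (fun x => f (g x)).
Proof. by move=> [f1 f2] mg; split; [exact: (measurableT_comp f1 mg)|exact: (measurableT_comp f2
  mg)]. Qed.

Let mpt_ty x : cmeasurable setT (fun z : measurableTypeR R * Rn R n => pt0 (z.1, (x, z.2))).
Proof.
apply: (cmeasurable_comp mpt0); apply: measurable_fun_pair; first exact: measurable_fst.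
by apply: measurable_fun_pair; [exact: measurable_cst|exact: measurable_snd].
Qed.

Let mpt_t x y : cmeasurable setT (fun t => pt0 (t, (x, y))).
Proof.
apply: (cmeasurable_comp mpt0); apply: measurable_fun_pair;
  [exact: measurable_id|exact: measurable_cst].
Qed.

Let mpt_y t x : cmeasurable setT (fun y => pt0 (t, (x, y))).
Proof.
apply: (cmeasurable_comp mpt0); apply: measurable_fun_pair; first exact: measurable_cst.
by apply: measurable_fun_pair; [exact: measurable_cst|exact: measurable_id].
Qed.

(** The unnormalised Riesz potential of |h|, by which every absolute integral below is dominated. *)
Definition riesz (h : CRn) x : \bar R :=
  (\int[leb]_y (normc (h y) * edist x y `^ (alpha - n%:R))%:E)%E.

Let mriesz (h : CRn) (x : Rn R n) : cmeasurable setT h ->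
  measurable_fun setT (fun y => (normc (h y) * edist x y `^ (alpha - n%:R))%:E).
Proof.
move=> mh; apply/measurable_EFinP; apply: measurable_funM; first exact: measurable_normc.
apply: (measurableT_comp (f := fun t : R => t `^ (alpha - n%:R))); first exact: measurable_powR.
apply: (measurableT_comp (f := fun z : Rn R n * Rn R n => edist z.1 z.2) (g := fun y => (x, y))).
  exact: measurable_edist.
exact: pair1_measurable.
Qed.

(** The factor t^(-n/2) of the Gaussian bound and t^(alpha/2 - 1) multiply to t^(- dd - 1). *)
Let dd := (n%:R - alpha) / 2.
Let dd0 : 0 < dd. Proof. by rewrite divr_gt0// subr_gt0. Qed.

Let edist_gt0 (x y : Rn R n) : x != y -> 0 < edist x y.
Proof. by move=> xy; rewrite lt_def edistRn_ge0 andbT; apply: contra_neq xy;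
  exact: edistRn_eq0. Qed.

Let expo (u : R) : u `^ (- (2 * dd)) = u `^ (alpha - n%:R).
Proof. by congr (_ `^ _); rewrite /dd; field. Qed.

Lemma kernel_time_integral_le : exists Ck : R, 0 < Ck /\ forall x y, x != y ->
  (\int[mu]_t (normc (pt0 (t, (x, y))) * t `^ (alpha / 2 - 1))%:E <=
   (Ck * edist x y `^ (alpha - n%:R))%:E)%E.
Proof.
have [C [Cp HC]] := gaussian_integral_le c0 dd0.
exists (C0 * C); split; first by rewrite mulr_gt0.
move=> x y xy; have u0 := edist_gt0 xy; rewrite -expo.
apply: (@le_trans _ _ (C0%:E * \int[mu]_(t in P) (t `^ (- dd - 1) * expR (- c * (edist x y ^+ 2 /
  t)))%:E)%E); last first.
  by rewrite -mulrA EFinM; apply: lee_wpmul2l; [rewrite lee_fin ltW|exact: HC].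
rewrite [leLHS](_ : _ = \int[mu]_(t in P) (normc (pt0 (t, (x, y))) * t `^ (alpha / 2 - 1))%:E)%E;
  last first.
  rewrite [RHS]integral_mkcond; apply: eq_integral => t _; rewrite patchE; case: ifPn => //.
  by rewrite notin_setE/= /pt0 => /negP/negbTE /= ->; rewrite normc0 mul0r.
have mg : measurable_fun P (fun t => (t `^ (- dd - 1) * expR (- c * (edist x y ^+ 2 / t)))%:E).
  apply/measurable_EFinP; apply: measurable_funM.
    by apply: measurable_funTS; exact: measurable_powR.
  apply: (eq_measurable_fun (fun t => expR (- c * (edist x y ^+ 2 * t `^ (-1))))).
    by move=> t; rewrite inE/= => t0; rewrite powR_inv1// ltW.
  apply: measurable_funTS; apply: measurableT_comp; first exact: measurable_expR.
  by apply: measurable_funM => //; apply: measurable_funM => //; exact: measurable_powR.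
rewrite -ge0_integralZl_EFin ?(ltW C00)//; last first.
  by move=> t _; rewrite lee_fin mulr_ge0 ?powR_ge0 ?expR_ge0.
apply: ge0_le_integral => //.
- by move=> t _; rewrite lee_fin mulr_ge0 ?powR_ge0// normc_ge0.
- apply/measurable_EFinP; apply: measurable_funM; last by apply: measurable_funTS;
  exact: measurable_powR.
  by apply: measurable_funTS; apply: measurable_normc.
- by apply: measurable_funeM.
move=> t t0; rewrite pt0E// -EFinM lee_fin.
apply: (le_trans (ler_wpM2r (powR_ge0 _ _) (gauss x y t0))).
apply: le_of_eq.
have [T ->] := pos_expR (t0 : 0 < t).
have -> : expR T `^ (- dd - 1) = (expR T `^ (n%:R / 2))^-1 * expR T `^ (alpha / 2 - 1).
  by rewrite /dd; exp_field.
by ring.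
Qed.

(** Used for the inner integral in y at a single time: the Gaussian is traded for the same power of
    the distance, with a constant depending on t. *)
Lemma kernel_le t : 0 < t -> exists Ct : R, 0 <= Ct /\ forall x y, x != y ->
  normc (pt t x y) <= Ct * edist x y `^ (alpha - n%:R).
Proof.
move=> t0; exists (C0 / t `^ (n%:R / 2) * ((dd / c) `^ dd * t `^ dd)); split.
  by rewrite !mulr_ge0 ?powR_ge0 ?invr_ge0 ?powR_ge0// ltW.
move=> x y xy; have u0 := edist_gt0 xy; apply: (le_trans (gauss x y t0)).
have z0 : 0 < edist x y ^+ 2 / t by rewrite divr_gt0// exprn_gt0.
rewrite -[leRHS]mulrA; apply: ler_wpM2l; first by rewrite divr_ge0 ?powR_ge0// ltW.
apply: (le_trans (expRN_le_powR c0 dd0 z0)).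
rewrite -[leRHS]mulrA ler_wpM2l ?powR_ge0//; apply: le_of_eq.
rewrite -expo -powR_mulrn ?(ltW u0)//.
by have [T ->] := pos_expR t0; have [U ->] := pos_expR u0; exp_field.
Qed.

Let Phi (h : CRn) x (z : measurableTypeR R * Rn R n) : \bar R :=
  (normc (pt0 (z.1, (x, z.2))) * z.1 `^ (alpha / 2 - 1) * normc (h z.2))%:E.

Let Phi_ge0 h x z : (0 <= Phi h x z)%E.
Proof. by rewrite lee_fin !mulr_ge0 ?powR_ge0 ?normc_ge0. Qed.

Let mPhi h x : cmeasurable setT h -> measurable_fun setT (Phi h x).
Proof.
move=> mh; apply/measurable_EFinP; apply: measurable_funM.
  apply: measurable_funM; first by apply: measurable_normc => //; exact: mpt_ty.
  by apply: (measurableT_comp (f := fun t : R => t `^ (alpha / 2 - 1)));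
    [exact: measurable_powR|exact: measurable_fst].
apply: (measurableT_comp (f := fun y => normc (h y))); first exact: measurable_normc.
exact: measurable_snd.
Qed.

(** Tonelli moves the time integral inside. Its bound is available only for y different from x, and
    a point is null since n > 0. *)
Lemma kernel_double_integral_le : exists Ck : R, 0 < Ck /\ forall h x, cmeasurable setT h ->
  (\int[mu]_t \int[leb]_y Phi h x (t, y) <= Ck%:E * riesz h x)%E.
Proof.
have [Ck [Ck0 HCk]] := kernel_time_integral_le.
exists Ck; split => // h x mh.
have mr := mriesz x mh.
rewrite fubini_tonelli//; last exact: mPhi.
rewrite /riesz -ge0_integralZl_EFin ?(ltW Ck0)//; last first.
  by move=> y _; rewrite lee_fin mulr_ge0 ?powR_ge0 ?normc_ge0.
apply: ae_ge0_le_integral => //.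
- by move=> y _; apply: integral_ge0 => t _; exact: Phi_ge0.
- apply: (measurable_fun_fubini_tonelli_G (Phi h x)) => //; exact: mPhi.
- by move=> y _; rewrite mule_ge0 ?lee_fin ?(ltW Ck0)// mulr_ge0 ?powR_ge0 ?normc_ge0.
- exact: measurable_funeM.
exists [set x]; split => //.
- exact: measurable_Rn_point.
- exact: lebesgueRn_point.
move=> y /=; apply: contra_notP => yx _.
have {}yx : x != y by apply/eqP => xy; apply: yx.
have H := HCk x y yx.
rewrite (_ : (\int[mu]_t Phi h x (t, y)) = (normc (h y))%:E * \int[mu]_t (normc (pt0 (t, (x,
  y))) * t `^ (alpha / 2 - 1))%:E)%E; last first.
  rewrite -ge0_integralZl_EFin ?normc_ge0//.
  - by apply: eq_integral => t _; rewrite /Phi/= mulrC EFinM.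
  - by move=> t _; rewrite lee_fin mulr_ge0 ?powR_ge0 ?normc_ge0.
  - apply/measurable_EFinP; apply: measurable_funM; last exact: measurable_powR.
    by apply: measurable_normc => //; exact: mpt_t.
apply: (le_trans (lee_wpmul2l _ H)); first by rewrite lee_fin normc_ge0.
by rewrite -!EFinM lee_fin mulrCA.
Qed.

Let F (h : CRn) x t := semigroup_integral pt t h x * (t `^ (alpha / 2 - 1))%:C%C.

Lemma cintegrable_semigroup h x t : cmeasurable setT h -> (riesz h x < +oo)%E -> 0 < t ->
  cintegrable leb setT (fun y => pt t x y * h y).
Proof.
move=> mh hx t0; have [Ct [Ct0 HCt]] := kernel_le t0.
have mr := mriesz x mh.
have mp : cmeasurable setT (fun y => pt t x y).
  by apply: eq_cmeasurable (mpt_y t x) => y _; rewrite pt0E.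
apply: cintegrable_normc => //; first exact: cmeasurableM.
apply: (@le_lt_trans _ _ (Ct%:E * riesz h x)%E); last first.
  by apply: lte_mul_pinfty; rewrite ?lee_fin//; exact: integral_ge0_fin.
rewrite /riesz -ge0_integralZl_EFin//; last first.
  by move=> y _; rewrite lee_fin mulr_ge0 ?powR_ge0 ?normc_ge0.
apply: ae_ge0_le_integral => //.
- by move=> y _; rewrite lee_fin normc_ge0.
- apply/measurable_EFinP; apply: measurable_normc => //; exact: cmeasurableM.
- by move=> y _; rewrite mule_ge0 ?lee_fin// mulr_ge0 ?powR_ge0 ?normc_ge0.
- exact: measurable_funeM.
exists [set x]; split => //.
- exact: measurable_Rn_point.
- exact: lebesgueRn_point.
move=> y /=; apply: contra_notP => yx _.
have {}yx : x != y by apply/eqP => xy; apply: yx.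
rewrite -EFinM lee_fin normcM mulrC mulrCA; apply: ler_wpM2l; [exact: normc_ge0|exact: HCt].
Qed.

Let mF h x : cmeasurable setT h -> cmeasurable P (F h x).
Proof.
move=> mh; apply: (@eq_cmeasurable _ _ _ P (fun t => cintegral leb setT (fun y => pt0 (t, (x,
  y)) * h y) * (t `^ (alpha / 2 - 1))%:C%C)).
  move=> t; rewrite inE/= => t0; rewrite /F /semigroup_integral; congr (_ * _).
  by apply: eq_cintegral => y _; rewrite pt0E.
have [m1 m2] : cmeasurable setT (fun t : measurableTypeR R => cintegral leb setT (fun y => pt0 (t,
  (x, y)) * h y) * (t `^ (alpha / 2 - 1))%:C%C).
  apply: cmeasurableM; last by apply: cmeasurable_real; exact: measurable_powR.
  apply: (@cmeasurable_cintegral_param _ _ _ _ R leb setT (fun z : measurableTypeR R * Rn R n =>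
    pt0 (z.1, (x, z.2)) * h z.2)) => //.
  apply: cmeasurableM; first exact: mpt_ty.
  by apply: (cmeasurable_comp mh); exact: measurable_snd.
by split; exact: measurable_funTS.
Qed.

Lemma fractional_norm_le : exists Ck : R, 0 < Ck /\ forall h x, cmeasurable setT h ->
  (\int[mu]_(t in P) (normc (F h x t))%:E <= Ck%:E * riesz h x)%E.
Proof.
have [Ck [Ck0 HCk]] := kernel_double_integral_le.
exists (2 * Ck); split => [|h x mh]; first by rewrite mulr_gt0.
have mI : measurable_fun setT (fun t => \int[leb]_y Phi h x (t, y))%E.
  by apply: (measurable_fun_fubini_tonelli_F (Phi h x)) => //; exact: mPhi.
apply: (@le_trans _ _ (2%:E * \int[mu]_t \int[leb]_y Phi h x (t, y))%E); last first.
  by rewrite EFinM -muleA; apply: lee_wpmul2l; [rewrite lee_fin|exact: HCk].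
rewrite -ge0_integralZl_EFin//; last first.
  by move=> t _; apply: integral_ge0.
apply: (@le_trans _ _ (\int[mu]_(t in P) (2%:E * \int[leb]_y Phi h x (t, y)))%E); last first.
  apply: ge0_subset_integral => //; first exact: measurable_funeM.
  by move=> t _; rewrite mule_ge0 ?lee_fin// integral_ge0.
apply: ge0_le_integral => //.
- by move=> t _; rewrite lee_fin normc_ge0.
- by apply/measurable_EFinP; apply: measurable_normc => //; exact: mF.
- by apply: measurable_funTS; exact: measurable_funeM.
move=> t t0; rewrite /F normcM normcC ger0_norm ?powR_ge0// EFinM.
have mp : cmeasurable setT (fun y => pt t x y * h y).
  apply: cmeasurableM => //; by apply: eq_cmeasurable (mpt_y t x) => y _; rewrite pt0E.
have mn : measurable_fun setT (fun y => (normc (pt t x y * h y))%:E).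
  by apply/measurable_EFinP; exact: measurable_normc.
apply: (le_trans (lee_wpmul2r _ (normc_cintegral_le leb measurableT mp))).
  by rewrite lee_fin powR_ge0.
rewrite -muleA; apply: lee_wpmul2l; first by rewrite lee_fin.
rewrite muleC -ge0_integralZl_EFin ?powR_ge0//; last by move=> y _; rewrite lee_fin normc_ge0.
apply: le_of_eq; apply: eq_integral => y _.
by rewrite /Phi/= pt0E// normcM -EFinM mulrCA mulrA.
Qed.

Lemma cintegrable_fractional h x : cmeasurable setT h -> (riesz h x < +oo)%E ->
  cintegrable mu P (F h x).
Proof.
move=> mh hx; have [Ck [Ck0 HCk]] := fractional_norm_le.
apply: cintegrable_normc => //; first exact: mF.
apply: le_lt_trans (HCk h x mh) _.
apply: lte_mul_pinfty; rewrite ?lee_fin ?(ltW Ck0)//.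
Qed.

Definition frac_op (h : CRn) x : R[i] :=
  (Gamma (alpha / 2))^-1%:C%C * cintegral mu [set t | 0 < t]
    (fun t => semigroup_integral pt t h x * (t `^ (alpha / 2 - 1))%:C%C).

(** A finite Riesz potential implies both convergence requirements of the definition: of the
    integral in y at every time, and of the integral in t. *)
Lemma fractional_integralE h x : cmeasurable setT h -> (riesz h x < +oo)%E ->
  fractional_integral pt alpha h x = Some (frac_op h x).
Proof.
move=> mh hx; rewrite /fractional_integral; case: asboolP => // -[]; split.
- by move=> t t0; exact: cintegrable_semigroup.
- exact: cintegrable_fractional.
Qed.

Lemma frac_op_mulB (a : R[i]) g h x : cmeasurable setT g -> cmeasurable setT h ->
  (riesz g x < +oo)%E -> (riesz h x < +oo)%E ->
  frac_op (fun y => a * g y - h y) x = a * frac_op g x - frac_op h x.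
Proof.
move=> mg mh gx hx; rewrite /frac_op mulrCA -mulrBr; congr (_ * _).
rewrite -cintegral_mulB//; [|exact: cintegrable_fractional|exact: cintegrable_fractional].
apply: eq_cintegral => t; rewrite inE/= => t0.
rewrite mulrA -mulrBl; congr (_ * _); rewrite /semigroup_integral.
rewrite -cintegral_mulB//; [|exact: cintegrable_semigroup|exact: cintegrable_semigroup].
by apply: eq_cintegral => y _; ring.
Qed.

Lemma frac_op_le : exists Ck : R, 0 < Ck /\ forall h x, cmeasurable setT h ->
  ((normc (frac_op h x))%:E <= Ck%:E * riesz h x)%E.
Proof.
have [Ck [Ck0 HCk]] := fractional_norm_le.
pose G := `|(Gamma (alpha / 2))^-1| : R.
(* The added 1 keeps the constant positive without evaluating the Gamma integral. *)
exists ((G + 1) * (2 * Ck)); split; first by rewrite !mulr_gt0// ltr_wpDl// /G.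
move=> h x mh; rewrite /frac_op normcM normcC -/G.
have H := normc_cintegral_le mu mP (mF x mh).
have rz : (0 <= riesz h x)%E by apply: integral_ge0 => y _;
  rewrite lee_fin mulr_ge0 ?powR_ge0 ?normc_ge0.
rewrite EFinM; apply: (@le_trans _ _ (G%:E * (2%:E * (Ck%:E * riesz h x)))%E).
  apply: lee_wpmul2l; first by rewrite lee_fin /G.
  by apply: le_trans H _; apply: lee_wpmul2l; [rewrite lee_fin|exact: HCk].
rewrite !muleA -!EFinM; apply: lee_wpmul2r => //;
  rewrite lee_fin -mulrA ler_wpM2r ?mulr_ge0 ?(ltW Ck0)//.
by rewrite lerDl.
Qed.

(** The function fed to the operator depends on the evaluation point, as the commutator requires;
    measurability in x follows from two successive parameter integrals. *)
Lemma cmeasurable_frac_op (H : Rn R n -> CRn) :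
  cmeasurable setT (fun z : Rn R n * Rn R n => H z.1 z.2) ->
  cmeasurable setT (fun x => frac_op (H x) x).
Proof.
move=> mH; apply: cmeasurableM; first exact: cmeasurable_cst.
pose J (z : Rn R n * measurableTypeR R) : R[i] := cintegral leb setT (fun y => pt0 (z.2, (z.1,
  y)) * H z.1 y) * (z.2 `^ (alpha / 2 - 1))%:C%C.
rewrite (_ : (fun x => _) = (fun x => cintegral mu P (fun t => J (x, t)))); last first.
  apply/funext => x; apply: eq_cintegral => t; rewrite inE/= => t0; congr (_ * _).
  by apply: eq_cintegral => y _; rewrite pt0E.
apply: (@cmeasurable_cintegral_param _ _ _ _ R mu P J) => //.
apply: cmeasurableM; last first.
  apply: cmeasurable_real; apply: (measurableT_comp (f := fun t : R => t `^ (alpha / 2 - 1)));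
    [exact: measurable_powR|exact: measurable_snd].
apply: (@cmeasurable_cintegral_param _ _ _ _ R leb setT (fun z : (Rn R n * measurableTypeR R) * Rn
  R n => pt0 (z.1.2, (z.1.1, z.2)) * H z.1.1 z.2)) => //.
have m11 : measurable_fun setT (fun z : (Rn R n * measurableTypeR R) * Rn R n => z.1.1).
  by apply: (measurableT_comp (f := fst)); exact: measurable_fst.
have m12 : measurable_fun setT (fun z : (Rn R n * measurableTypeR R) * Rn R n => z.1.2).
  by apply: (measurableT_comp (f := snd)); [exact: measurable_snd|exact: measurable_fst].
apply: cmeasurableM.
- apply: (cmeasurable_comp mpt0); apply: measurable_fun_pair => //.
  by apply: measurable_fun_pair => //; exact: measurable_snd.
- apply: (cmeasurable_comp mH (g := fun z => (z.1.1, z.2))); apply: measurable_fun_pair => //;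
  exact: measurable_snd.
Qed.

End fractional_kernel.

(** * The iterated commutator as an integral operator *)

Section multilinear_commutator.
Context {R : realType} {n : nat}.
Local Notation leb := (lebesgueRn R n).
Local Notation CRn := (Rn R n -> R[i]).
Variables (pt : R -> Rn R n -> Rn R n -> R[i]) (C0 c alpha : R).
Hypothesis mpt : cmeasurable ([set t : measurableTypeR R | 0 < t] `*` [set: Rn R n * Rn R n])
  (fun z => pt z.1 z.2.1 z.2.2).
Hypotheses (C00 : 0 < C0) (c0 : 0 < c) (gauss : Gaussian_bound C0 c pt).
Hypotheses (alpha0 : 0 < alpha) (alpha_lt : alpha < n%:R).

Definition cmeasurable_seq (bs : seq CRn) := forall i, cmeasurable setT (nth (fun=> 0) bs i).

Lemma cmeasurable_seq_rcons bs b : cmeasurable_seq (rcons bs b) ->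
  cmeasurable_seq bs /\ cmeasurable setT b.
Proof.
move=> H; split=> [i|]; last by have := H (size bs); rewrite nth_rcons ltnn eqxx.
have := H i; rewrite nth_rcons; case: ltnP => // ib _.
by rewrite nth_default//; exact: cmeasurable_cst.
Qed.

(** Dominates every partial product of the |b_j|; times |f|, it dominates every function to which
    the fractional integral is applied in the expansion of the commutator. *)
Definition prodN (bs : seq CRn) (y : Rn R n) : R := \prod_(b <- bs) (1 + normc (b y)).

Lemma prodN_ge1 bs y : 1 <= prodN bs y.
Proof.
elim: bs => [|b bs IH]; rewrite /prodN ?big_nil// big_cons.
by apply: mulr_ege1 => //; rewrite lerDl normc_ge0.
Qed.

Lemma normc_prod (bs : seq CRn) (g : CRn -> R[i]) :
  normc (\prod_(b <- bs) g b) = \prod_(b <- bs) normc (g b).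
Proof.
elim: bs => [|b bs IH]; first by rewrite !big_nil normc1.
by rewrite !big_cons normcM IH.
Qed.

Lemma normc_prodB_le bs (x y : Rn R n) :
  normc (\prod_(b <- bs) (b x - b y)) <= prodN bs x * prodN bs y.
Proof.
rewrite normc_prod /prodN -big_split /=.
elim: bs => [|b bs IH]; first by rewrite !big_nil.
rewrite !big_cons; apply: ler_pM => //; first exact: normc_ge0.
  by elim: (bs) => [|b' bs' IH']; rewrite ?big_nil// big_cons mulr_ge0// normc_ge0.
have := normc_triangle 0 (b x) (b y); rewrite subr0 sub0r normcN => /le_trans; apply.
by have := normc_ge0 (b x); have := normc_ge0 (b y); nra.
Qed.

Lemma cmeasurable_prodB bs : cmeasurable_seq bs ->
  cmeasurable setT (fun z : Rn R n * Rn R n => \prod_(b <- bs) (b z.1 - b z.2)).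
Proof.
elim/last_ind: bs => [|bs b IH].
  by move=> _; under eq_fun do rewrite big_nil; exact: cmeasurable_cst.
move=> /cmeasurable_seq_rcons[/IH mbs [m1 m2]].
under eq_fun do rewrite big_rcons/=.
apply: cmeasurableM => //; apply: cmeasurableB; split.
- by apply: (measurableT_comp m1); exact: measurable_fst.
- by apply: (measurableT_comp m2); exact: measurable_fst.
- by apply: (measurableT_comp m1); exact: measurable_snd.
- by apply: (measurableT_comp m2); exact: measurable_snd.
Qed.

Lemma cmeasurable_prodB_section bs x : cmeasurable_seq bs ->
  cmeasurable setT (fun y => \prod_(b <- bs) (b x - b y)).
Proof.
move=> /cmeasurable_prodB[m1 m2]; split.
- by apply: (measurable_fun_pair2 x m1).
- by apply: (measurable_fun_pair2 x m2).
Qed.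

Lemma cmeasurable_prodN bs : cmeasurable_seq bs -> measurable_fun setT (prodN bs).
Proof.
rewrite /prodN; elim/last_ind: bs => [|bs b IH].
  by move=> _; under eq_fun do rewrite big_nil; exact: measurable_cst.
move=> /cmeasurable_seq_rcons[/IH mbs mb]; under eq_fun do rewrite big_rcons/=.
by apply: measurable_funM => //; apply: measurable_funD => //; exact: measurable_normc.
Qed.

Lemma riesz_ltoo (K : R) (h g : CRn) x : 0 <= K -> cmeasurable setT h -> cmeasurable setT g ->
  (forall y, normc (g y) <= K * normc (h y)) ->
  (riesz alpha h x < +oo)%E -> (riesz alpha g x < +oo)%E.
Proof.
move=> K0 mh mg gh hx.
have mr (f : CRn) : cmeasurable setT f ->
    measurable_fun setT (fun y => (normc (f y) * edist x y `^ (alpha - n%:R))%:E).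
  move=> mf; apply/measurable_EFinP; apply: measurable_funM; first exact: measurable_normc.
  apply: (measurableT_comp (f := fun t : R => t `^ (alpha - n%:R))); first exact: measurable_powR.
  apply: (measurableT_comp (f := fun z : Rn R n * Rn R n => edist z.1 z.2) (g := fun y => (x, y))).
    exact: measurable_edist.
  exact: pair1_measurable.
apply: (@le_lt_trans _ _ (K%:E * riesz alpha h x)%E); last first.
  by apply: lte_mul_pinfty; rewrite ?lee_fin.
rewrite /riesz -ge0_integralZl_EFin//; last 2 first.
- by move=> y _; rewrite lee_fin mulr_ge0 ?powR_ge0 ?normc_ge0.
- exact: mr.
apply: ge0_le_integral => //.
- by move=> y _; rewrite lee_fin mulr_ge0 ?powR_ge0 ?normc_ge0.
- exact: mr.
- by apply: measurable_funeM; exact: mr.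
by move=> y _; rewrite -EFinM lee_fin mulrA ler_wpM2r ?powR_ge0.
Qed.

(** Induction on the last function, the outermost bracket, which evaluates the inner commutator at f
    and at b f. Both needed potentials are dominated through [prodN], and linearity with b x frozen
    as a scalar recombines the two kernels. *)
Lemma multi_commutatorE bs f x : cmeasurable_seq bs -> cmeasurable setT f ->
  (riesz alpha (fun y => (prodN bs y)%:C%C * f y)%R x < +oo)%E ->
  multi_commutator bs (fractional_integral pt alpha) f x =
    Some (frac_op pt alpha (fun y => (\prod_(b <- bs) (b x - b y)) * f y) x).
Proof.
elim/last_ind: bs f => [|bs b IH] f.
  move=> _ mf fx; rewrite /multi_commutator /=.
  have fE : (fun y => \prod_(b <- ([::] : seq CRn)) (b x - b y) * f y) = f.
    by apply/funext => y; rewrite big_nil mul1r.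
  rewrite fE; apply: (fractional_integralE mpt C00 c0 gauss) => //.
  move: fx; rewrite (_ : (fun y => _) = f)//.
  by apply/funext => y; rewrite /prodN big_nil mul1r.
move=> mbs mf fx; have [mbs' mb] := cmeasurable_seq_rcons mbs.
have mN bs' : cmeasurable_seq bs' -> cmeasurable setT (fun y => (prodN bs' y)%:C%C).
  by move=> H; apply: cmeasurable_real; exact: cmeasurable_prodN.
have mbf : cmeasurable setT (fun y => b y * f y) by exact: cmeasurableM.
have nN bs' y : normc (prodN bs' y)%:C%C = prodN bs' y.
  by rewrite normcC ger0_norm// (le_trans ler01)// prodN_ge1.
have N0 bs' y : 0 <= prodN bs' y by rewrite (le_trans ler01)// prodN_ge1.
have NE y : prodN (rcons bs b) y = prodN bs y * (1 + normc (b y)).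
  by rewrite /prodN big_rcons /= mulrC.
have fx1 : (riesz alpha (fun y => (prodN bs y)%:C%C * f y)%R x < +oo)%E.
  apply: (riesz_ltoo (h := fun y => (prodN (rcons bs b) y)%:C%C * f y) (K := 1)) fx => //.
  - by apply: cmeasurableM => //; exact: mN.
  - by apply: cmeasurableM => //; exact: mN.
  - move=> y; rewrite mul1r !normcM !nN NE ler_wpM2r ?normc_ge0//.
    by rewrite ler_peMr// lerDl normc_ge0.
have fx2 : (riesz alpha (fun y => (prodN bs y)%:C%C * (b y * f y))%R x < +oo)%E.
  apply: (riesz_ltoo (h := fun y => (prodN (rcons bs b) y)%:C%C * f y) (K := 1)) fx => //.
  - by apply: cmeasurableM => //; exact: mN.
  - by apply: cmeasurableM => //; exact: mN.
  - move=> y; rewrite mul1r !normcM !nN NE -mulrA ler_wpM2l// ler_wpM2r ?normc_ge0//.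
    by rewrite lerDr.
have I1 := IH f mbs' mf fx1; have I2 := IH _ mbs' mbf fx2.
rewrite /multi_commutator foldl_rcons -/(multi_commutator _ _) /commutator I1 I2; congr Some.
have big f' : cmeasurable setT f' -> (riesz alpha (fun y => (prodN bs y)%:C%C * f' y)%R x < +oo)%E
  ->
    (riesz alpha (fun y => (\prod_(b <- bs) (b x - b y)) * f' y)%R x < +oo)%E.
  move=> mf'; apply: (riesz_ltoo (K := prodN bs x)) => //.
  - by apply: cmeasurableM => //; exact: mN.
  - by apply: cmeasurableM => //; exact: cmeasurable_prodB_section.
  - by move=> y; rewrite !normcM nN mulrA ler_wpM2r ?normc_ge0 ?normc_prodB_le.
have hE : (fun y => \prod_(b0 <- rcons bs b) (b0 x - b0 y) * f y) =
    (fun y => b x * (\prod_(b0 <- bs) (b0 x - b0 y) * f y) - \prod_(b0 <- bs) (b0 x - b0 y) * (b y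
      * f y)).
  apply/funext => y; rewrite big_rcons /=.
  by move: (\prod_(b0 <- bs) _) (b x) (b y) (f y) => u v z t; ring.
rewrite hE (frac_op_mulB mpt C00 c0 gauss alpha0 alpha_lt); first by [].
- by apply: cmeasurableM => //; exact: cmeasurable_prodB_section.
- by apply: cmeasurableM => //; exact: cmeasurable_prodB_section.
- exact: big.
- exact: big.
Qed.

(** [g] is given by the total operator [frac_op], so its measurability and its bound do not wait for
    the convergence that identifies it with the commutator. *)
Lemma multi_commutator_le : exists Ck : R, 0 < Ck /\ forall bs f,
  cmeasurable_seq bs -> cmeasurable setT f ->
  exists g, [/\ cmeasurable setT g,
    forall x, (riesz alpha (fun y => (prodN bs y)%:C%C * f y)%R x < +oo)%E ->
      multi_commutator bs (fractional_integral pt alpha) f x = Some (g x) &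
    forall x, ((normc (g x))%:E <=
      Ck%:E * \int[leb]_y (\prod_(b <- bs) normc (b x - b y) * normc (f y) *
        edist x y `^ (alpha - n%:R))%:E)%E].
Proof.
have [Ck [Ck0 HCk]] := frac_op_le mpt C00 c0 gauss alpha0 alpha_lt.
exists Ck; split => // bs f mbs mf.
exists (fun x => frac_op pt alpha (fun y => (\prod_(b <- bs) (b x - b y)) * f y) x); split.
- apply: (@cmeasurable_frac_op _ _ pt alpha mpt (fun x y => (\prod_(b <- bs) (b x - b y)) * f y)).
  apply: cmeasurableM; first exact: cmeasurable_prodB.
  by case: mf => m1 m2; split; [apply: (measurableT_comp m1)|apply: (measurableT_comp m2)];
    exact: measurable_snd.
- by move=> x fx; exact: multi_commutatorE.
- move=> x; have := HCk (fun y => (\prod_(b <- bs) (b x - b y)) * f y) x.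
  have mm : cmeasurable setT (fun y => (\prod_(b <- bs) (b x - b y)) * f y).
    by apply: cmeasurableM => //; exact: cmeasurable_prodB_section.
  move=> /(_ mm) /le_trans; apply; apply: lee_wpmul2l; first by rewrite lee_fin ltW.
  apply: le_of_eq; apply: eq_integral => y _.
  by rewrite normcM normc_prod.
Qed.

End multilinear_commutator.

(** * From balls to cubes *)

Section ball_cube.
Context {R : realType} {n : nat}.
Hypothesis n0 : (0 < n)%N.
Implicit Types (a x y : Rn R n) (l : R).
Local Notation leb := (lebesgueRn R n).

Let N0 : 0 < n%:R :> R. Proof. by rewrite ltr0n. Qed.

Definition hcenter a l : Rn R n := [tuple tnth a i + l / 2 | i < n].

(** The radius n l exceeds half the diagonal of the cube. As it is a fixed multiple of the side,
    every ball is the ball of some cube. *)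
Definition cball a l : set (Rn R n) := eball (hcenter a l) (n%:R * l).

Definition ccorner a l : Rn R n := [tuple tnth (hcenter a l) i - n%:R * l | i < n].

Definition cside l : R := 2 * (n%:R * l).

Lemma cside_gt0 l : 0 < l -> 0 < cside l.
Proof. by move=> l0; rewrite /cside !mulr_gt0. Qed.

Lemma measurable_eball x (rho : R) : measurable (eball x rho).
Proof.
have : measurable_fun setT (fun y => edist x y).
  apply: (measurableT_comp (f := fun z : Rn R n * Rn R n => edist z.1 z.2) (g := fun y => (x, y))).
    exact: measurable_edist.
  exact: pair1_measurable.
move=> /(_ measurableT `]-oo, rho[%classic (measurable_itv _)).
by rewrite setTI (_ : _ @^-1` _ = eball x rho)//; apply/seteqP; split => y /=; rewrite in_itv.
Qed.

Lemma hcube_sub_cball a l : 0 < l -> hcube a l `<=` cball a l.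
Proof.
move=> l0 y ya; rewrite /cball /eball /=.
apply: (@le_lt_trans _ _ (n%:R * (l / 2))).
  apply: edistRn_le => [|i]; first by rewrite divr_ge0// ltW.
  have /andP[y1 y2] := ya i; rewrite tnth_mktuple ler_norml; apply/andP; split; lra.
by rewrite ltr_pM2l// ltr_pdivrMr// mulr_natr mulr2n ltrDl.
Qed.

Lemma cball_sub_hcube a l : 0 < l -> cball a l `<=` hcube (ccorner a l) (cside l).
Proof.
move=> l0 y; rewrite /cball /eball /= => ya i; rewrite tnth_mktuple.
have := le_lt_trans (tnth_edistRn_le (hcenter a l) y i) ya.
rewrite ltr_norml /cside => /andP[]; set t := tnth (hcenter a l) i; set u := n%:R * l.
by move=> H1 H2; apply/andP; split; lra.
Qed.

Lemma hcube_sub_ccube a l : 0 < l -> hcube a l `<=` hcube (ccorner a l) (cside l).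
Proof. by move=> l0 y /(hcube_sub_cball l0)/(cball_sub_hcube l0). Qed.

Lemma balls_cball a l : 0 < l -> balls (cball a l).
Proof. by move=> l0; exists (hcenter a l), (n%:R * l); split => //; rewrite mulr_gt0. Qed.

Lemma balls_cballP (B : set (Rn R n)) : balls B -> exists a l, 0 < l /\ B = cball a l.
Proof.
move=> [x [rho [rho0 ->]]]; exists [tuple tnth x i - rho / n%:R / 2 | i < n], (rho / n%:R).
split; first by rewrite divr_gt0.
rewrite /cball; congr (eball _ _); last by rewrite mulrC divfK// gt_eqF.
by apply: eq_from_tnth => i; rewrite !tnth_mktuple subrK.
Qed.

Lemma measurable_cball a l : measurable (cball a l).
Proof. exact: measurable_eball. Qed.

Lemma leb_cball_le a l : 0 < l -> (leb (cball a l) <= ((2 * n%:R) ^+ n * l ^+ n)%:E)%E.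
Proof.
move=> l0; rewrite -exprMn -mulrA -/(cside l) -(lebesgueRn_hcube (ccorner a l) (ltW (cside_gt0
  l0))).
apply: le_measure; rewrite ?inE; [exact: measurable_cball|exact: measurable_hcube|exact:
  cball_sub_hcube].
Qed.

Lemma leb_cball_ge a l : 0 < l -> ((l ^+ n)%:E <= leb (cball a l))%E.
Proof.
move=> l0; rewrite -(lebesgueRn_hcube a (ltW l0)).
apply: le_measure; rewrite ?inE; [exact: measurable_hcube|exact: measurable_cball|exact:
  hcube_sub_cball].
Qed.

Lemma leb_cball_fin a l : 0 < l -> leb (cball a l) = (fine (leb (cball a l)))%:E.
Proof.
by move=> l0; rewrite fineK// ge0_fin_numE//; apply: le_lt_trans (leb_cball_le a l0) _;
  rewrite ltry.
Qed.

Lemma leb_cball_gt0 a l : 0 < l -> 0 < fine (leb (cball a l)).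
Proof.
move=> l0; apply: (@lt_le_trans _ _ (l ^+ n)); first exact: exprn_gt0.
by rewrite -lee_fin -leb_cball_fin// leb_cball_ge.
Qed.

End ball_cube.

Section weight_on_cubes.
Context {R : realType} {n : nat}.
Hypothesis n0 : (0 < n)%N.
Local Notation leb := (lebesgueRn R n).
Variables (w : Rn R n -> R).
Hypothesis hw : weight w.

(** The weight is positive only almost everywhere; a change on a null set makes all its real powers
    invertible at every point. *)
Definition posw x := if 0 < w x then w x else 1.

Lemma posw_gt0 x : 0 < posw x.
Proof. by rewrite /posw; case: ifP. Qed.

Let mw : measurable_fun setT w. Proof. by case: hw => -[]. Qed.

Lemma measurable_posw : measurable_fun setT posw.
Proof.
apply: measurable_fun_ifT => //.
by apply: measurable_fun_ltr => //; exact: measurable_cst.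
Qed.

Lemma ae_posw : {ae leb, forall x, w x = posw x}.
Proof. by case: hw => _; apply: filterS => x wx; rewrite /posw wx. Qed.

Lemma integral_posw (E : set (Rn R n)) (h : Rn R n -> R) (phi : R -> R) : measurable E ->
  measurable_fun setT h -> measurable_fun setT phi ->
  (\int[leb]_(x in E) (h x * phi (w x))%:E = \int[leb]_(x in E) (h x * phi (posw x))%:E)%E.
Proof.
move=> mE mh mphi; apply: ae_eq_integral => //.
- apply/measurable_EFinP; apply: measurable_funTS; apply: measurable_funM => //.
  exact: measurableT_comp.
- apply/measurable_EFinP; apply: measurable_funTS; apply: measurable_funM => //.
  by apply: measurableT_comp => //; exact: measurable_posw.
by have := ae_posw; apply: filterS => x -> _.
Qed.

Local Notation W := (wdens leb measurable_posw posw_gt0).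
Local Notation cW := (cmass leb measurable_posw posw_gt0).

Let integral_cst1M (E : set (Rn R n)) (v : Rn R n -> R) :
  (\int[leb]_(x in E) (cst 1 x * v x)%:E = \int[leb]_(x in E) (v x)%:E)%E.
Proof. by apply: eq_integral => x _; rewrite /cst mul1r. Qed.

Lemma wmeasureE E : measurable E -> wmeasure w E = W E.
Proof.
move=> mE; rewrite /wmeasure densE.
have := @integral_posw E (cst 1) id mE (measurable_cst _) (@measurable_id _ _ _).
by rewrite !integral_cst1M.
Qed.

Lemma wdens_hcube_fin (a : Rn R n) (l : R) : (W (hcube a l) < +oo)%E.
Proof.
have [l0|l0] := ltP 0 l; last first.
  rewrite (_ : hcube a l = set0) ?measure0//; apply/seteqP;
    split => // y /(_ (Ordinal n0)) /andP[H1 H2].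
  by move: (le_lt_trans H1 H2); rewrite ltNge gerDl l0.
have [[_ H] _] := hw; have {}H := H _ (balls_cball n0 a l0).
apply: le_lt_trans H.
apply: (@le_trans _ _ (W (cball a l))).
  by apply: le_measure; rewrite ?inE; [exact: measurable_hcube|exact: measurable_cball|exact:
    hcube_sub_cball].
rewrite -wmeasureE; last exact: measurable_cball.
rewrite /wmeasure; apply: le_trans (lee_abs _) _; apply: le_abse_integral.
- exact: measurable_cball.
- by apply/measurable_EFinP; exact: measurable_funTS.
Qed.

Let mB a l : measurable (cball a l : set (Rn R n)). Proof. exact: measurable_cball. Qed.
Let mQ a l : measurable (hcube a l : set (Rn R n)). Proof. exact: measurable_hcube. Qed.
Let lebH a l : 0 < l -> (leb : {measure set (Rn R n) -> \bar R}) (hcube a l) = (l ^+ n)%:E.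
Proof. by move=> l0; exact: lebesgueRn_hcube (ltW l0). Qed.
Let mpw E t : measurable_fun E (fun x => (posw x `^ t)%:E).
Proof. by apply: measurable_powR_comp; apply: measurable_funTS; exact: measurable_posw. Qed.

Lemma integral_powR_posw (E : set (Rn R n)) (t : R) : measurable E ->
  (\int[leb]_(x in E) (w x `^ t)%:E = \int[leb]_(x in E) (posw x `^ t)%:E)%E.
Proof.
move=> mE; have := @integral_posw E (cst 1) (fun u => u `^ t) mE (measurable_cst _)
  (measurable_powR t).
by rewrite !integral_cst1M.
Qed.

(** By Jensen's inequality the s-th power of the average of w is at most the average of w^s, to
    which A_1 on the circumscribed ball applies; then take the s-th root. The factor (2 n)^n
    compares ball and cube. *)
Lemma A1_hcube (s : R) : 1 < s -> A1 (fun x => w x `^ s) -> exists C1 : R, 0 < C1 /\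
  forall (a : Rn R n) (l : R), 0 < l ->
  {ae leb, forall y, hcube a l y -> cW a l <= C1 * l ^+ n * posw y}.
Proof.
move=> s1 [_ [C HC]]; have s0 : 0 < s by exact: lt_trans s1.
pose D := (2 * n%:R) ^+ n * (`|C| + 1).
have D0 : 0 < D by rewrite mulr_gt0// ?exprn_gt0 ?mulr_gt0 ?ltr0n// ltr_wpDl.
exists (D `^ s^-1); split; first exact: powR_gt0.
move=> a l l0; have vl : 0 < l ^+ n by exact: exprn_gt0.
have M0 := cmass_gt0 lebH wdens_hcube_fin a l0.
have H1 := HC _ (balls_cball n0 a l0).
have := ess_inf_le leb (patch (cst +oo%E) (cball a l) (EFin \o (fun x => w x `^ s))).
rewrite -/(ess_inf_on _ _); set e := ess_inf_on _ _ in H1 *.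
(* A nonnegative essential infimum permits enlarging the A_1 constant, of unknown sign, to |C| +
   1. *)
have e0 : (0 <= e)%E.
  apply/ess_infP; apply: nearW => x; rewrite /patch; case: ifPn => _; last exact: leey.
  by rewrite lee_fin powR_ge0.
apply: filterS2 ae_posw => x wx ex xa.
have {ex} : (e <= (posw x `^ s)%:E)%E.
  by move: ex; rewrite /patch mem_set /= ?wx//; exact: hcube_sub_cball.
move=> ex.
have H2 : (average (fun x => w x `^ s)%R (cball a l) <= ((`|C| + 1) * posw x `^ s)%:E)%E.
  apply: (le_trans H1); apply: (@le_trans _ _ ((`|C| + 1)%:E * e)%E).
    by apply: lee_wpmul2r => //; rewrite lee_fin (le_trans (ler_norm C))// lerDl.
  by rewrite EFinM; apply: lee_wpmul2l => //; rewrite lee_fin addr_ge0.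
have B0 := leb_cball_gt0 n0 a l0.
have H3 : (\int[leb]_(y in cball a l) (w y `^ s)%:E <=
    (fine (leb (cball a l)) * ((`|C| + 1) * posw x `^ s))%:E)%E.
  have b0 : (0 <= (fine (leb (cball a l)))%:E)%E by rewrite lee_fin ltW.
  have := lee_wpmul2l b0 H2; rewrite /average muleA -!EFinM mulfV ?gt_eqF// mul1e; exact.
have H4 : (\int[leb]_(y in hcube a l) (posw y `^ s)%:E <= (D * l ^+ n * posw x `^ s)%:E)%E.
  apply: (@le_trans _ _ (\int[leb]_(y in cball a l) (posw y `^ s)%:E)%E).
    apply: ge0_subset_integral => //; first by move=> y _; rewrite lee_fin powR_ge0.
    exact: hcube_sub_cball.
  rewrite -integral_powR_posw//; apply: (le_trans H3); rewrite lee_fin.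
  rewrite [leRHS](_ : _ = ((2 * n%:R) ^+ n * l ^+ n) * ((`|C| + 1) * posw x `^ s));
    last by rewrite /D; ring.
  apply: ler_wpM2r; first by rewrite mulr_ge0 ?powR_ge0// addr_ge0.
  by rewrite -lee_fin -leb_cball_fin// leb_cball_le.
have := @integral_powR_le _ _ R leb (hcube a l) posw s (mQ a l)
  (measurable_funTS measurable_posw) (fun x _ => ltW (posw_gt0 x)) s1.
rewrite (integral_w wdens_hcube_fin) lebH// !poweR_EFin => H5.
have {H5} := le_trans H5 (lee_wpmul2r _ H4).
rewrite lee_fin powR_ge0 => /(_ isT); rewrite -EFinM lee_fin => H5.
apply: (powR_inj_le s0); first exact: ltW.
  by rewrite !mulr_ge0 ?powR_ge0 ?(ltW vl) ?(ltW (posw_gt0 x)).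
apply: (le_trans H5); apply: le_of_eq.
have [X ->] := pos_expR (posw_gt0 x); have [V ->] := pos_expR vl; have [E ->] := pos_expR D0.
by exp_field.
Qed.

(** The inequality on the circumscribed ball returns an average of w over the ball; the doubling
    supplied by A_1 brings it back to the cube. *)
Lemma reverse_Hoelder_hcube (r C1 : R) : 1 < r -> reverse_Hoelder r w -> 0 < C1 ->
  (forall (a : Rn R n) (l : R), 0 < l ->
    {ae leb, forall y, hcube a l y -> cW a l <= C1 * l ^+ n * posw y}) ->
  exists C2 : R, 0 < C2 /\ forall (a : Rn R n) (l : R), 0 < l ->
  (\int[leb]_(x in hcube a l) (posw x `^ r)%:E <=
   (C2 * l ^+ n * (cW a l / l ^+ n) `^ r)%:E)%E.
Proof.
move=> r1 [C [C0 HC]] C10 hA1; have r0 : 0 < r by exact: lt_trans r1.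
pose E := (2 * n%:R : R) ^+ n.
have E0 : 0 < E by rewrite exprn_gt0// mulr_gt0// ltr0n.
exists (E * (C * (C1 * E)) `^ r); split.
  by rewrite mulr_gt0// powR_gt0// !mulr_gt0.
move=> a l l0; have vl : 0 < l ^+ n by exact: exprn_gt0.
have M0 := cmass_gt0 lebH wdens_hcube_fin a l0.
have L0 : 0 < cside (n := n) l by exact: cside_gt0.
have B0 := leb_cball_gt0 n0 a l0.
have Bl : l ^+ n <= fine (leb (cball a l)) by rewrite -lee_fin -leb_cball_fin// leb_cball_ge.
have Bu : fine (leb (cball a l)) <= E * l ^+ n by rewrite -lee_fin -leb_cball_fin// leb_cball_le.
set b := fine (leb (cball a l)) in B0 Bl Bu.
have H1 := HC _ (balls_cball n0 a l0).
have avg : (average w (cball a l) <= (C1 * E * (cW a l / l ^+ n))%:E)%E.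
  rewrite /average -/b -/(wmeasure w _) wmeasureE//.
  apply: (@le_trans _ _ ((l ^+ n)^-1%:E * (C1 * E * cW a l)%:E)%E).
    apply: lee_pmul => //; first by rewrite lee_fin invr_ge0 ltW.
      by rewrite lee_fin lef_pV2.
    apply: (@le_trans _ _ (W (hcube (ccorner a l) (cside (n := n) l)))).
      by apply: le_measure; rewrite ?inE//; exact: cball_sub_hcube.
    rewrite (wdensE wdens_hcube_fin) lee_fin.
    apply: (le_trans (cmass_doubling lebH C10 wdens_hcube_fin hA1 l0 L0 (hcube_sub_ccube n0 l0))).
    apply: le_of_eq.
    by rewrite /cside /E mulrA exprMn mulfK// gt_eqF.
  by rewrite -EFinM lee_fin; apply: le_of_eq; ring.
have avg0 : (0 <= average (fun x => (w x `^ r)%R) (cball a l))%E.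
  rewrite mule_ge0//; first by rewrite lee_fin invr_ge0 fine_ge0.
  by apply: integral_ge0 => x _; rewrite lee_fin powR_ge0.
have H2 : (average (fun x => (w x `^ r)%R) (cball a l) `^ r^-1 <= (C * (C1 * E * (cW a l / l ^+
  n)))%:E)%E.
  by apply: (le_trans H1); rewrite EFinM; apply: lee_wpmul2l => //; rewrite lee_fin ltW.
have H3 := le_poweR (ltW r0) (poweR_ge0 _ _) H2.
rewrite -poweRrM mulVf ?gt_eqF// poweRe1// poweR_EFin in H3.
apply: (@le_trans _ _ (\int[leb]_(x in cball a l) (posw x `^ r)%:E)%E).
  apply: ge0_subset_integral => //; first by move=> y _; rewrite lee_fin powR_ge0.
  exact: hcube_sub_cball.
rewrite -integral_powR_posw//.
have -> : (\int[leb]_(x in cball a l) (w x `^ r)%:E = b%:E * average (fun x => (w x `^ r)%R) (cball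
  a l))%E.
  by rewrite /average -/b muleA -EFinM mulfV ?gt_eqF// mul1e.
apply: (@le_trans _ _ ((E * l ^+ n)%:E * ((C * (C1 * E * (cW a l / l ^+ n))) `^ r)%:E)%E).
  by apply: lee_pmul => //; rewrite lee_fin ?ltW.
rewrite -EFinM lee_fin; apply: le_of_eq.
have [M ->] := pos_expR M0; have [V ->] := pos_expR vl; have [F ->] := pos_expR E0.
have [G ->] := pos_expR C0; have [H ->] := pos_expR C10.
by exp_field.
Qed.

End weight_on_cubes.

Section transfer.
Context {R : realType} {n : nat}.
Hypothesis n0 : (0 < n)%N.
Local Notation leb := (lebesgueRn R n).
Variables (w : Rn R n -> R) (C1 : R).
Hypothesis hw : weight w.
Local Notation mw' := (measurable_posw hw).
Local Notation W := (wdens leb mw' (posw_gt0 w)).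
Local Notation cW := (cmass leb mw' (posw_gt0 w)).
Hypothesis C10 : 0 < C1.
Hypothesis hA1 : forall (a : Rn R n) (l : R), 0 < l ->
  {ae leb, forall y, hcube a l y -> cW a l <= C1 * l ^+ n * posw w y}.

Let mB a l : measurable (cball a l : set (Rn R n)). Proof. exact: measurable_cball. Qed.
Let mQ a l : measurable (hcube a l : set (Rn R n)). Proof. exact: measurable_hcube. Qed.
Let lebH a l : 0 < l -> (leb : {measure set (Rn R n) -> \bar R}) (hcube a l) = (l ^+ n)%:E.
Proof. by move=> l0; exact: lebesgueRn_hcube (ltW l0). Qed.
Let Wfin := wdens_hcube_fin n0 hw.
Let Wcube a l : W (hcube a l) = (cW a l)%:E. Proof. exact: (wdensE Wfin). Qed.
Let cW_gt0 a l : 0 < l -> 0 < cW a l. Proof. exact: (cmass_gt0 lebH Wfin). Qed.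

Let posw_ge0 x : 0 <= posw w x. Proof. exact/ltW/posw_gt0. Qed.

Let E := C1 * (2 * n%:R) ^+ n.
Let E0 : 0 < E.
Proof. by rewrite /E mulr_gt0// exprn_gt0// mulr_gt0// ltr0n. Qed.

Lemma ball_mass (a : Rn R n) (l : R) : 0 < l -> exists V : R, [/\ 0 < V,
  wmeasure w (cball a l) = V%:E, cW a l <= V,
  V <= cW (ccorner a l) (cside (n := n) l) & cW (ccorner a l) (cside (n := n) l) <= E * cW a l].
Proof.
move=> l0; have L0 : 0 < cside (n := n) l by exact: cside_gt0.
have W1 : (W (hcube a l) <= W (cball a l))%E.
  by apply: le_measure; rewrite ?inE//; exact: hcube_sub_cball.
have W2 : (W (cball a l) <= W (hcube (ccorner a l) (cside (n := n) l)))%E.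
  by apply: le_measure; rewrite ?inE//; exact: cball_sub_hcube.
have W3 : cW (ccorner a l) (cside (n := n) l) <= E * cW a l.
  apply: (le_trans (cmass_doubling lebH C10 Wfin hA1 l0 L0 (hcube_sub_ccube n0 l0))).
  apply: le_of_eq.
  by rewrite /cside /E mulrA exprMn mulfK// gt_eqF// exprn_gt0.
have Voo : W (cball a l) = (fine (W (cball a l)))%:E.
  by rewrite fineK// ge0_fin_numE//; apply: le_lt_trans W2 _; rewrite Wcube ltry.
exists (fine (W (cball a l))); rewrite wmeasureE//.
rewrite Voo Wcube lee_fin in W1; rewrite Voo Wcube lee_fin in W2.
by split => //; exact: lt_le_trans (cW_gt0 a l0) W1.
Qed.

(** The cube lies in its ball, whose mass is at most [E] times that of the cube: hence the factor
    E^(kappa/p) in the normalisation. *)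
Lemma morrey_le1_of (p kappa M : R) (f : Rn R n -> R[i]) : 1 < p -> 0 <= kappa -> 0 < M ->
  cmeasurable setT f -> (morrey_norm p kappa w w f <= M%:E)%E ->
  morrey_le1 leb mw' (posw_gt0 w) p kappa (fun x => (M * E `^ (kappa / p))^-1 * normc (f x)).
Proof.
move=> p1 k0 M0 mf hf a l l0; have p0 : 0 < p by exact: lt_trans p1.
have [V [V0 VE cV VQ QE]] := ball_mass a l0.
have VEc := le_trans VQ QE.
pose T := M * E `^ (kappa / p); have T0 : 0 < T by rewrite mulr_gt0// powR_gt0.
have mnf : measurable_fun setT (fun x => normc (f x) `^ p).
  by apply/measurable_EFinP; apply: measurable_powR_comp; exact: measurable_normc.
set I := (\int[leb]_(x in cball a l) (normc (f x) `^ p * w x)%:E)%E.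
have IE : I = (\int[leb]_(x in cball a l) (normc (f x) `^ p * posw w x)%:E)%E.
  exact: (integral_posw hw (mB a l) mnf (@measurable_id _ _ _)).
have I0 : (0 <= I)%E by rewrite IE; apply: integral_ge0 => x _; rewrite lee_fin mulr_ge0// powR_ge0.
have H1 : ((((V `^ kappa)^-1)%:E * I) `^ p^-1 <= M%:E)%E.
  apply: le_trans hf; apply: ereal_sup_ubound; exists (cball a l); first exact: balls_cball.
  by rewrite VE.
have H2 := le_poweR (ltW p0) (poweR_ge0 _ _) H1.
have vk : 0 < V `^ kappa by exact: powR_gt0.
have X0 : (0 <= ((V `^ kappa)^-1)%:E * I)%E by rewrite mule_ge0// lee_fin invr_ge0 ltW.
rewrite -poweRrM mulVf ?gt_eqF// poweRe1// poweR_EFin in H2.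
have H3 : (I <= (V `^ kappa * M `^ p)%:E)%E.
  have vk0 : (0 <= (V `^ kappa)%:E)%E by rewrite lee_fin ltW.
  by have := lee_wpmul2l vk0 H2; rewrite muleA -!EFinM mulfV ?gt_eqF// mul1e.
have mnfE D : measurable_fun D (fun x => ((T^-1 * normc (f x)) `^ p)%:E).
  apply: measurable_powR_comp; apply: measurable_funTS; apply: measurable_funM => //.
  exact: measurable_normc.
rewrite -/T integral_dens//; last by move=> x _; rewrite lee_fin powR_ge0.
have -> : (\int[leb]_(x in hcube a l) (((T^-1 * normc (f x)) `^ p)%:E * (posw w x)%:E) =
    (T `^ (- p))%:E * \int[leb]_(x in hcube a l) (normc (f x) `^ p * posw w x)%:E)%E.
  rewrite -ge0_integralZl_EFin; [|exact: mQ| | |exact: powR_ge0].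
  - apply: eq_integral => x _; rewrite -!EFinM; congr (_%:E).
    by rewrite powRM ?invr_ge0 ?normc_ge0 ?(ltW T0)// -powR_inv1 ?(ltW T0)// -powRrM mulN1r mulrA.
  - by move=> x _; rewrite lee_fin mulr_ge0// powR_ge0.
  - apply/measurable_EFinP; apply: measurable_funTS; apply: measurable_funM => //.
    exact: (measurable_posw hw).
apply: (@le_trans _ _ ((T `^ (- p))%:E * (V `^ kappa * M `^ p)%:E)%E).
  apply: lee_wpmul2l; first by rewrite lee_fin powR_ge0.
  apply: le_trans H3; rewrite IE; apply: ge0_subset_integral => //.
  - apply/measurable_EFinP; apply: measurable_funTS; apply: measurable_funM => //.
    exact: (measurable_posw hw).
  - by move=> x _; rewrite lee_fin mulr_ge0// powR_ge0.
  - exact: hcube_sub_cball.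
have c0 := cW_gt0 a l0.
rewrite -EFinM lee_fin; apply: (@le_trans _ _ (T `^ (- p) * ((E * cW a l) `^ kappa * M `^ p))).
  apply: ler_wpM2l; first exact: powR_ge0.
  by apply: ler_wpM2r; [exact: powR_ge0|apply: powR_gt0_le => //; exact: ltW].
apply: le_of_eq; rewrite /T.
have [X ->] := pos_expR M0; have [Y ->] := pos_expR E0; have [Z ->] := pos_expR c0.
by exp_field.
Qed.

(** The integral over a ball is bounded by that over the circumscribed cube, whose mass is at most
    [E] times that of the ball. *)
Lemma morrey_norm_le_of (p q kappa X : R) (g : Rn R n -> R[i]) : 0 < p -> 0 < q -> 0 <= kappa -> 0
  < X ->
  cmeasurable setT g ->
  (forall (a : Rn R n) (l : R), 0 < l ->
    (\int[wpow_dens leb mw' (q / p)]_(x in hcube a l) (normc (g x) `^ q)%:E <=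
      (X * cW a l `^ (kappa * q / p))%:E)%E) ->
  (morrey_norm q (kappa * q / p) (fun x => w x `^ (q / p))%R w g <=
    ((X * E `^ (kappa * q / p)) `^ q^-1)%:E)%E.
Proof.
move=> p0 q0 k0 X0 mg HX; apply: ge_ereal_sup => _ [B /(balls_cballP n0)[a [l [l0 ->]]] <-].
have [V [V0 VE cV VQ QE]] := ball_mass a l0.
have L0 : 0 < cside (n := n) l by exact: cside_gt0.
have t0 : 0 <= kappa * q / p by rewrite mulr_ge0 ?invr_ge0 ?mulr_ge0 ?(ltW p0) ?(ltW q0).
have vk : 0 < V `^ (kappa * q / p) by exact: powR_gt0.
have mgq : measurable_fun setT (fun x => normc (g x) `^ q).
  by apply/measurable_EFinP; apply: measurable_powR_comp; exact: measurable_normc.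
have mws : measurable_fun setT (fun x => posw w x `^ (q / p)).
  by apply/measurable_EFinP; apply: measurable_powR_comp; exact: (measurable_posw hw).
rewrite VE.
have -> : (\int[leb]_(x in cball a l) (normc (g x) `^ q * w x `^ (q / p))%:E =
    \int[wpow_dens leb mw' (q / p)]_(x in cball a l) (normc (g x) `^ q)%:E)%E.
  rewrite (integral_posw hw (mB a l) mgq (measurable_powR (q / p))) integral_dens//.
  - by apply/measurable_EFinP; exact: measurable_funTS.
  - by move=> x _; rewrite lee_fin powR_ge0.
rewrite -poweR_EFin; apply: le_poweR; first by rewrite invr_ge0 ltW.
  rewrite mule_ge0//; first by rewrite lee_fin invr_ge0 ltW.
  by apply: integral_ge0 => x _; rewrite lee_fin powR_ge0.
apply: (@le_trans _ _ ((V `^ (kappa * q / p))^-1%:E * (X * cW (ccorner a l) (cside (n := n) l) `^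
  (kappa * q / p))%:E)%E).
  apply: lee_wpmul2l; first by rewrite lee_fin invr_ge0 ltW.
  apply: le_trans (HX _ _ L0); apply: ge0_subset_integral => //.
  - by apply/measurable_EFinP; exact: measurable_funTS.
  - by move=> x _; rewrite lee_fin powR_ge0.
  - exact: cball_sub_hcube.
rewrite -EFinM lee_fin mulrC ler_pdivrMr// -[leRHS]mulrA; apply: ler_wpM2l; first exact: ltW.
rewrite -powRM; [|exact: ltW|exact: ltW]; apply: powR_gt0_le => //; first exact/ltW/cW_gt0.
by apply: (le_trans QE); rewrite ler_pM2l.
Qed.

Definition ocube (a : Rn R n) (l : R) : set (Rn R n) :=
  [set y | forall i, tnth a i < tnth y i < tnth a i + l].

Lemma measurable_ocube a l : measurable (ocube a l).
Proof.
rewrite (_ : ocube a l = \bigcap_(i in [set: 'I_n]) ((fun x : Rn R n => tnth x i) @^-1` `]tnth a i,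
  tnth a i + l[)).
  apply: fin_bigcap_measurable => // i _; rewrite -[X in measurable X]setTI.
  by apply: measurable_tnth => //; exact: measurable_itv.
apply/seteqP; split => y Hy i; first by move=> _ /=; rewrite in_itv/=; exact: Hy.
by have := Hy i Logic.I; rewrite /= in_itv.
Qed.

(** BMO is tested on open cubes, while a half-open cube contains boundary points of the open cube
    with the same corner and side. The centre is therefore the scaled mean over an open cube of side
    3 l around it, and the mass ratio C1 3^n enters the normalisation. *)
Lemma osc_le1_of (b : Rn R n -> R[i]) (N : R) : 0 < N -> bmo w b -> (bmo_norm w b <= N%:E)%E ->
  exists c, osc_le1 leb mw' (posw_gt0 w) (fun x => ((N * (C1 * 3 ^+ n))^-1)%:C%C * b x) c.
Proof.
move=> N0 [mb _ _] bN.
pose k := (N * (C1 * 3 ^+ n))^-1.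
have D0 : 0 < C1 * 3 ^+ n by rewrite mulr_gt0// exprn_gt0.
have k0 : 0 < k by rewrite invr_gt0 mulr_gt0.
pose a' (a : Rn R n) l : Rn R n := [tuple tnth a i - l | i < n].
pose O a l := ocube (a' a l) (3 * l).
exists (fun a l => k%:C%C * wmean w b (O a l)) => a l l0.
have L0 : 0 < 3 * l by rewrite mulr_gt0.
have s1 : hcube a l `<=` O a l.
  by move=> y ya i; have /andP[y1 y2] := ya i; rewrite tnth_mktuple; apply/andP; split; lra.
have s2 : O a l `<=` hcube (a' a l) (3 * l).
  by move=> y ya i; have /andP[y1 y2] := ya i; rewrite (ltW y1) y2.
have mO : measurable (O a l) by exact: measurable_ocube.
have W1 : (W (hcube a l) <= W (O a l))%E by apply: le_measure; rewrite ?inE.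
have W2 : (W (O a l) <= W (hcube (a' a l) (3 * l)))%E by apply: le_measure; rewrite ?inE.
have W3 : cW (a' a l) (3 * l) <= C1 * 3 ^+ n * cW a l.
  apply: (le_trans (cmass_doubling lebH C10 Wfin hA1 l0 L0 (subset_trans s1 s2))).
  by rewrite exprMn mulfK// gt_eqF// exprn_gt0.
have Voo : W (O a l) = (fine (W (O a l)))%:E.
  by rewrite fineK// ge0_fin_numE//; apply: le_lt_trans W2 _; rewrite Wcube ltry.
have VE : wmeasure w (O a l) = (fine (W (O a l)))%:E by rewrite wmeasureE.
set V := fine (W (O a l)) in Voo VE.
rewrite Voo Wcube lee_fin in W1; rewrite Voo Wcube lee_fin in W2.
have V0 : 0 < V by exact: lt_le_trans (cW_gt0 a l0) W1.
set z := wmean w b (O a l).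
have mbz : measurable_fun setT (fun x => normc (b x - z)).
  by apply: measurable_normc => //; exact: cmeasurable_subr.
have H1 : ((V^-1)%:E * \int[leb]_(x in O a l) (normc (b x - z) * w x)%:E <= N%:E)%E.
  apply: le_trans bN; apply: ereal_sup_ubound; exists (O a l); last by rewrite VE.
  by exists (a' a l), (3 * l).
have mbw (D : set (Rn R n)) : measurable_fun D (fun x => (normc (b x - z) * posw w x)%:E).
  by apply/measurable_EFinP; apply: measurable_funTS; apply: measurable_funM => //;
    exact: (measurable_posw hw).
rewrite (integral_posw hw mO mbz (@measurable_id _ _ _)) in H1.
have H2 : (\int[leb]_(x in O a l) (normc (b x - z) * posw w x)%:E <= (V * N)%:E)%E.
  have v0 : (0 <= V%:E)%E by rewrite lee_fin ltW.
  by have := lee_wpmul2l v0 H1; rewrite muleA -!EFinM mulfV ?gt_eqF// mul1e.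
rewrite integral_dens//; last 2 first.
- apply/measurable_EFinP; apply: measurable_funTS; apply: measurable_normc => //.
  apply: cmeasurable_subr; apply: cmeasurableM => //; exact: cmeasurable_cst.
- by move=> x _; rewrite lee_fin normc_ge0.
have -> : (\int[leb]_(x in hcube a l) ((normc ((k%:C)%C * b x - (k%:C)%C * z))%:E * (posw w x)%:E) =
   k%:E * \int[leb]_(x in hcube a l) (normc (b x - z) * posw w x)%:E)%E.
  rewrite -ge0_integralZl_EFin ?(ltW k0)//; last by move=> x _;
    rewrite lee_fin mulr_ge0// normc_ge0.
  by apply: eq_integral => x _; rewrite -mulrBr normcM normcC gtr0_norm// -!EFinM mulrA.
apply: (@le_trans _ _ (k%:E * (V * N)%:E)%E).
  apply: lee_wpmul2l; first by rewrite lee_fin ltW.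
  by apply: le_trans H2; apply: ge0_subset_integral => // x _; rewrite lee_fin mulr_ge0// normc_ge0.
rewrite Wcube -EFinM lee_fin /k ler_pdivrMl ?mulr_gt0//.
rewrite [leLHS]mulrC -mulrA ler_pM2l//.
exact: le_trans W2 W3.
Qed.

End transfer.

Lemma poweR_sum_le {R : realType} (u : nat -> \bar R) m (t : R) : 0 < t ->
  (forall j, (0 <= u j)%E) ->
  ((\sum_(j < m) u j) `^ t <= ((2 `^ t) ^+ m)%:E * \sum_(j < m) (u j `^ t))%E.
Proof.
move=> t0 u0; elim: m => [|m IH].
  by rewrite !big_ord0 mule0 -[X in (X `^ _)%E]/(0%:E) poweR_EFin powR0// gt_eqF.
rewrite !big_ord_recr /=.
have s0 : (0 <= \sum_(j < m) u j)%E by exact: sume_ge0.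
have s1 : (0 <= \sum_(j < m) u j `^ t)%E by apply: sume_ge0 => j _; exact: poweR_ge0.
have c0 : (0 <= (2 `^ t)%:E)%E by rewrite lee_fin powR_ge0.
have c1 : 1 <= 2 `^ t by rewrite -[leLHS](powRr0 2); apply: ler_powR; [rewrite ler1n|exact: ltW].
apply: (le_trans (poweR_addr_le (ltW t0) s0 (u0 m))).
rewrite exprS EFinM -muleA; apply: lee_wpmul2l => //.
rewrite ge0_muleDr//; last exact: poweR_ge0.
apply: leeD => //; rewrite -[leLHS]mul1e; apply: lee_wpmul2r; first exact: poweR_ge0.
by rewrite lee_fin exprn_ege1.
Qed.

(** The product is at most the m-th power of its largest factor, and that power is one of the
    summands. *)
Lemma prod_le_sum_expr {R : realDomainType} m (a : 'I_m -> R) : (0 < m)%N ->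
  (forall j, 0 <= a j) -> \prod_(j < m) a j <= \sum_(j < m) a j ^+ m.
Proof.
move=> m0 a0; pose i0 := Ordinal m0.
have [i _ Hi] := @Order.TotalTheory.arg_maxP _ _ 'I_m i0 xpredT a isT.
apply: (@le_trans _ _ (\prod_(j < m) a i)).
  by apply: ler_prod => j _; rewrite a0; exact: Hi.
by rewrite prodr_const card_ord (bigD1 i)//= lerDl sumr_ge0// => j _; rewrite exprn_ge0.
Qed.

(* Letting e tend to 0 recovers the bound with the norms themselves, which may vanish. *)
Lemma ereal_le_prod_limit {R : realType} m (K u : R) (v : 'I_m -> R) (z : \bar R) :
  (forall e, 0 < e -> (z <= (K * \prod_(j < m) (v j + e) * (u + e))%:E)%E) ->
  (z <= (K * \prod_(j < m) v j * u)%:E)%E.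
Proof.
(* The bound is a polynomial in e, so continuity of polynomials at 0 gives the limit. *)
move=> H; pose P : {poly R} := K%:P * \prod_(j < m) ((v j)%:P + 'X) * (u%:P + 'X).
have PE e : P.[e] = K * \prod_(j < m) (v j + e) * (u + e).
  rewrite /P !hornerE horner_prod; congr (_ * _ * _).
  by apply: eq_bigr => j _; rewrite !hornerE.
have P0 : P.[0] = K * \prod_(j < m) v j * u.
  by rewrite PE addr0; congr (_ * _ * _); apply: eq_bigr => j _; rewrite addr0.
rewrite -P0; apply/lee_addgt0Pr => d d0; rewrite -EFinD.
have /cvgrPdist_lt/(_ d d0) := @continuous_horner R P 0.
move=> [r /= r0 Hr]; pose e := r / 2.
have e0 : 0 < e by rewrite divr_gt0.
have := Hr e; rewrite /= sub0r normrN gtr0_norm// => /(_ _)/ltr_normlP[].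
  by rewrite ltr_pdivrMr// mulr_natr mulr2n ltrDl.
move=> {}Hr _; apply: (le_trans (H e e0)); rewrite -PE lee_fin.
by move: Hr; rewrite opprB ltrBlDl => /ltW.
Qed.

(** * Normalisation, almost everywhere convergence and the norm bound *)

Section main_estimate.
Context {R : realType} {n : nat}.
Hypothesis n0 : (0 < n)%N.
Local Notation leb := (lebesgueRn R n).
Variables (w : Rn R n -> R) (p q alpha kappa C1 C2 r : R).
Hypothesis hw : weight w.
Local Notation mw' := (measurable_posw hw).
Local Notation W := (wdens leb mw' (posw_gt0 w)).
Local Notation cW := (cmass leb mw' (posw_gt0 w)).
Local Notation s := (q / p).
Local Notation Sg := (wpow_dens leb mw' s).
Hypotheses (C10 : 0 < C1) (C20 : 0 < C2).
Hypothesis hA1 : forall (a : Rn R n) (l : R), 0 < l ->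
  {ae leb, forall y, hcube a l y -> cW a l <= C1 * l ^+ n * posw w y}.
Hypothesis hRH : forall (a : Rn R n) (l : R), 0 < l ->
  (\int[leb]_(x in hcube a l) (posw w x `^ r)%:E <=
   (C2 * l ^+ n * (cW a l / l ^+ n) `^ r)%:E)%E.
Hypotheses (p1 : 1 < p) (pq : p < q) (qE : q^-1 = p^-1 - alpha / n%:R).
Hypotheses (sr : s < r) (alpha_lt : alpha < n%:R).
Hypotheses (kappa0 : 0 <= kappa) (kappa_lt : kappa < p / q)
  (kappa_r : (1 - kappa) / (p / q - kappa) < r).

Let lebH a l : 0 < l -> (leb : {measure set (Rn R n) -> \bar R}) (hcube a l) = (l ^+ n)%:E.
Proof. by move=> l0; exact: lebesgueRn_hcube (ltW l0). Qed.
Let Wfin := wdens_hcube_fin n0 hw.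
Let p0 : 0 < p. Proof. exact: lt_trans p1. Qed.
Let q0 : 0 < q. Proof. exact: lt_trans pq. Qed.
Let s1 : 1 < s. Proof. by rewrite ltr_pdivlMr// mul1r. Qed.
Let mQ a l : measurable (hcube a l : set (Rn R n)). Proof. exact: measurable_hcube. Qed.

Lemma osc_kop_le m : (0 < m)%N -> exists C, 0 < C /\ forall b c (f : Rn R n -> R),
  cmeasurable setT b -> osc_le1 leb mw' (posw_gt0 w) b c ->
  measurable_fun setT f -> (forall x, 0 <= f x) -> morrey_le1 leb mw' (posw_gt0 w) p kappa f ->
  forall (a : Rn R n) (l : R), 0 < l ->
  (\int[Sg]_(x in hcube a l) (kop leb alpha (osc_kernel m b) f x `^ q) <=
    (C * cW a l `^ (kappa * q / p))%:E)%E.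
Proof.
move=> m0.
have [A [Cb [A0 Cb0 adm]]] := admissible_osc lebH C10 C20 s1 sr Wfin hA1 hRH m0.
have [C [C0 HC]] := kop_morrey_le n0 lebH p1 pq qE C10 C20 sr Wfin hA1 hRH alpha_lt
  kappa0 kappa_lt kappa_r A0 (ler0n R m) Cb0.
by exists C; split => // b c f mb osc mf f0 fm a l l0; exact: HC (adm b c mb osc) mf f0 fm a l l0.
Qed.

(** F^q w^s is integrable on each cube of an exhaustion, hence finite almost everywhere; as w^s > 0,
    so is F. *)
Lemma ae_lty_of_cubes (F : Rn R n -> \bar R) (X : Rn R n -> R -> R) :
  measurable_fun setT F -> (forall x, 0 <= F x)%E ->
  (forall (a : Rn R n) (l : R), 0 < l ->
    (\int[Sg]_(x in hcube a l) (F x `^ q) <= (X a l)%:E)%E) ->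
  {ae leb, forall x, (F x < +oo)%E}.
Proof.
move=> mF F0 HX; pose a : Rn R n := [tuple 0 | i < n].
pose Q k := hcube (dilc k a 1) (dils k 1).
have mFq : measurable_fun setT (fun x => F x `^ q)%E.
  exact: (measurableT_comp (measurable_poweR q)).
have mws : measurable_fun setT (fun x => posw w x `^ s).
  by apply/measurable_EFinP; apply: measurable_powR_comp; exact: (measurable_posw hw).
have H k : {ae leb, forall x, Q k x -> (F x < +oo)%E}.
  have L0 : 0 < dils k 1 :> R by exact: dils_gt0.
  have := HX (dilc k a 1) _ L0; rewrite integral_dens; last 3 first.
  - exact: mQ.
  - exact: measurable_funTS.
  - by move=> x _; exact: poweR_ge0.
  move=> Hk.
  have int : leb.-integrable (Q k) (fun x => F x `^ q * (posw w x `^ s)%:E)%E.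
    apply/integrableP; split.
      apply: measurable_funTS; apply: emeasurable_funM => //; exact/measurable_EFinP.
    under eq_integral do rewrite gee0_abs ?mule_ge0 ?poweR_ge0 ?lee_fin ?powR_ge0//.
    by apply: le_lt_trans Hk _; rewrite ltry.
  have := integrable_ae (mQ _ _) int; apply: filterS => x Hx Qx.
  have := Hx Qx; have := F0 x; case: (F x) => [u _ _| _|//]; first by rewrite ltry.
  have w0 : (0 < (posw w x `^ s)%:E)%E by rewrite lte_fin powR_gt0 ?posw_gt0.
  by rewrite poweRyr ?gt_eqF// gt0_mulye.
have := ae_foralln H; apply: filterS => x Hx.
have : [set: Rn R n] x by []; rewrite -(dil_cover a ltr01) => -[k _ Qx].
exact: Hx k Qx.
Qed.

(** [N j] and [M] are positive upper bounds of the norms, so that one may divide by them. Both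
    conclusions come from the m positive operators attached to the normalised b_j. *)
Lemma commutator_bound m Ck : (0 < m)%N -> 0 < Ck -> exists K, 0 < K /\
  forall (b : m.-tuple (Rn R n -> R[i])) (f : Rn R n -> R[i]) (N : 'I_m -> R) (M : R),
  (forall j, bmo w (tnth b j)) -> (forall j, 0 < N j) ->
  (forall j, (bmo_norm w (tnth b j) <= (N j)%:E)%E) ->
  0 < M -> cmeasurable setT f -> (morrey_norm p kappa w w f <= M%:E)%E ->
  {ae leb, forall x, (riesz alpha (fun y => (prodN b y)%:C%C * f y)%R x < +oo)%E} /\
  forall g, cmeasurable setT g -> (forall x, ((normc (g x))%:E <=
      Ck%:E * \int[leb]_y (\prod_(b' <- b) normc (b' x - b' y) * normc (f y) *
        edist x y `^ (alpha - n%:R))%:E)%E) ->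
  (morrey_norm q (kappa * q / p) (fun x => w x `^ s)%R w g <= (K * \prod_(j < m) N j * M)%:E)%E.
Proof.
move=> m0 Ck0.
have [Cm [Cm0 HCm]] := osc_kop_le m0.
pose D := C1 * 3 ^+ n; have D0 : 0 < D by rewrite mulr_gt0// exprn_gt0.
pose E := C1 * (2 * n%:R) ^+ n.
have E0 : 0 < E by rewrite mulr_gt0// exprn_gt0// mulr_gt0// ltr0n.
pose Y := (2 `^ q) ^+ m * (m%:R * Cm).
have Y0 : 0 < Y by rewrite mulr_gt0 ?exprn_gt0 ?powR_gt0// mulr_gt0// ltr0n.
exists (Ck * D ^+ m * E `^ (kappa / p) * (Y * E `^ (kappa * q / p)) `^ q^-1).
split; first by rewrite !mulr_gt0 ?exprn_gt0 ?powR_gt0// mulr_gt0 ?powR_gt0.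
move=> b f N M hb N0 bN M0 mf fM.
(* [lam j] and [T] are the divisors of [osc_le1_of] and [morrey_le1_of]: after division, the
   oscillation and the Morrey bound on cubes are at most 1. *)
pose lam j := N j * D; have lam0 j : 0 < lam j by rewrite mulr_gt0.
pose T := M * E `^ (kappa / p); have T0 : 0 < T by rewrite mulr_gt0// powR_gt0.
pose bt j (x : Rn R n) : R[i] := ((lam j)^-1)%:C%C * tnth b j x.
pose ft x := T^-1 * normc (f x).
have mb j : cmeasurable setT (tnth b j) by case: (hb j).
have mbt j : cmeasurable setT (bt j) by apply: cmeasurableM => //; exact: cmeasurable_cst.
have mft : measurable_fun setT ft by apply: measurable_funM => //; exact: measurable_normc.
have ft0 x : 0 <= ft x by rewrite mulr_ge0 ?normc_ge0// invr_ge0 ltW.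
have fm : morrey_le1 leb mw' (posw_gt0 w) p kappa ft.
  exact: (@morrey_le1_of _ _ n0 w C1 hw C10 hA1 p kappa M f p1 kappa0 M0 mf fM).
have oscj j : exists c, osc_le1 leb mw' (posw_gt0 w) (bt j) c.
  exact: (@osc_le1_of _ _ n0 w C1 hw C10 hA1 (tnth b j) (N j) (N0 j) (hb j) (bN j)).
pose k j := kop leb alpha (osc_kernel m (bt j)) ft.
have Hk j (a : Rn R n) (l : R) : 0 < l ->
    (\int[Sg]_(x in hcube a l) (k j x `^ q) <= (Cm * cW a l `^ (kappa * q / p))%:E)%E.
  move=> l0; have [c osc] := oscj j.
  exact: HCm (bt j) c ft (mbt j) osc mft ft0 fm a l l0.
have mK j : measurable_fun setT (fun z : Rn R n * Rn R n => osc_kernel m (bt j) z.1 z.2).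
  exact: measurable_osc_kernel.
have K0 j x y : 0 <= osc_kernel m (bt j) x y by rewrite addr_ge0// exprn_ge0// normc_ge0.
have mk j : measurable_fun setT (k j) by exact: measurable_kop.
have ker0 j x y : 0 <= osc_kernel m (bt j) x y * ft y * edist x y `^ (alpha - n%:R).
  exact: (mulr_ge0 (mulr_ge0 (K0 j x y) (ft0 y)) (powR_ge0 _ _)).
have k0 j x : (0 <= k j x)%E.
  by apply: integral_ge0 => y _; rewrite lee_fin; exact: ker0.
have bE j x y : normc (tnth b j x - tnth b j y) = lam j * normc (bt j x - bt j y).
  rewrite /bt -mulrBr normcM normcC gtr0_norm ?invr_gt0// mulrA mulfV ?mul1r// gt_eqF//.
have fE y : normc (f y) = T * ft y by rewrite /ft mulrA mulfV ?mul1r// gt_eqF.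
have mker j x : measurable_fun setT (fun y => (osc_kernel m (bt j) x y * ft y * edist x y `^ (alpha
  - n%:R))%:E).
  exact: measurable_kop_section.
(* Shared by both conclusions: F is 1 + |b_j| multiplied over j for finiteness, and the product of
   the differences for the norm bound. The coefficients may depend on x, which is fixed. *)
have sum_le x (H : 'I_m -> R) (F : Rn R n -> R) : (forall j, 0 <= H j) ->
    measurable_fun setT F -> (forall y, 0 <= F y) ->
    (forall y, F y <= \sum_(j < m) H j * osc_kernel m (bt j) x y) ->
    (\int[leb]_y (F y * normc (f y) * edist x y `^ (alpha - n%:R))%:E <=
      \sum_(j < m) ((T * H j)%:E * k j x))%E.
  move=> H0 mF F0 HF.
  rewrite /k /kop (eq_bigr (fun j => \int[leb]_y ((T * H j)%:E * (osc_kernel m (bt j) x y * ft y *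
    edist x y `^ (alpha - n%:R))%:E)))%E; last first.
    move=> j _; rewrite ge0_integralZl_EFin//; last by rewrite mulr_ge0// ltW.
    by move=> y _; rewrite lee_fin; exact: ker0.
  rewrite -ge0_integral_sum//; last 2 first.
  - by move=> j; apply: measurable_funeM; exact: mker.
  - move=> j y _; rewrite mule_ge0// lee_fin; last exact: ker0.
    by rewrite mulr_ge0// ltW.
  apply: ge0_le_integral => //.
  - by move=> y _; rewrite lee_fin !mulr_ge0 ?powR_ge0 ?normc_ge0.
  - apply/measurable_EFinP; apply: measurable_funM; last first.
      apply: (measurableT_comp (f := fun t : R => t `^ (alpha - n%:R)));
        first exact: measurable_powR.
      apply: (measurableT_comp (f := fun z : Rn R n * Rn R n => edist z.1 z.2) (g := fun y => (x,
        y))).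
        exact: measurable_edist.
      exact: pair1_measurable.
    by apply: measurable_funM => //; exact: measurable_normc.
  - by apply: emeasurable_sum => j; apply: measurable_funeM; exact: mker.
  move=> y _; under eq_bigr do rewrite -EFinM.
  rewrite sumEFin lee_fin fE.
  apply: (@le_trans _ _ ((\sum_(j < m) H j * osc_kernel m (bt j) x y) * (T * ft y) * edist x y `^
    (alpha - n%:R))).
    by apply: ler_wpM2r; [exact: powR_ge0|apply: ler_wpM2r => //; rewrite mulr_ge0// ltW].
  apply: le_of_eq; rewrite -mulrA mulr_suml; apply: eq_bigr => j _; ring.
split.
  (* Indexed by [nat], with 0 beyond m, to intersect countably many sets of full measure. *)
  pose kn (i : nat) x := if insub i is Some j then k j x else 0%E.
  have : {ae leb, forall x (i : nat), (kn i x < +oo)%E}.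
    apply: ae_foralln => j; rewrite /kn; case: insub => [j'|]; last exact: nearW.
    exact: (ae_lty_of_cubes (mk j') (k0 j') (Hk j')).
  apply: filterS => x Hx.
  have {}Hx j : (k j x < +oo)%E by have := Hx j; rewrite /kn valK.
  (* From 1 + |b_j(y)| <= (1 + |b_j(x)| + lam_j)(1 + d), with d the normalised difference, and (1 +
     d)^m <= 3^m (1 + d^m). Dependence on x is harmless, since only finiteness at x is sought. *)
  pose H j := (1 + normc (tnth b j x) + lam j) ^+ m * 3 ^+ m.
  have H0 j : 0 <= H j.
    by rewrite mulr_ge0 ?exprn_ge0// !addr_ge0 ?normc_ge0// ltW.
  apply: (@le_lt_trans _ _ (\sum_(j < m) ((T * H j)%:E * k j x))%E); last first.
    apply: lte_sum_pinfty => j _; apply: lte_mul_pinfty => //.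
    by rewrite lee_fin mulr_ge0// ltW.
  rewrite /riesz (eq_integral (fun y => (prodN b y * normc (f y) * edist x y `^ (alpha -
    n%:R))%:E)); last first.
    by move=> y _; rewrite normcM normcC ger0_norm// (le_trans ler01)// prodN_ge1.
  apply: sum_le => //.
  - apply: cmeasurable_prodN => i; case: (ltnP i m) => im; last first.
      by rewrite nth_default ?size_tuple//; exact: cmeasurable_cst.
    by rewrite -(tnth_nth (fun=> 0) b (Ordinal im)).
  - by move=> y; rewrite (le_trans ler01)// prodN_ge1.
  move=> y; rewrite /prodN big_tuple.
  apply: (le_trans (prod_le_sum_expr m0 _)) => [j|]; first by rewrite addr_ge0// normc_ge0.
  apply: ler_sum => j _; rewrite /H -mulrA.
  set d := normc (bt j x - bt j y); have d0 : 0 <= d by exact: normc_ge0.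
  apply: (@le_trans _ _ (((1 + normc (tnth b j x) + lam j) * (1 + d)) ^+ m)).
    rewrite lerXn2r// ?nnegrE ?mulr_ge0 ?addr_ge0 ?normc_ge0 ?(ltW (lam0 j))//.
    have H1 : normc (tnth b j y) <= normc (tnth b j x) + lam j * d.
      have := normc_triangle (tnth b j x) (tnth b j y) 0.
      by rewrite !subr0 normc_distC bE addrC.
    have := normc_ge0 (tnth b j x); have := ltW (lam0 j).
    move: H1; set u := normc _; set v := normc _ => H1 l0 v0.
    by have := mulr_ge0 v0 d0; have := mulr_ge0 l0 d0; lra.
  rewrite exprMn; apply: ler_wpM2l; first by rewrite exprn_ge0// !addr_ge0 ?normc_ge0// ltW.
  have := exprD3_le m (@ler01 R) d0 (lexx 0).
  by rewrite addr0 expr1n expr0n (gtn_eqF m0) addr0.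
move=> g mg gle.
pose L := \prod_(j < m) lam j; have L0 : 0 < L by exact: prodr_gt0.
have gk x : ((normc (g x))%:E <= (Ck * L * T)%:E * \sum_(j < m) k j x)%E.
  apply: (le_trans (gle x)); rewrite -mulrA EFinM -muleA; apply: lee_wpmul2l.
    by rewrite lee_fin ltW.
  apply: (@le_trans _ _ (\sum_(j < m) ((T * L)%:E * k j x))%E); last first.
    by rewrite ge0_sume_distrr// [L * T]mulrC.
  apply: sum_le => [|||y].
  - by move=> _; exact: ltW.
  - rewrite (_ : (fun _ => _) = (fun y => normc (\prod_(b' <- b) (b' x - b' y)))); last first.
      by apply/funext => y; rewrite normc_prod.
    apply: measurable_normc => //; apply: cmeasurable_prodB_section => i; case: (ltnP i m) => im;
      last first.
      by rewrite nth_default ?size_tuple//; exact: cmeasurable_cst.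
    by rewrite -(tnth_nth (fun=> 0) b (Ordinal im)).
  - by move=> y; apply: prodr_ge0 => b' _; exact: normc_ge0.
  rewrite big_tuple (eq_bigr (fun j => lam j * normc (bt j x - bt j y))); last by move=> j _;
    exact: bE.
  rewrite big_split /= -/L -mulr_sumr; apply: ler_wpM2l; first exact: ltW.
  apply: (le_trans (prod_le_sum_expr m0 _)) => [j|]; first exact: normc_ge0.
  by apply: ler_sum => j _; rewrite lerDr.
have [Z [Z0 ZE]] : exists Z, 0 < Z /\ Z = Ck * L * T.
  by exists (Ck * L * T); split => //; exact: (mulr_gt0 (mulr_gt0 Ck0 L0) T0).
rewrite -ZE in gk.
have mkq j : measurable_fun setT (fun x => k j x `^ q)%E.
  exact: (measurableT_comp (measurable_poweR q)).
have HX (a : Rn R n) (l : R) : 0 < l ->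
    (\int[Sg]_(x in hcube a l) (normc (g x) `^ q)%:E <= (Z `^ q * Y * cW a l `^ (kappa * q /
      p))%:E)%E.
  move=> l0; pose V := cW a l `^ (kappa * q / p).
  apply: (@le_trans _ _ (\int[Sg]_(x in hcube a l) ((Z `^ q * (2 `^ q) ^+ m)%:E * \sum_(j < m) (k j
    x `^ q)))%E).
    apply: ge0_le_integral => //.
    - by move=> x _; rewrite lee_fin powR_ge0.
    - by apply: measurable_powR_comp; apply: measurable_funTS; exact: measurable_normc.
    - by apply: measurable_funTS; apply: measurable_funeM; apply: emeasurable_sum.
    move=> x _; rewrite -poweR_EFin.
    have s0 : (0 <= \sum_(j < m) k j x)%E by exact: sume_ge0.
    apply: (le_trans (le_poweR (ltW q0) _ (gk x))); first by rewrite lee_fin normc_ge0.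
    rewrite poweRM//; last by rewrite lee_fin ltW.
    rewrite poweR_EFin EFinM -muleA; apply: lee_wpmul2l; first by rewrite lee_fin powR_ge0.
    pose u i := if insub i is Some j then k j x else 0%E.
    have uE (j : 'I_m) : u j = k j x by rewrite /u valK.
    have := @poweR_sum_le R u m q q0; under eq_bigr do rewrite uE;
      under [X in (_ <= _ * X)%E]eq_bigr do rewrite uE.
    by apply=> i; rewrite /u; case: insub.
  rewrite ge0_integralZl_EFin//; last 3 first.
  - by move=> x _; apply: sume_ge0 => j _; exact: poweR_ge0.
  - by apply: measurable_funTS; exact: emeasurable_sum.
  - by rewrite mulr_ge0 ?powR_ge0// exprn_ge0// powR_ge0.
  rewrite ge0_integral_sum//; last 2 first.
  - by move=> j; exact: measurable_funTS.
  - by move=> j x _; exact: poweR_ge0.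
  apply: (@le_trans _ _ ((Z `^ q * (2 `^ q) ^+ m)%:E * \sum_(j < m) (Cm * V)%:E)%E).
    apply: lee_wpmul2l; first by rewrite lee_fin mulr_ge0 ?powR_ge0// exprn_ge0// powR_ge0.
    by apply: lee_sum => j _; exact: Hk.
  rewrite sumEFin -EFinM lee_fin; apply: le_of_eq.
  rewrite (_ : \sum_(_ < m) Cm * V = m%:R * (Cm * V));
    last by rewrite big_const_ord iter_addr_0 mulr_natl.
  by rewrite /Y /V; ring.
have XY0 : 0 < Z `^ q * Y by rewrite mulr_gt0 ?powR_gt0.
apply: (le_trans (@morrey_norm_le_of _ _ n0 w C1 hw C10 hA1 p q kappa _ g p0 q0 kappa0 XY0 mg HX)).
rewrite lee_fin -/E; apply: le_of_eq.
rewrite -mulrA powRM ?powR_ge0//; last by rewrite mulr_ge0 ?powR_ge0// ltW.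
rewrite -powRrM mulfV ?gt_eqF// powRr1 ?(ltW Z0)// ZE /T /L /lam big_split /=.
by rewrite prodr_const card_ord; ring.
Qed.

End main_estimate.

Section nonnegative_norms.
Context {R : realType} {n : nat}.
Implicit Types (w u v : Rn R n -> R) (f b : Rn R n -> R[i]).

Lemma morrey_norm_ge0 (p kappa : R) u v f : (0 <= morrey_norm p kappa u v f)%E.
Proof.
pose x0 : Rn R n := [tuple 0 | i < n].
apply: (@le_trans _ _ ((((fine (wmeasure v (eball x0 1)) `^ kappa)^-1)%:E *
    \int[lebesgueRn R n]_(x in eball x0 1) (normc (f x) `^ p * u x)%:E) `^ p^-1)%E).
  exact: poweR_ge0.
by apply: ereal_sup_ubound; exists (eball x0 1) => //; exists x0, 1.
Qed.

Lemma bmo_norm_ge0 w b : weight w -> cmeasurable setT b -> (0 <= bmo_norm w b)%E.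
Proof.
move=> hw mb; pose x0 : Rn R n := [tuple 0 | i < n].
pose Q := ocube x0 1; have mQ : measurable Q by exact: measurable_ocube.
apply: (@le_trans _ _ (((fine (wmeasure w Q))^-1)%:E *
    \int[lebesgueRn R n]_(x in Q) (normc (b x - wmean w b Q) * w x)%:E)%E).
  apply: mule_ge0; first by rewrite lee_fin (wmeasureE hw mQ) invr_ge0 fine_ge0.
  have mbz : measurable_fun setT (fun x => normc (b x - wmean w b Q)).
    by apply: measurable_normc => //; exact: cmeasurable_subr.
  rewrite (integral_posw hw mQ mbz (@measurable_id _ _ _)); apply: integral_ge0 => x _.
  by rewrite lee_fin mulr_ge0 ?normc_ge0// ltW// posw_gt0.
by apply: ereal_sup_ubound; exists Q => //; exists x0, 1.
Qed.

End nonnegative_norms.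

Theorem theorem1p1 (R : realType) (n : nat)
  (L : @operatorL2 R n) (theta : R)
  (S : R[i] -> (Rn R n -> R[i]) -> (Rn R n -> R[i]))
  (pt : R -> Rn R n -> Rn R n -> R[i]) (C0 c : R)
  (alpha p q kappa : R) (w : Rn R n -> R) (m : nat)
  (hL : linear_operatorL2 L)
  (hS : analytic_semigroup theta S)
  (hLS : generates L S)
  (hpt : semigroup_kernel pt S)
  (hC0 : 0 < C0) (hc : 0 < c)
  (hGauss : Gaussian_bound C0 c pt)
  (halpha : 0 < alpha < n%:R)
  (hp : 1 < p < n%:R / alpha)
  (hq : q^-1 = p^-1 - alpha / n%:R)
  (hkappa : 0 <= kappa < p / q)
  (hw : weight w)
  (hwA1 : A1 (fun x => w x `^ (q / p)))
  (hrw : (((1 - kappa) / (p / q - kappa))%:E < critical_index w)%E)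
  (hm : (1 <= m)%N) :
  exists C : R, 0 < C /\
    forall b : m.-tuple (Rn R n -> R[i]),
    (forall j : 'I_m, bmo w (tnth b j)) ->
    forall f : Rn R n -> R[i], morrey p kappa w w f ->
    exists g : Rn R n -> R[i],
      [/\ cmeasurable setT g,
          {ae lebesgueRn R n, forall x,
             multi_commutator b (fractional_integral pt alpha) f x
             = Some (g x)} &
          (morrey_norm q (kappa * q / p) (fun x => w x `^ (q / p))%R w g
           <= C%:E * (\big[mule/1]_(j < m) bmo_norm w (tnth b j))
                   * morrey_norm p kappa w w f)%E].
Proof.
have /andP[alpha0 alpha_lt] := halpha.
have /andP[p1 pa] := hp; have /andP[kappa0 kappa_lt] := hkappa.
have p0 : 0 < p by exact: lt_trans p1.
have N0 : 0 < n%:R :> R by exact: lt_trans alpha_lt.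
have n0 : (0 < n)%N by move: N0; rewrite ltr0n.
(* This is the hypothesis p < n / alpha; it yields q > 0 and then q > p. *)
have qi : 0 < q^-1.
  by rewrite hq subr_gt0 ltr_pdivrMr// [ltRHS]mulrC ltr_pdivlMr// [ltLHS]mulrC -ltr_pdivlMr.
have q0 : 0 < q by rewrite -invr_gt0.
have pq : p < q.
  by rewrite -(ltf_pV2 (x := q)) ?posrE// hq gtrBl divr_gt0.
have s1 : 1 < q / p by rewrite ltr_pdivlMr// mul1r.
have pk : 0 < p / q - kappa by rewrite subr_gt0.
(* The supremum r_w need not be attained, so a reverse Hoelder exponent strictly above the threshold
   is taken. *)
have [_ [r [r1 hr] <-]] := ereal_sup_gt hrw; rewrite lte_fin => kappa_r.
(* The threshold is at least q/p: (q/p)(p/q - kappa) = 1 - kappa q/p <= 1 - kappa, because q/p >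
   1. *)
have sr : q / p < r.
  apply: le_lt_trans kappa_r; rewrite ler_pdivlMr// mulrBr.
  rewrite (_ : q / p * (p / q) = 1); last by field; rewrite !gt_eqF.
  by rewrite lerD2l lerN2 ler_peMl// ltW.
have [C1 [C10 hA1]] := A1_hcube n0 hw s1 hwA1.
have [C2 [C20 hRH]] := reverse_Hoelder_hcube n0 r1 hr C10 hA1.
have [Ck [Ck0 HCk]] := multi_commutator_le hpt.1 hC0 hc hGauss alpha0 alpha_lt.
have [K [K0 HK]] := commutator_bound n0 C10 C20 hA1 hRH p1 pq hq sr alpha_lt
  kappa0 kappa_lt kappa_r hm Ck0.
exists K; split => // b hb f [mf foo].
have mbs : cmeasurable_seq b.
  move=> i; case: (ltnP i m) => im; last first.
    by rewrite nth_default ?size_tuple//; exact: cmeasurable_cst.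
  by rewrite -(tnth_nth (fun=> 0) b (Ordinal im)); case: (hb (Ordinal im)).
(* [g] is fixed before any perturbation of the norms, so one function serves for every e. *)
have [g [mg gE gle]] := HCk b f mbs mf.
pose nu j := fine (bmo_norm w (tnth b j)); pose mu := fine (morrey_norm p kappa w w f).
have nuE j : bmo_norm w (tnth b j) = (nu j)%:E.
  have [mb _ boo] := hb j; rewrite fineK// ge0_fin_numE//.
  exact: bmo_norm_ge0.
have muE : morrey_norm p kappa w w f = mu%:E.
  by rewrite fineK// ge0_fin_numE// morrey_norm_ge0.
have nu0 j : 0 <= nu j.
  by rewrite -lee_fin -nuE; apply: bmo_norm_ge0 => //; case: (hb j).
have mu0 : 0 <= mu by rewrite -lee_fin -muE morrey_norm_ge0.
(* Adding e makes the bounds positive even where a norm vanishes, as [commutator_bound] requires. *)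
have H e : 0 < e ->
    {ae lebesgueRn R n, forall x, (riesz alpha (fun y => (prodN b y)%:C%C * f y)%R x < +oo)%E} /\
    (morrey_norm q (kappa * q / p) (fun x => w x `^ (q / p))%R w g
      <= (K * \prod_(j < m) (nu j + e) * (mu + e))%:E)%E.
  move=> e0; have [||||||fin bound] := HK b f (fun j => nu j + e) (mu + e) => //.
  - by move=> j; rewrite ltr_wpDl.
  - by move=> j; rewrite nuE lee_fin lerDl ltW.
  - by rewrite ltr_wpDl.
  - by rewrite muE lee_fin lerDl ltW.
  - by split => //; exact: bound.
exists g; split => //.
- by have [fin _] := H 1 ltr01; apply: filterS fin => x; exact: gE.
- rewrite muE (eq_bigr (fun j => (nu j)%:E)); last by move=> j _; exact: nuE.
  rewrite prodEFin -!EFinM; apply: ereal_le_prod_limit => e e0.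
  by case: (H e e0).
Qed.
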